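(* Let $n,m\ge1$ be integers. For every $s<\frac{n+m}{2(n+m+1)}$ there exists $f\in H^s(\mathbb R^n\times\mathbb T^m)$ such that $$\lim_{t\to0}e^{it\Delta}f(x,y)\neq f(x,y)\qquad\text{for a.e. }(x,y)\in\mathbb R^n\times\mathbb T^m,$$ that is, for almost every $(x,y)$ it is not the case that $e^{it\Delta}f(x,y)$ converges to $f(x,y)$ as $t\to0$.
   Context: $\mathbb T=\mathbb R/\mathbb Z$. For $f$ on $\mathbb R^n\times\mathbb T^m$, $\widehat f(\xi,k)=\int f(x,y)e^{-2\pi i(x\cdot\xi+y\cdot k)}\,dx\,dy$ for $(\xi,k)\in\mathbb R^n\times\mathbb Z^m$. $H^s(\mathbb R^n\times\mathbb T^m)$ is the Sobolev space with norm $\|f\|_{H^s}=\|(1+|\xi|^2+|k|^2)^{s/2}\widehat f\|_{L^2(\mathbb R^n\times\mathbb Z^m)}$. The Schrödinger propagator is the Fourier multiplier with symbol $e^{2\pi it(|\xi|^2+|k|^2)}$: $$e^{it\Delta}f(x,y)=\sum_{k\in\mathbb Z^m}\int_{\mathbb R^n}e^{2\pi i(x\cdot\xi+y\cdot k+t(|\xi|^2+|k|^2))}\widehat f(\xi,k)\,d\xi .$$ When this is not absolutely convergent, the pointwise value $e^{it\Delta}f(x,y)$ is understood as $\lim_{N\to\infty}e^{it\Delta}P_{\le N}f(x,y)$ over dyadic $N$, where $\widehat{P_{\le N}f}(\zeta)=\eta(\zeta/N)\widehat f(\zeta)$, $\eta(\zeta)=\prod_{i=1}^{n+m}\eta_1(\zeta_i)$,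 and $\eta_1:\mathbb R\to[0,1]$ is smooth, even, equal to $1$ on $|x|\le1$ and $0$ on $|x|\ge2$. *)

(* Defs.v *)
From HB Require Import structures.
From mathcomp Require Import all_boot all_order all_algebra.
From mathcomp Require Import all_classical all_reals all_analysis.
From mathcomp Require Import complex.

Set Implicit Arguments.
Unset Strict Implicit.
Unset Printing Implicit Defensive.

Import Order.TTheory GRing.Theory Num.Theory.
Import numFieldNormedType.Exports.

Local Open Scope classical_set_scope.
Local Open Scope ring_scope.
Local Open Scope complex_scope.

HB.instance Definition _ := isPointed.Build int 0.

HB.instance Definition _ := @isMeasurable.Build default_measure_display
  int discrete_measurable discrete_measurable0
  discrete_measurableC discrete_measurableU.

Lemma sigma_finite_counting_int (R : realType) :
  sigma_finite [set: int] (@counting int R).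
Proof.
exists (fun i => [set x : int | (`|x| <= i)%N]).
  by apply/seteqP; split => // x _; exists `|x|%N => /=.
move=> i; split => //; rewrite /counting asboolT ?ltry//.
apply: (@sub_finite_set _ _
  ((Posz @` `I_i.+1) `|` ((fun j => - Posz j) @` `I_i.+1))).
  by case=> j /= ji; [left; exists j|right; exists j.+1].
by rewrite finite_setU; split; apply: finite_image; exact: finite_II.
Qed.

HB.instance Definition _ (R : realType) :=
  @Measure_isSigmaFinite.Build _ _ R (@counting int R)
    (sigma_finite_counting_int R).

(* The n-fold product measure, by recursion on n: the (n+1)-fold product is the
   image of the product of mu with the n-fold one under (a, t) |-> a :: t. *)
Section cons_measure.
Context d (T : measurableType d) (R : realType).
Variables (mu : {sigma_finite_measure set T -> \bar R}) (n : nat).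
Variable nu : {sigma_finite_measure set (n.-tuple T) -> \bar R}.

Let consp (p : T * n.-tuple T) : n.+1.-tuple T := cons_tuple p.1 p.2.

Let measurable_consp : measurable_fun setT consp.
Proof. exact: measurable_cons. Qed.

Definition cons_measure : set (n.+1.-tuple T) -> \bar R :=
  pushforward (mu \x nu)%E consp.

Let m0 : cons_measure set0 = 0%E.
Proof. by rewrite /cons_measure /pushforward preimage_set0 measure0. Qed.

Let m_ge0 A : (0 <= cons_measure A)%E.
Proof. exact: integral_ge0. Qed.

Let m_sigma_additive : semi_sigma_additive cons_measure.
Proof.
move=> F mF tF mUF; rewrite /cons_measure /pushforward preimage_bigcup.
apply: measure_semi_sigma_additive.
- by move=> i; rewrite -[X in measurable X]setTI; exact: measurable_consp.
- apply/trivIsetP => i j _ _ ij; rewrite -preimage_setI.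
  by move/trivIsetP : tF => /(_ _ _ _ _ ij) ->//; rewrite preimage_set0.
- by rewrite -preimage_bigcup -[X in measurable X]setTI; exact: measurable_consp.
Qed.

HB.instance Definition _ :=
  isMeasure.Build _ _ _ cons_measure m0 m_ge0 m_sigma_additive.

Let uncons (t : n.+1.-tuple T) : T * n.-tuple T := (thead t, behead_tuple t).

Let m_sigma_finite : sigma_finite setT cons_measure.
Proof.
have /sigma_finiteP[F [FT ndF Ffin]] := sigma_finiteT mu.
have /sigma_finiteP[G [GT ndG Gfin]] := sigma_finiteT nu.
have munc : measurable_fun setT uncons.
  by apply/measurable_fun_pairP; split;
    [exact: measurable_tnth|exact: measurable_behead].
exists (fun i => uncons @^-1` (F i `*` G i)).
  rewrite -preimage_bigcup; apply/seteqP; split => // t _.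
  have : setT (thead t) by [].
  have : setT (behead_tuple t) by [].
  rewrite {1}GT {1}FT => -[j _ Gj] [i _ Fi]; exists (maxn i j) => //; split.
    by move: Fi; exact/subsetPset/ndF/leq_maxl.
  by move: Gj; exact/subsetPset/ndG/leq_maxr.
move=> i; have [mFi Fi] := Ffin i; have [mGi Gi] := Gfin i; split.
  by rewrite -[X in measurable X]setTI; apply: munc => //; exact: measurableX.
rewrite /cons_measure /pushforward -comp_preimage.
rewrite (_ : uncons \o consp = id) ?preimage_id; last first.
  by apply/funext => -[a t]; rewrite /uncons /consp /=; congr pair;
    apply: val_inj.
by rewrite product_measure1E// lte_mul_pinfty// ge0_fin_numE.
Qed.

HB.instance Definition _ :=
  Measure_isSigmaFinite.Build _ _ _ cons_measure m_sigma_finite.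

End cons_measure.

Fixpoint tuple_measure d (T : measurableType d) (R : realType)
    (mu : {sigma_finite_measure set T -> \bar R}) (n : nat) :
    {sigma_finite_measure set (n.-tuple T) -> \bar R} :=
  match n with
  | 0 => \d_ ([tuple] : 0.-tuple T)
  | n'.+1 => cons_measure mu (tuple_measure mu n')
  end.

Section complex_valued.
Context d (T : measurableType d) (R : realType).
Variable mu : {measure set T -> \bar R}.
Implicit Type g : T -> R[i].

Definition measurable_complex g :=
  measurable_fun setT (fun z => complex.Re (g z)) /\
  measurable_fun setT (fun z => complex.Im (g z)).

Definition integrable_complex g :=
  mu.-integrable setT (fun z => (complex.Re (g z))%:E) /\
  mu.-integrable setT (fun z => (complex.Im (g z))%:E).

Definition integral_complex g : R[i] :=
  (\int[mu]_z complex.Re (g z)) +i* (\int[mu]_z complex.Im (g z)).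

Definition L2norm g : \bar R := Lnorm mu 2%:E (fun z => (Normc.normc (g z))%:E).

End complex_valued.

(* e^{2 pi i theta} *)
Definition expi2pi (R : realType) (theta : R) : R[i] :=
  cos (2 * pi * theta) +i* sin (2 * pi * theta).

(* Functions on R^n x T^m are represented by functions on R^n x R^m that are
   1-periodic in each of the last m variables. *)
Notation phys R n m := (n.-tuple (measurableTypeR R) * m.-tuple (measurableTypeR R))%type.
Notation freq R n m := (n.-tuple (measurableTypeR R) * m.-tuple int)%type.

Section torus_measure.
Variable R : realType.

Lemma measurable_fundamental : measurable (`[0, 1[ : set (measurableTypeR R)).
Proof. exact: measurable_itv. Qed.

Lemma lebesgue_fundamental_lty :
  (lebesgue_measure (`[0%R, 1%R[ : set (measurableTypeR R)) < +oo)%E.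
Proof. by rewrite lebesgue_measure_itv /= lte_fin ltr01 oppr0 adde0 ltry. Qed.

Definition circle_measure : {sigma_finite_measure set (measurableTypeR R) -> \bar R} :=
  mfrestr measurable_fundamental lebesgue_fundamental_lty.

End torus_measure.

Section mixed_space.
Variables (R : realType) (n m : nat).
Implicit Types (p : phys R n m) (z : freq R n m).
Implicit Types (f : phys R n m -> R[i]) (F : freq R n m -> R[i]).

Definition phys_measure : {measure set (phys R n m) -> \bar R} :=
  (tuple_measure lebesgue_measure n \x tuple_measure (circle_measure R) m)%E.

(* The m-fold product of the counting measure on Z is the counting measure on
   Z^m, so that integrating against freq_measure is summing over k and
   integrating over xi. *)
Definition freq_measure : {measure set (freq R n m) -> \bar R} :=
  (tuple_measure lebesgue_measure n \x tuple_measure (@counting int R) m)%E.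

Definition pairing p z : R :=
  \sum_(i < n) tnth p.1 i * tnth z.1 i
  + \sum_(j < m) tnth p.2 j * (tnth z.2 j)%:~R.

Definition sqnorm z : R :=
  \sum_(i < n) tnth z.1 i ^+ 2 + \sum_(j < m) (tnth z.2 j)%:~R ^+ 2.

Definition periodic f : Prop :=
  forall (x : n.-tuple (measurableTypeR R)) (y : m.-tuple (measurableTypeR R)) (k : m.-tuple int),
    f (x, [tuple tnth y j + (tnth k j)%:~R | j < m]) = f (x, y).

Definition fourierL1 f : freq R n m -> R[i] := fun z =>
  integral_complex phys_measure (fun p => f p * expi2pi (- pairing p z)).

Definition truncate (r : R) f : phys R n m -> R[i] := fun p =>
  if \sum_(i < n) tnth p.1 i ^+ 2 <= r ^+ 2 then f p else 0.

(* The Fourier transform of a square-integrable f need not be given by an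
   absolutely convergent integral: it is the limit in L^2 of the transforms of
   the truncations of f to |x| <= r, determined up to a null set. *)
Definition fourier_transform f F : Prop :=
  measurable_complex F /\
  L2norm freq_measure (fun z => F z - fourierL1 (truncate j%:R f) z)
    @[j --> \oo] --> 0%E.

Definition sobolev_norm (s : R) F : \bar R :=
  L2norm freq_measure (fun z => ((1 + sqnorm z) `^ (s / 2))%:C * F z).

(* f is a square-integrable function in H^s, with Fourier transform F. For
   s >= 0 square-integrability follows from the finiteness of the norm; for
   s < 0 it selects the elements of H^s that are square-integrable functions,
   among distributions. *)
Definition sobolev (s : R) f F : Prop :=
  [/\ periodic f,
      measurable_complex f, (L2norm phys_measure f < +oo)%E,
      fourier_transform f F
    & (sobolev_norm s F < +oo)%E].

Definition cutoff (eta1 : R -> R) : Prop :=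
  [/\ forall (k : nat) (x : R), derivable (derive1n k eta1) x 1,
      forall x, 0 <= eta1 x <= 1,
      forall x, eta1 (- x) = eta1 x,
      forall x, `|x| <= 1 -> eta1 x = 1
    & forall x, 2 <= `|x| -> eta1 x = 0].

Definition eta (eta1 : R -> R) (N : R) z : R :=
  (\prod_(i < n) eta1 (tnth z.1 i / N))
  * \prod_(j < m) eta1 ((tnth z.2 j)%:~R / N).

Definition schrodinger_integrand F (t : R) p : freq R n m -> R[i] := fun z =>
  expi2pi (pairing p z + t * sqnorm z) * F z.

Definition schrodinger_P (eta1 : R -> R) F (t : R) p (N : R) : R[i]^o :=
  integral_complex freq_measure
    (schrodinger_integrand (fun z => (eta eta1 N z)%:C * F z) t p).

(* Whether e^{it Delta} f has a value at p, where F is the Fourier transform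
   of f, and this value. The limit is over the dyadic numbers N = 2^j. *)
Definition schrodinger_defined (eta1 : R -> R) F (t : R) p : Prop :=
  integrable_complex freq_measure (schrodinger_integrand F t p) \/
  cvgn (fun j => schrodinger_P eta1 F t p (2 ^+ j)).

Definition schrodinger (eta1 : R -> R) F (t : R) p : R[i]^o :=
  if `[< integrable_complex freq_measure (schrodinger_integrand F t p) >]
  then integral_complex freq_measure (schrodinger_integrand F t p)
  else limn (fun j => schrodinger_P eta1 F t p (2 ^+ j)).

(* The limit as t -> 0 of the partially defined function
   t |-> e^{it Delta} f (p), hence along the times where it has a value. *)
Definition schrodinger_tends_to (eta1 : R -> R) F p (l : R[i]) : Prop :=
  schrodinger eta1 F t p
    @[t --> within [set t | schrodinger_defined eta1 F t p] 0^']
    --> (l : R[i]^o).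

End mixed_space.

(* Main.v *)
(* Put d = n + m and let B be a large power of 2. A wave packet is a tensor product: in x_0 it
   is a tent of width about B^-(d + 1) modulated at frequency R = B^(2 d + 2), in each other
   Euclidean variable a tent of width about 1 times a sum of about B exponentials, and in each
   torus variable a sum of about B exponentials; these exponentials have the frequencies
   th + D l, where D is about B^(2 d + 1) and l is in [B / 32, B / 16).
   At a time t = p / D^2 the terms e(t D^2 l^2) equal 1, so the sum over l is coherent as
   soon as D u + 2 t D th is close to an integer, u being the spatial variable. Taking
   th = D / (2 B^i) in the i-th variable turns this into D u_i + p / B^i being close to an
   integer. The first variable moves at speed 2 R and selects a window of B^(d - 1)
   consecutive values of p, in which the base B digits of p solve the remaining d - 1
   conditions. Hence on a fixed open set of x, for every y, the packet is at some small time
   coherent in all variables at once, while its H^s norm is small when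
   s < d / (2 (d + 1)).
   A lacunary sum of such packets, each placed infinitely often at each of countably many
   locations, diverges almost everywhere: at the times of the k-th packet the earlier ones
   are bounded by the L^1 norms of their transforms, and the later ones are negligible for
   almost every y because the mean square over the torus controls them, uniformly in x. *)

Require Import Defs.
From HB Require Import structures.
From mathcomp Require Import all_boot all_order all_algebra.
From mathcomp Require Import all_classical all_reals all_analysis.
From mathcomp Require Import complex measurable_realfun.
From mathcomp Require Import zify ring lra.

Set Implicit Arguments.
Unset Strict Implicit.
Unset Printing Implicit Defensive.

Import Order.TTheory GRing.Theory Num.Theory.
Import numFieldNormedType.Exports.

Local Open Scope classical_set_scope.
Local Open Scope ring_scope.
Local Open Scope complex_scope.

(** The exponents balance as follows. One step of p moves the first variable by 2 R / D^2, about
    B^(-2 d), so a window of B^(d - 1) values of p moves it by about its width B^(-d - 1): every p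
    in the window is admissible for it, and d - 1 digits remain free. At its peak a packet of
    amplitude c has size about c B^(d - 1), while for s >= 0 its squared H^s norm is at most about
    c^2 B^(4 (d + 1) s - 2). A choice of c makes the first large and the second small when s < d /
    (2 (d + 1)). Two features answer to the definitions. The value of the propagator is a limit over
    dyadic cutoffs, so bounds have to be uniform in the cutoff: the torus frequencies of one packet
    fill a single dyadic interval, on which all cutoffs but one are 0 or 1. The transform is a limit
    over truncations to balls: each packet lives strictly between two consecutive spheres of integer
    radius, so a truncation keeps it or removes it entirely. Tents have compact support and
    nonnegative integrable transforms, so that a lower bound at the peak is a matter of phases
    alone. *)

Local Notation cRe := complex.Re.
Local Notation cIm := complex.Im.
Local Notation normc := Normc.normc.

(** * Complex numbers and the characters e(theta) *)

Section complex_numbers.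
Variable R : realType.
Implicit Types z w : R[i].

Lemma cReD z w : cRe (z + w) = cRe z + cRe w. Proof. by case: z w => ? ? []. Qed.
Lemma cImD z w : cIm (z + w) = cIm z + cIm w. Proof. by case: z w => ? ? []. Qed.
Lemma cReM z w : cRe (z * w) = cRe z * cRe w - cIm z * cIm w.
Proof. by case: z w => ? ? []. Qed.
Lemma cImM z w : cIm (z * w) = cRe z * cIm w + cIm z * cRe w.
Proof. by case: z w => ? ? []. Qed.
Lemma cReB z w : cRe (z - w) = cRe z - cRe w. Proof. by case: z w => ? ? []. Qed.
Lemma cImB z w : cIm (z - w) = cIm z - cIm w. Proof. by case: z w => ? ? []. Qed.

Lemma complex_ext z w : cRe z = cRe w -> cIm z = cIm w -> z = w.
Proof. by case: z w => ? ? [] ? ? /= -> ->. Qed.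

Lemma cRe_sum I (r : seq I) (P : pred I) (F : I -> R[i]) :
  cRe (\sum_(i <- r | P i) F i) = \sum_(i <- r | P i) cRe (F i).
Proof. by apply: (big_morph _ cReD). Qed.

Lemma cIm_sum I (r : seq I) (P : pred I) (F : I -> R[i]) :
  cIm (\sum_(i <- r | P i) F i) = \sum_(i <- r | P i) cIm (F i).
Proof. by apply: (big_morph _ cImD). Qed.

Lemma sqr_normc2 z : normc z ^+ 2 = cRe z ^+ 2 + cIm z ^+ 2.
Proof. by case: z => a b /=; rewrite sqr_sqrtr// addr_ge0// sqr_ge0. Qed.

Lemma normc_ge0 z : 0 <= normc z.
Proof. by case: z => a b /=; exact: sqrtr_ge0. Qed.

Lemma normr_cRe_le z : `|cRe z| <= normc z.
Proof.
case: z => a b /=; rewrite -sqrtr_sqr ler_wsqrtr// lerDl; exact: sqr_ge0.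
Qed.

Lemma normr_cIm_le z : `|cIm z| <= normc z.
Proof.
case: z => a b /=; rewrite -sqrtr_sqr ler_wsqrtr// lerDr; exact: sqr_ge0.
Qed.

Lemma normc_le_ReIm z : normc z <= `|cRe z| + `|cIm z|.
Proof.
rewrite -(@ler_pXn2r _ 2)// ?nnegrE ?normc_ge0 ?addr_ge0//.
rewrite sqr_normc2 sqrrD !real_normK ?num_real// [leRHS]addrAC lerDl.
by rewrite mulrn_wge0// mulr_ge0.
Qed.

Lemma normc_sum I (r : seq I) (P : pred I) (F : I -> R[i]) :
  normc (\sum_(i <- r | P i) F i) <= \sum_(i <- r | P i) normc (F i).
Proof.
elim/big_rec2 : _ => [|i y1 y2 Pi h]; first by rewrite Normc.normc0.
by apply: le_trans (le_normcD _ _) _; rewrite lerD2l.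
Qed.

Lemma normc_prod I (r : seq I) (P : pred I) (F : I -> R[i]) :
  normc (\prod_(i <- r | P i) F i) = \prod_(i <- r | P i) normc (F i).
Proof.
by apply: (big_morph _ (@Normc.normcM _)); rewrite Normc.normc1.
Qed.

Lemma normc_real (x : R) : normc x%:C = `|x|.
Proof. by rewrite /= expr0n/= addr0 sqrtr_sqr. Qed.

Lemma normr_normc z : `|z| = (normc z)%:C.
Proof. by case: z => a b; rewrite normc_def. Qed.

Lemma expi2pi0 : expi2pi 0 = 1 :> R[i].
Proof. by rewrite /expi2pi mulr0 cos0 sin0. Qed.

Lemma expi2piD (a b : R) : expi2pi (a + b) = expi2pi a * expi2pi b.
Proof.
rewrite /expi2pi mulrDr cosD sinD; apply: complex_ext => /=; first by [].
by rewrite addrC [X in _ + X]mulrC; congr (_ + _); rewrite mulrC.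
Qed.

Lemma normc_expi2pi (a : R) : normc (expi2pi a) = 1.
Proof. by rewrite /= cos2Dsin2 sqrtr1. Qed.

Lemma expi2pi_sum I (r : seq I) (P : pred I) (F : I -> R) :
  expi2pi (\sum_(i <- r | P i) F i) = \prod_(i <- r | P i) expi2pi (F i).
Proof. by apply: (big_morph _ expi2piD); exact: expi2pi0. Qed.

Lemma expi2pi_int (k : int) : expi2pi k%:~R = 1 :> R[i].
Proof.
have nat_case (j : nat) : expi2pi j%:R = 1 :> R[i].
  have -> : expi2pi j%:R = cos (0 + pi *+ 2 *+ j) +i* sin (0 + pi *+ 2 *+ j) :> R[i].
    by rewrite /expi2pi add0r mulr_natr mulr_natl.
  by rewrite (periodicn (@cosD2pi R)) (periodicn (@sinD2pi R)) cos0 sin0.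
case: k => j; first exact: nat_case.
rewrite NegzE mulrNz.
have := nat_case j.+1; have := expi2piD (- j.+1%:R) j.+1%:R.
by rewrite addNr expi2pi0 => E N; rewrite N mulr1 in E; rewrite -E.
Qed.

Lemma expi2piDint (a : R) (k : int) : expi2pi (a + k%:~R) = expi2pi a.
Proof. by rewrite expi2piD expi2pi_int mulr1. Qed.

End complex_numbers.

(** * Complex-valued integrals *)

Section complex_integral.
Context d (T : measurableType d) (R : realType) (mu : {measure set T -> \bar R}).
Implicit Types (g h : T -> R[i]) (f : T -> R).

Lemma cRe_integral g : cRe (integral_complex mu g) = \int[mu]_x cRe (g x).
Proof. by []. Qed.

Lemma cIm_integral g : cIm (integral_complex mu g) = \int[mu]_x cIm (g x).
Proof. by []. Qed.

Lemma measurable_normc g : measurable_complex g ->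
  measurable_fun setT (fun x => normc (g x)).
Proof.
move=> [mr mi].
rewrite (_ : (fun x => _) = (fun x => Num.sqrt (cRe (g x) ^+ 2 + cIm (g x) ^+ 2))); last first.
  by apply/funext => x; case: (g x).
apply: measurableT_comp; first by apply: continuous_measurable_fun; exact: sqrt_continuous.
by apply: measurable_funD; apply: measurable_funX.
Qed.

Lemma measurable_complexM g h : measurable_complex g -> measurable_complex h ->
  measurable_complex (fun x => g x * h x).
Proof.
move=> [gr gi] [hr hi]; split.
  under eq_fun do rewrite cReM.
  by apply: measurable_funB; apply: measurable_funM.
under eq_fun do rewrite cImM.
by apply: measurable_funD; apply: measurable_funM.
Qed.

Lemma measurable_complex_real f : measurable_fun setT f ->
  measurable_complex (fun x => (f x)%:C).
Proof. by move=> mf; split => //=; exact: measurable_cst. Qed.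

Lemma measurable_complex_cst (c : R[i]) : measurable_complex (fun _ : T => c).
Proof. by split; exact: measurable_cst. Qed.

Lemma measurable_complex_expi2pi f : measurable_fun setT f ->
  measurable_complex (fun x => expi2pi (f x)).
Proof.
move=> mf; split => /=.
  apply: measurableT_comp; first exact: continuous_measurable_fun (@continuous_cos R).
  exact: measurable_funM.
apply: measurableT_comp; first exact: continuous_measurable_fun (@continuous_sin R).
exact: measurable_funM.
Qed.

Lemma measurable_complex_sum I (r : seq I) (P : pred I) (F : I -> T -> R[i]) :
  (forall i, P i -> measurable_complex (F i)) ->
  measurable_complex (fun x => \sum_(i <- r | P i) F i x).
Proof.
move=> mF; split.
  under eq_fun do rewrite cRe_sum big_mkcond.
  apply: measurable_sum => i; case: (boolP (P i)) => Pi; [exact: (mF i Pi).1|exact: measurable_cst].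
under eq_fun do rewrite cIm_sum big_mkcond.
apply: measurable_sum => i; case: (boolP (P i)) => Pi; [exact: (mF i Pi).2|exact: measurable_cst].
Qed.

Lemma measurable_complex_prod I (r : seq I) (P : pred I) (F : I -> T -> R[i]) :
  (forall i, P i -> measurable_complex (F i)) ->
  measurable_complex (fun x => \prod_(i <- r | P i) F i x).
Proof.
move=> mF; elim: r => [|i r IH].
  by under eq_fun do rewrite big_nil; exact: measurable_complex_cst.
under eq_fun do rewrite big_cons.
by case: (boolP (P i)) => Pi //; apply: measurable_complexM => //; exact: mF.
Qed.

Lemma integrable_complex_normc g : measurable_complex g ->
  mu.-integrable setT (fun x => (normc (g x))%:E) -> integrable_complex mu g.
Proof.
move=> [mr mi] ig; split.
- apply: le_integrable ig => //; first exact/measurable_EFinP.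
  by move=> x _; rewrite /= lee_fin (ger0_norm (normc_ge0 _)) normr_cRe_le.
- apply: le_integrable ig => //; first exact/measurable_EFinP.
  by move=> x _; rewrite /= lee_fin (ger0_norm (normc_ge0 _)) normr_cIm_le.
Qed.

Lemma integrable_complex_measurable g : integrable_complex mu g -> measurable_complex g.
Proof.
by move=> [ir ii]; split; apply/measurable_EFinP; [exact: measurable_int ir|exact: measurable_int ii].
Qed.

Lemma integrable_normc g : integrable_complex mu g ->
  mu.-integrable setT (fun x => (normc (g x))%:E).
Proof.
move=> ig; have mg := integrable_complex_measurable ig; case: ig => ir ii.
have iD := integrableD measurableT (integrable_abse ir) (integrable_abse ii).
apply: le_integrable iD => //.
  by apply/measurable_EFinP; exact: measurable_normc.
move=> x _ /=; rewrite lee_fin ger0_norm ?normc_ge0//.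
by rewrite ger0_norm ?addr_ge0// normc_le_ReIm.
Qed.

Lemma integrable_complexP g : integrable_complex mu g <->
  measurable_complex g /\ mu.-integrable setT (fun x => (normc (g x))%:E).
Proof.
split=> [ig|[mg ig]]; last exact: integrable_complex_normc.
by split; [exact: integrable_complex_measurable|exact: integrable_normc].
Qed.

Lemma integrable_complex_le g f : measurable_complex g ->
  mu.-integrable setT (fun x => (f x)%:E) -> (forall x, normc (g x) <= f x) ->
  integrable_complex mu g.
Proof.
move=> mg jf gf; apply/integrable_complexP; split => //.
apply: le_integrable jf => //.
  by apply/measurable_EFinP; exact: measurable_normc.
move=> x _; rewrite /= lee_fin ger0_norm ?normc_ge0//.
exact: le_trans (gf x) (ler_norm _).
Qed.

Lemma integrable_complexMb g h : integrable_complex mu g -> measurable_complex h ->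
  (forall x, normc (h x) <= 1) -> integrable_complex mu (fun x => h x * g x).
Proof.
move=> ig mh h1; apply: (integrable_complex_le _ (integrable_normc ig)).
  by apply: measurable_complexM => //; exact: integrable_complex_measurable.
by move=> x; rewrite Normc.normcM ler_piMl ?normc_ge0.
Qed.

Lemma integrable_complexZ (c : R[i]) g : integrable_complex mu g ->
  integrable_complex mu (fun x => c * g x).
Proof.
move=> ig; have iz := integrableZl measurableT (normc c) (integrable_normc ig).
apply: (integrable_complex_le (f := fun x => normc c * normc (g x))).
- apply: measurable_complexM; first exact: measurable_complex_cst.
  exact: integrable_complex_measurable.
- by apply: eq_integrable iz => // x _; rewrite EFinM.
- by move=> x; rewrite Normc.normcM.
Qed.

Lemma integrable_complex_real f : mu.-integrable setT (fun x => (f x)%:E) ->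
  integrable_complex mu (fun x => (f x)%:C).
Proof. by move=> jf; split => //=; exact: integrable0. Qed.

Lemma integrable_complex_sum I (r : seq I) (P : pred I) (F : I -> T -> R[i]) :
  (forall i, P i -> integrable_complex mu (F i)) ->
  integrable_complex mu (fun x => \sum_(i <- r | P i) F i x).
Proof.
move=> jF; split.
  apply: (@eq_integrable _ _ _ _ _ _ (fun x => (\sum_(i <- r | P i) (cRe (F i x))%:E)%E)) => //.
    by move=> x _; rewrite sumEFin cRe_sum.
  by apply: integrable_sum => // i Pi; exact: (jF i Pi).1.
apply: (@eq_integrable _ _ _ _ _ _ (fun x => (\sum_(i <- r | P i) (cIm (F i x))%:E)%E)) => //.
  by move=> x _; rewrite sumEFin cIm_sum.
by apply: integrable_sum => // i Pi; exact: (jF i Pi).2.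
Qed.

Lemma eq_integral_complex g h : (forall x, g x = h x) ->
  integral_complex mu g = integral_complex mu h.
Proof. by move=> gh; congr integral_complex; exact/funext. Qed.

Lemma integral_complex_sum I (r : seq I) (F : I -> T -> R[i]) :
  (forall i, integrable_complex mu (F i)) ->
  integral_complex mu (fun x => \sum_(i <- r) F i x) =
  \sum_(i <- r) integral_complex mu (F i).
Proof.
move=> jF; apply: complex_ext; rewrite ?cRe_sum ?cIm_sum /=.
  under eq_Rintegral do rewrite cRe_sum.
  rewrite /Rintegral; under eq_integral do rewrite -sumEFin.
  rewrite integral_sum//; last by move=> i; exact: (jF i).1.
  by rewrite -sum_fine// => i _; apply: integrable_fin_num => //; exact: (jF i).1.
under eq_Rintegral do rewrite cIm_sum.
rewrite /Rintegral; under eq_integral do rewrite -sumEFin.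
rewrite integral_sum//; last by move=> i; exact: (jF i).2.
by rewrite -sum_fine// => i _; apply: integrable_fin_num => //; exact: (jF i).2.
Qed.

Lemma integral_complexZ (c : R[i]) g : integrable_complex mu g ->
  integral_complex mu (fun x => c * g x) = c * integral_complex mu g.
Proof.
move=> [ir ii]; apply: complex_ext; rewrite ?cReM ?cImM /=.
  under eq_Rintegral do rewrite cReM.
  rewrite RintegralB//; last 2 first.
    - by apply: eq_integrable (integrableZl measurableT (cRe c) ir) => // x _; rewrite EFinM.
    - by apply: eq_integrable (integrableZl measurableT (cIm c) ii) => // x _; rewrite EFinM.
  by rewrite !RintegralZl.
under eq_Rintegral do rewrite cImM.
rewrite RintegralD//; last 2 first.
  - by apply: eq_integrable (integrableZl measurableT (cRe c) ii) => // x _; rewrite EFinM.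
  - by apply: eq_integrable (integrableZl measurableT (cIm c) ir) => // x _; rewrite EFinM.
by rewrite !RintegralZl.
Qed.

Lemma integral_complex_real f :
  integral_complex mu (fun x => (f x)%:C) = (\int[mu]_x f x)%:C.
Proof.
apply: complex_ext => //=; rewrite /Rintegral integral0_eq//.
Qed.

(* The factor 2 comes from treating real and imaginary parts separately. *)
Lemma normc_integral_le g f : integrable_complex mu g ->
  mu.-integrable setT (fun x => (f x)%:E) -> (forall x, normc (g x) <= f x) ->
  normc (integral_complex mu g) <= 2 * \int[mu]_x f x.
Proof.
move=> [ir ii] jf gf; apply: le_trans (normc_le_ReIm _) _ => /=.
rewrite mulr_natl mulr2n lerD//; apply: le_trans (le_normr_Rintegral _ _) _ => //;
  (apply: le_Rintegral => //; first exact: (integrable_norm (D := setT))).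
- by move=> x _; apply: le_trans (gf x); exact: normr_cRe_le.
- by move=> x _; apply: le_trans (gf x); exact: normr_cIm_le.
Qed.

End complex_integral.

(** * Tensor products and Fubini *)

Section tensor.
Context d1 d2 (T1 : measurableType d1) (T2 : measurableType d2) (R : realType).
Variable m1 : {sigma_finite_measure set T1 -> \bar R}.
Variable m2 : {sigma_finite_measure set T2 -> \bar R}.

Lemma measurable_tensor (f : T1 -> R) (g : T2 -> R) :
  measurable_fun setT f -> measurable_fun setT g ->
  measurable_fun setT (fun p : T1 * T2 => f p.1 * g p.2).
Proof.
by move=> mf mg; apply: measurable_funM; apply: measurableT_comp.
Qed.

Lemma integrable_tensor (f : T1 -> R) (g : T2 -> R) :
  m1.-integrable setT (EFin \o f) -> m2.-integrable setT (EFin \o g) ->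
  (m1 \x m2)%E.-integrable setT (fun p => (f p.1 * g p.2)%:E).
Proof.
move=> jf jg.
have mf : measurable_fun setT f by apply/measurable_EFinP; exact: measurable_int jf.
have mg : measurable_fun setT g by apply/measurable_EFinP; exact: measurable_int jg.
apply/integrable12ltyP.
  by apply/measurable_EFinP; exact: measurable_tensor.
under eq_integral => x _.
  under eq_integral => y _ do rewrite /= normrM EFinM.
  rewrite ge0_integralZl//; last first.
    by apply/measurable_EFinP; apply: measurableT_comp.
  rewrite muleC.
  over.
rewrite ge0_integralZl//.
- rewrite lte_mul_pinfty//.
  + exact: integral_ge0.
  + by have /integrableP[_] := jg; rewrite ge0_fin_numE//; exact: integral_ge0.
  + by have /integrableP[] := jf.
- by apply/measurable_EFinP; apply: measurableT_comp.
- exact: integral_ge0.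
Qed.

Lemma Rintegral_tensor (f : T1 -> R) (g : T2 -> R) :
  m1.-integrable setT (EFin \o f) -> m2.-integrable setT (EFin \o g) ->
  \int[(m1 \x m2)%E]_p (f p.1 * g p.2) = (\int[m1]_x f x) * (\int[m2]_y g y).
Proof.
move=> jf jg; rewrite /Rintegral -integral12_prod_meas1; last exact: integrable_tensor.
rewrite /fubini_F /=.
under eq_integral => x _.
  under eq_integral => y _ do rewrite EFinM.
  rewrite integralZl// -(fineK (integrable_fin_num measurableT jg)) -EFinM mulrC EFinM.
  over.
rewrite integralZl// fineM//; last exact: integrable_fin_num.
by rewrite mulrC.
Qed.

Lemma integrable_complex_tensor (g : T1 -> R[i]) (h : T2 -> R[i]) :
  integrable_complex m1 g -> integrable_complex m2 h ->
  integrable_complex (m1 \x m2)%E (fun p => g p.1 * h p.2).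
Proof.
move=> jg jh; apply/integrable_complexP; split.
  have [mgr mgi] := integrable_complex_measurable jg.
  have [mhr mhi] := integrable_complex_measurable jh.
  apply: measurable_complexM; split.
  - exact: (measurableT_comp mgr measurable_fst).
  - exact: (measurableT_comp mgi measurable_fst).
  - exact: (measurableT_comp mhr measurable_snd).
  - exact: (measurableT_comp mhi measurable_snd).
under eq_fun do rewrite Normc.normcM.
have ng := integrable_normc jg; have nh := integrable_normc jh.
exact: (@integrable_tensor (fun x => normc (g x)) (fun y => normc (h y)) ng nh).
Qed.

Lemma integral_complex_tensor (g : T1 -> R[i]) (h : T2 -> R[i]) :
  integrable_complex m1 g -> integrable_complex m2 h ->
  integral_complex (m1 \x m2)%E (fun p => g p.1 * h p.2) =
  integral_complex m1 g * integral_complex m2 h.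
Proof.
move=> [gr gi] [hr hi]; apply: complex_ext; rewrite ?cReM ?cImM !cRe_integral !cIm_integral.
  under eq_Rintegral do rewrite cReM.
  rewrite RintegralB; [|by []|exact: (integrable_tensor gr hr)|exact: (integrable_tensor gi hi)].
  by rewrite (Rintegral_tensor gr hr) (Rintegral_tensor gi hi).
under eq_Rintegral do rewrite cImM.
rewrite RintegralD; [|by []|exact: (integrable_tensor gr hi)|exact: (integrable_tensor gi hr)].
by rewrite (Rintegral_tensor gr hi) (Rintegral_tensor gi hr).
Qed.

End tensor.

Section tuple_tensor.
Context d (T : measurableType d) (R : realType).
Variable mu : {sigma_finite_measure set T -> \bar R}.

(** By induction on n: [tuple_measure] is the image of a product measure under cons, so the integral
    is pulled back along cons and the first factor splits off. The empty product is integrated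
    against a Dirac mass. *)
Lemma tuple_tensor n (g : 'I_n -> T -> R[i]) :
  (forall i, integrable_complex mu (g i)) ->
  integrable_complex (tuple_measure mu n) (fun x => \prod_i g i (tnth x i)) /\
  integral_complex (tuple_measure mu n) (fun x => \prod_i g i (tnth x i)) =
  \prod_i integral_complex mu (g i).
Proof.
elim: n g => [|n IH] g jg.
  under eq_fun do rewrite big_ord0.
  rewrite big_ord0 /=; split.
    split; apply/integrableP; split; try exact: measurable_cst;
      by rewrite integral_dirac// diracT mul1e /= ltry.
  by apply: complex_ext => /=; rewrite /Rintegral integral_dirac// diracT mul1e.
have [] := IH (fun i => g (lift ord0 i)) (fun i => jg _).
set G := (X in integrable_complex _ X) => jG iG.
pose c (p : T * n.-tuple T) : n.+1.-tuple T := cons_tuple p.1 p.2.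
have mc : measurable_fun setT c by exact: measurable_cons.
have jt := integrable_complex_tensor (jg ord0) jG.
have it := integral_complex_tensor (jg ord0) jG.
set F := (fun x : n.+1.-tuple T => \prod_i g i (tnth x i)).
have Fc p : F (c p) = g ord0 p.1 * G p.2.
  rewrite /F big_ord_recl; congr (_ * _); apply: eq_bigr => i _.
  by rewrite tnthS; congr (g _ (tnth _ _)); apply: val_inj.
have mF : measurable_complex F.
  apply: measurable_complex_prod => i _.
  have [mr mi] := integrable_complex_measurable (jg i).
  by split; [apply: (measurableT_comp mr)|apply: (measurableT_comp mi)]; exact: measurable_tnth.
have FcE : F \o c = fun p => g ord0 p.1 * G p.2 by exact/funext/Fc.
have [mFr mFi] := mF.
have [jFr jFi] : integrable_complex (mu \x tuple_measure mu n)%E (F \o c) by rewrite FcE.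
have eR := @integral_pushforward _ _ _ _ R _ mc (mu \x tuple_measure mu n)%E setT
  (fun x => (cRe (F x))%:E).
have eI := @integral_pushforward _ _ _ _ R _ mc (mu \x tuple_measure mu n)%E setT
  (fun x => (cIm (F x))%:E).
rewrite preimage_setT in eR eI.
split.
  split.
    apply: (@integrable_pushforward _ _ _ _ R _ mc (mu \x tuple_measure mu n)%E setT
      (fun x => (cRe (F x))%:E)) => //; first exact/measurable_EFinP.
  apply: (@integrable_pushforward _ _ _ _ R _ mc (mu \x tuple_measure mu n)%E setT
    (fun x => (cIm (F x))%:E)) => //; exact/measurable_EFinP.
rewrite big_ord_recl -iG -it -FcE.
apply: complex_ext; rewrite !(cRe_integral, cIm_integral) /Rintegral.
  by congr fine; apply: eR => //; exact/measurable_EFinP.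
by congr fine; apply: eI => //; exact/measurable_EFinP.
Qed.
End tuple_tensor.

(** * Integration over intervals, the circle and the integers *)

Section one_dimension.
Variable R : realType.
Local Notation leb := (@lebesgue_measure R).

Lemma Rintegral_derivative (F f : R -> R) (a b : R) : a < b -> continuous f ->
  (forall x : R, is_derive x 1 F (f x)) -> \int[leb]_(x in `[a, b]) f x = F b - F a.
Proof.
move=> ab cf dF; rewrite /Rintegral (@continuous_FTC2 _ f F)//.
- exact: continuous_subspaceT.
- have cF x : {for x, continuous F}.
    by apply/differentiable_continuous/derivable1_diffP; case: (dF x).
  split.
  + by move=> x _; case: (dF x).
  + exact/cvg_at_right_filter/cF.
  + exact/cvg_at_left_filter/cF.
- by move=> x _; rewrite derive1E (@derive_val _ _ _ _ _ _ _ (dF x)).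
Qed.

Lemma continuous_cos_affine (w c : R) : continuous (fun x => cos (w * x + c) : R).
Proof.
move=> x; apply: continuous_comp; last exact: continuous_cos.
by apply: continuousD; [apply: mulrl_continuous|exact: cvg_cst].
Qed.

Lemma Rintegral_cos (w c a b : R) : a < b -> w != 0 ->
  \int[leb]_(x in `[a, b]) cos (w * x + c) = (sin (w * b + c) - sin (w * a + c)) / w.
Proof.
move=> ab w0.
have dF (x : R) : is_derive x 1 (fun x => w^-1 * sin (w * x + c)) (cos (w * x + c)).
  have dl : is_derive x 1 (fun x => w * x + c) w.
    have -> : (fun x : R => w * x + c) = w *: (id : R -> R) + cst c by [].
    by apply: is_derive_eq; rewrite addr0 /GRing.scale /= mulr1.
  have ds := @is_derive1_comp _ sin (fun x => w * x + c) x _ _ (is_derive_sin _) dl.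
  have := @is_deriveZ _ _ _ _ w^-1 x 1 _ ds.
  by rewrite /GRing.scale /= mulrCA mulVf// mulr1; exact.
rewrite (Rintegral_derivative ab (@continuous_cos_affine _ _) dF).
by rewrite mulrC [X in _ - X]mulrC -mulrBl.
Qed.

End one_dimension.

Section circle.
Variable R : realType.
Local Notation leb := (@lebesgue_measure R).
Local Notation circ := (circle_measure R).

Lemma circle_integrable (f : R -> R) (M : R) : measurable_fun setT f ->
  (forall x, `|f x| <= M) -> circ.-integrable setT (EFin \o f).
Proof.
move=> mf fM; apply: measurable_bounded_integrable => //.
  by rewrite /circle_measure /= /mfrestr /mrestr setTI lebesgue_fundamental_lty.
exists M; split; first exact: num_real.
by move=> y My x _ /=; apply: le_trans (fM x) (ltW My).
Qed.

Lemma circle_Rintegral (f : R -> R) : circ.-integrable setT (EFin \o f) ->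
  \int[circ]_x f x = \int[leb]_(x in `[0, 1]) f x.
Proof.
move=> jf; rewrite /Rintegral; congr fine.
rewrite -integral_itv_bndo_bndc; last by apply: measurable_funTS; exact: measurable_int jf.
rewrite (@negligible_integral _ _ _ _ _ (~` (`[0%R, 1%R[ : set (measurableTypeR R))))//; last 2 first.
  exact: measurableC.
  by rewrite /circle_measure /= /mfrestr /mrestr setICl measure0.
rewrite setTD setCK; apply: eq_measure_integral => A mA A01.
by rewrite /circle_measure /= /mfrestr /mrestr setIidl.
Qed.

(** A nonzero integer frequency completes whole periods, so the boundary terms cancel. The shift c
    leaves room for the phases t k^2 of the evolution. *)
Lemma circle_cos (k : int) (c : R) :
  \int[circ]_y cos (2 * pi * (k%:~R * y + c)) = (k == 0)%:R * cos (2 * pi * c).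
Proof.
rewrite circle_Rintegral; last first.
  apply: (@circle_integrable _ 1) => [|x]; last exact: cos_max.
  apply: measurableT_comp; first exact: continuous_measurable_fun (@continuous_cos R).
  by apply: measurable_funM => //; apply: measurable_funD => //; exact: measurable_funM.
under eq_Rintegral do rewrite mulrDr mulrA.
have [->|k0] := eqVneq k 0.
  under eq_Rintegral do rewrite mulr0 mul0r add0r.
  by rewrite Rintegral_cst//= lebesgue_measure_itv/= lte01 oppr0 adde0 mulr1 mul1r.
have w0 : 2 * pi * k%:~R != 0 :> R by rewrite !mulf_neq0 ?intr_eq0// gt_eqF// pi_gt0.
rewrite Rintegral_cos// mulr0 add0r mulr1 mul0r.
have -> : sin (2 * pi * k%:~R + 2 * pi * c) = sin (2 * pi * c) :> R.
  by have := expi2piDint c k; rewrite /expi2pi mulrDr addrC => -[].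
by rewrite subrr mul0r.
Qed.

Lemma circle_sin (k : int) (c : R) :
  \int[circ]_y sin (2 * pi * (k%:~R * y + c)) = (k == 0)%:R * sin (2 * pi * c).
Proof.
have sc (x : R) : sin (2 * pi * x) = cos (2 * pi * (x - 4^-1)).
  rewrite mulrBr cosB.
  have -> : 2 * pi * 4^-1 = pi / 2 :> R by field.
  by rewrite cos_pihalf sin_pihalf mulr0 add0r mulr1.
under eq_Rintegral do rewrite sc -addrA.
by rewrite circle_cos sc.
Qed.

Lemma circle_integrable_complex (g : R -> R[i]) (M : R) : measurable_complex g ->
  (forall x, normc (g x) <= M) -> integrable_complex circ g.
Proof.
move=> mg gM; apply/integrable_complexP; split => //.
apply: (@circle_integrable _ M); first exact: measurable_normc.
by move=> x; rewrite ger0_norm ?normc_ge0.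
Qed.

Lemma circle_expi2pi (k : int) (c : R) :
  integral_complex circ (fun y => expi2pi (k%:~R * y + c)) = (k == 0)%:R%:C * expi2pi c.
Proof.
apply: complex_ext; rewrite ?cRe_integral ?cIm_integral ?cReM ?cImM /=.
  by rewrite circle_cos mul0r subr0.
by rewrite circle_sin mul0r addr0.
Qed.

Lemma sqr_normc_sum K (w a : 'I_K -> R) :
  normc (\sum_l (w l)%:C * expi2pi (a l)) ^+ 2 =
  \sum_l \sum_l' w l * w l' * cos (2 * pi * (a l - a l')).
Proof.
rewrite sqr_normc2 cRe_sum cIm_sum !expr2 !big_distrlr -big_split; apply: eq_bigr => l _.
rewrite -big_split; apply: eq_bigr => l' _.
by rewrite (mulrBr (2 * pi)) cosB !cReM !cImM /=; ring.
Qed.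

(** The real phases [b l] only multiply the coefficients by unimodular numbers, which is why the
    same identity holds at every time of the evolution. *)
Lemma circle_Parseval K (w b : 'I_K -> R) (k : 'I_K -> int) : injective k ->
  \int[circ]_y (normc (\sum_l (w l)%:C * expi2pi ((k l)%:~R * y + b l)) ^+ 2) =
  \sum_l w l ^+ 2.
Proof.
move=> ik; under eq_Rintegral do rewrite sqr_normc_sum.
have jc l l' : circ.-integrable setT
    (fun y => (w l * w l' * cos (2 * pi * ((k l)%:~R * y + b l - ((k l')%:~R * y + b l'))))%:E).
  apply: (@circle_integrable _ (`|w l * w l'|)) => [|x].
    apply: measurable_funM => //.
    apply: measurableT_comp; first exact: continuous_measurable_fun (@continuous_cos R).
    by apply: measurable_funM => //; apply: measurable_funB;
      apply: measurable_funD => //; exact: measurable_funM.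
  by rewrite normrM ler_piMr// cos_max.
rewrite /Rintegral; under eq_integral => y _.
  rewrite -sumEFin; under eq_bigr do rewrite -sumEFin; over.
rewrite integral_sum//; last by move=> l; apply: integrable_sum.
rewrite -sum_fine; last first.
  by move=> l _; apply: integrable_fin_num => //; apply: integrable_sum.
apply: eq_bigr => l _.
rewrite integral_sum// -sum_fine; last by move=> l' _; exact: integrable_fin_num.
rewrite (bigD1 l)//= big1 ?addr0.
  under eq_integral do rewrite subrr mulr0 cos0 mulr1.
  have := Rintegral_cst circ (@measurableT _ R) (w l * w l); rewrite /Rintegral /cst => ->.
  by rewrite /circle_measure /= /mfrestr /mrestr setTI lebesgue_measure_itv/= lte01 oppr0 adde0 mulr1.
move=> l' ll'.
have -> : (fun x : R => (w l * w l' * cos (2 * pi * ((k l)%:~R * x + b l - ((k l')%:~R * x + b l'))))%:E)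
  = (fun x => (w l * w l')%:E * (cos (2 * pi * ((k l - k l')%:~R * x + (b l - b l'))))%:E)%E.
  apply/funext => x; rewrite -EFinM; congr ((_ * cos _)%:E).
  by rewrite intrB; ring.
have jx : circ.-integrable setT (fun x => (cos (2 * pi * ((k l - k l')%:~R * x + (b l - b l'))))%:E).
  apply: (@circle_integrable _ 1) => [|x]; last exact: cos_max.
  apply: measurableT_comp; first exact: continuous_measurable_fun (@continuous_cos R).
  by apply: measurable_funM => //; apply: measurable_funD => //; exact: measurable_funM.
rewrite integralZl// fineM//; last exact: integrable_fin_num.
have := circle_cos (k l - k l') (b l - b l'); rewrite /Rintegral => ->.
by rewrite subr_eq0 (inj_eq ik) eq_sym (negbTE ll') mul0r mulr0.
Qed.

End circle.

Section counting_int.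
Variable R : realType.
Local Notation cnt := (@counting int R).

Lemma measurable_fun_int d (T : measurableType d) (f : int -> T) : measurable_fun setT f.
Proof. by []. Qed.

Lemma counting_indic (k : int) :
  cnt.-integrable setT (fun j => ((j == k)%:R)%:E) /\ \int[cnt]_j (j == k)%:R = 1.
Proof.
have fE : (fun j : int => ((j == k)%:R : R)%:E) = EFin \o \1_[set k].
  by apply/funext => j; rewrite /= indicE; case: eqP => jk; [rewrite mem_set|rewrite memNset].
have c1 : cnt [set k] = 1%E by rewrite /counting asboolT// fset_set1 finmap.cardfs1.
split.
  apply/integrableP; split; first exact: measurable_fun_int.
  rewrite (eq_integral (EFin \o \1_[set k])); last first.
    by move=> j _; rewrite -fE gee0_abs// lee_fin.
  by rewrite integral_indic// setIT (_ : _ [set k] = 1%E) ?ltry.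
by rewrite /Rintegral fE integral_indic// setIT (_ : _ [set k] = 1%E).
Qed.

(** A function supported in a finite set is a combination of indicators of points, each of counting
    measure 1. *)
Lemma counting_integral (s : seq int) (g : int -> R[i]) : uniq s ->
  (forall k, k \notin s -> g k = 0) ->
  integrable_complex cnt g /\ integral_complex cnt g = \sum_(k <- s) g k.
Proof.
move=> us gs.
have gE k : g k = \sum_(j <- s) g j * ((k == j)%:R)%:C.
  have [ks|ks] := boolP (k \in s); last first.
    rewrite gs// big_seq big1// => j js; case: eqP => [kj|_]; last by rewrite mulr0.
    by rewrite kj js in ks.
  rewrite (bigD1_seq k)//= eqxx mulr1 big1 ?addr0// => j; rewrite eq_sym => /negbTE ->.
  by rewrite mulr0.
have jj (j : int) : integrable_complex cnt (fun k => ((k == j)%:R)%:C).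
  by apply: integrable_complex_real; have [] := counting_indic j.
have -> : g = fun k => \sum_(j <- s) g j * ((k == j)%:R)%:C by exact/funext.
split.
  by apply: integrable_complex_sum => j _; exact: integrable_complexZ.
rewrite integral_complex_sum; last by move=> j; exact: integrable_complexZ.
apply: eq_bigr => j _; rewrite integral_complexZ// integral_complex_real.
by have [_ ->] := counting_indic j; rewrite mulr1 -gE.
Qed.

Lemma counting_Rintegral (s : seq int) (f : int -> R) : uniq s ->
  (forall k, k \notin s -> f k = 0) ->
  cnt.-integrable setT (EFin \o f) /\ \int[cnt]_k f k = \sum_(k <- s) f k.
Proof.
move=> us fs.
have [|[j _] e] := @counting_integral s (fun k => (f k)%:C) us.
  by move=> k ks; rewrite fs.
split => //; have := congr1 (@cRe _) e.
by rewrite cRe_integral cRe_sum.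
Qed.

End counting_int.

Lemma tuple_tensor_real d (T : measurableType d) (R : realType)
    (mu : {sigma_finite_measure set T -> \bar R}) n (g : 'I_n -> T -> R) :
  (forall i, mu.-integrable setT (EFin \o g i)) ->
  (tuple_measure mu n).-integrable setT (EFin \o (fun x => \prod_i g i (tnth x i))) /\
  \int[tuple_measure mu n]_x (\prod_i g i (tnth x i)) = \prod_i \int[mu]_x g i x.
Proof.
move=> jg; pose f x := \prod_i g i (tnth x i).
have [] := @tuple_tensor _ _ _ mu n (fun i x => (g i x)%:C) (fun i => integrable_complex_real (jg i)).
have -> : (fun x => \prod_i (g i (tnth x i))%:C) = fun x => (f x)%:C.
  by apply/funext => x; rewrite /f rmorph_prod.
move=> [jf _] e; split => //; apply: complexI; rewrite rmorph_prod.
have := integral_complex_real (tuple_measure mu n) f; rewrite e /= => <-.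
by apply: eq_bigr => i _; rewrite integral_complex_real.
Qed.

Section mixed_tensor.
Context d1 d2 (T1 : measurableType d1) (T2 : measurableType d2) (R : realType).
Variable m1 : {sigma_finite_measure set T1 -> \bar R}.
Variable m2 : {sigma_finite_measure set T2 -> \bar R}.
Variables n m : nat.

Definition tensor (g : 'I_n -> T1 -> R[i]) (h : 'I_m -> T2 -> R[i])
    (p : n.-tuple T1 * m.-tuple T2) : R[i] :=
  (\prod_i g i (tnth p.1 i)) * \prod_j h j (tnth p.2 j).

Lemma mixed_tensor g h :
  (forall i, integrable_complex m1 (g i)) -> (forall j, integrable_complex m2 (h j)) ->
  integrable_complex (tuple_measure m1 n \x tuple_measure m2 m)%E (tensor g h) /\
  integral_complex (tuple_measure m1 n \x tuple_measure m2 m)%E (tensor g h) =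
  (\prod_i integral_complex m1 (g i)) * \prod_j integral_complex m2 (h j).
Proof.
move=> jg jh; have [jG iG] := tuple_tensor jg; have [jH iH] := tuple_tensor jh.
split; first exact: (integrable_complex_tensor jG jH).
by rewrite -iG -iH -(integral_complex_tensor jG jH).
Qed.

Lemma mixed_tensor_real (g : 'I_n -> T1 -> R) (h : 'I_m -> T2 -> R) :
  (forall i, m1.-integrable setT (EFin \o g i)) ->
  (forall j, m2.-integrable setT (EFin \o h j)) ->
  let f (p : n.-tuple T1 * m.-tuple T2) :=
    (\prod_i g i (tnth p.1 i)) * \prod_j h j (tnth p.2 j) in
  (tuple_measure m1 n \x tuple_measure m2 m)%E.-integrable setT (EFin \o f) /\
  \int[(tuple_measure m1 n \x tuple_measure m2 m)%E]_p f p =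
  (\prod_i \int[m1]_x g i x) * \prod_j \int[m2]_y h j y.
Proof.
move=> jg jh f.
have [] := @mixed_tensor (fun i x => (g i x)%:C) (fun j y => (h j y)%:C)
  (fun i => integrable_complex_real (jg i)) (fun j => integrable_complex_real (jh j)).
have -> : tensor (fun i x => (g i x)%:C) (fun j y => (h j y)%:C) = fun p => (f p)%:C.
  by apply/funext => p; rewrite /tensor /f rmorphM !rmorph_prod.
move=> [jf _] e; split => //.
have := integral_complex_real (tuple_measure m1 n \x tuple_measure m2 m)%E f.
move=> e'; apply: complexI; rewrite -e' e rmorphM !rmorph_prod.
by congr (_ * _); apply: eq_bigr => i _; rewrite integral_complex_real.
Qed.

End mixed_tensor.

(** * Fourier transforms of tents *)

Section tent_transform.
Variable R : realType.
Local Notation leb := (@lebesgue_measure R).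

Definition tent (lam v x : R) : R := Num.max 0 (1 - lam * `|x - v|).

(** This is the Fejer kernel lam^-1 (sin theta / theta)^2 at theta = pi w / lam, written with 1 -
    cos (2 theta) = 2 sin^2 theta. *)
Definition tent_hat (lam w : R) : R :=
  if w == 0 then lam^-1 else lam * (1 - cos (2 * pi * w / lam)) / (2 * pi ^+ 2 * w ^+ 2).

Lemma tent_ge0 lam v x : 0 <= tent lam v x.
Proof. by rewrite le_max lexx. Qed.

Lemma tent_le1 lam v x : 0 <= lam -> tent lam v x <= 1.
Proof. by move=> l0; rewrite ge_max ler01 lerBlDr lerDl mulr_ge0. Qed.

Lemma tent_eq0 lam v x : 0 < lam -> lam^-1 <= `|x - v| -> tent lam v x = 0.
Proof.
move=> l0 xv; apply/max_idPl; rewrite subr_le0.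
by rewrite -ler_pdivrMl// mulr1.
Qed.

Lemma continuous_tent lam v : continuous (tent lam v).
Proof.
move=> x; apply: (@continuous_max R R (cst 0) (fun x => 1 - lam * `|x - v|)); first exact: cvg_cst.
apply: continuousB; first exact: cvg_cst.
apply: continuousM; first exact: cvg_cst.
by apply: continuous_comp; [apply: continuousB => //; exact: cvg_cst|exact: norm_continuous].
Qed.

Lemma is_derive_affine (a v c x : R) : is_derive x 1 (fun x : R => a * (x - v) + c) a.
Proof.
have -> : (fun x : R => a * (x - v) + c) = a *: ((id : R -> R) - cst v) + cst c by [].
by apply: is_derive_eq; rewrite addr0 subr0 /GRing.scale /= mulr1.
Qed.

Lemma is_derive_sin_affine (a v c x : R) :
  is_derive x 1 (fun x : R => sin (a * (x - v) + c)) (cos (a * (x - v) + c) * a).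
Proof. exact: (is_derive1_comp (is_derive_sin _) (is_derive_affine a v c x)). Qed.

Lemma is_derive_cos_affine (a v c x : R) :
  is_derive x 1 (fun x : R => cos (a * (x - v) + c)) (- sin (a * (x - v) + c) * a).
Proof. exact: (is_derive1_comp (is_derive_cos _) (is_derive_affine a v c x)). Qed.

Lemma derivable_continuous (f : R -> R) :
  (forall x : R, derivable f x 1) -> continuous f.
Proof. by move=> df x; exact/differentiable_continuous/derivable1_diffP. Qed.

Lemma integral_slope_cos (s a v c x1 x2 : R) : x1 < x2 -> a != 0 ->
  let G x := (1 - s * (x - v)) * (a^-1 * sin (a * (x - v) + c))
             - s / a ^+ 2 * cos (a * (x - v) + c) in
  \int[leb]_(x in `[x1, x2]) ((1 - s * (x - v)) * cos (a * (x - v) + c)) = G x2 - G x1.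
Proof.
move=> x12 a0 G; apply: Rintegral_derivative => //.
  have -> : (fun x : R => (1 - s * (x - v)) * cos (a * (x - v) + c)) =
      (fun x : R => - s * (x - v) + 1) * (fun x : R => cos (a * (x - v) + c)).
    by apply/funext => y; rewrite !fctE mulNr addrC.
  apply: derivable_continuous => x; apply: derivableM.
    by case: (is_derive_affine (- s) v 1 x).
  by case: (is_derive_cos_affine a v c x).
move=> x.
have dS := is_derive_sin_affine a v c x.
have dC := is_derive_cos_affine a v c x.
have dA := is_derive_affine (- s) v 1 x.
have -> : G = (fun x : R => - s * (x - v) + 1) * (a^-1 *: (fun x : R => sin (a * (x - v) + c)))
             - (s / a ^+ 2) *: (fun x : R => cos (a * (x - v) + c)).
  by apply/funext => y; rewrite /G !fctE /GRing.scale /= mulNr [- _ + 1]addrC.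
apply: is_derive_eq.
rewrite /GRing.scale /=; set S := sin _; set C := cos _.
by rewrite -[_ *: S]/(_ * S); field.
Qed.

Lemma integral_slope_const (s v k x1 x2 : R) : x1 < x2 ->
  let G x := k * ((x - v) - s / 2 * (x - v) ^+ 2) in
  \int[leb]_(x in `[x1, x2]) ((1 - s * (x - v)) * k) = G x2 - G x1.
Proof.
move=> x12 G; apply: Rintegral_derivative => //.
  have -> : (fun x : R => (1 - s * (x - v)) * k) = k *: (fun x : R => - s * (x - v) + 1).
    by apply/funext => y; rewrite !fctE /GRing.scale /= mulNr addrC mulrC.
  apply: derivable_continuous => x; apply: derivableZ.
  by case: (is_derive_affine (- s) v 1 x).
move=> x.
have dA := is_derive_affine 1 v 0 x.
have -> : G = k *: ((fun x : R => 1 * (x - v) + 0) - (s / 2) *: (fun x : R => 1 * (x - v) + 0) ^+ 2).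
  apply/funext => y; rewrite /G -[RHS]/(k * ((1 * (y - v) + 0) - s / 2 * (1 * (y - v) + 0) ^+ 2)).
    by rewrite mul1r addr0.
apply: is_derive_eq.
by rewrite /GRing.scale /=; field.
Qed.

(** The tent is affine on each side of v, where explicit primitives apply. The phase c lets one
    formula give the cosine and the sine transform. *)
Lemma tent_cos (lam v w c : R) : 0 < lam ->
  \int[leb]_x (tent lam v x * cos (2 * pi * w * (x - v) + c)) = tent_hat lam w * cos c.
Proof.
move=> l0; set a := 2 * pi * w.
set f := fun x => tent lam v x * cos (a * (x - v) + c).
have cf : continuous f.
  move=> x; apply: continuousM; first exact: continuous_tent.
  apply: (derivable_continuous (f := fun x => cos (a * (x - v) + c))) => y.
  by case: (is_derive_cos_affine a v c y).
have jf (x1 x2 : R) : leb.-integrable `[x1, x2] (EFin \o f).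
  apply: continuous_compact_integrable; first exact: segment_compact.
  exact: continuous_subspaceT.
have li0 : 0 < lam^-1 by rewrite invr_gt0.
have lv : v < v + lam^-1 by rewrite ltrDl.
have vl : v - lam^-1 < v by rewrite ltrBlDr ltrDl.
have -> : \int[leb]_x f x = \int[leb]_(x in `[v - lam^-1, v + lam^-1]) f x.
  rewrite [RHS]Rintegral_mkcond; apply: eq_Rintegral => x _.
  rewrite patchE; case: ifPn => //.
  rewrite notin_setE /= in_itv /= => /negP; rewrite negb_and -!ltNge => xv.
  rewrite /f tent_eq0 ?mul0r//; case/orP: xv => xv.
    by rewrite ler0_norm; lra.
  by rewrite ger0_norm; lra.
have := @Rintegral_itvB R f (BLeft (v - lam^-1)) (BRight (v + lam^-1)) v (jf _ _).
rewrite !bnd_simp (ltW vl) (ltW lv) => /(_ isT isT) /eqP; rewrite subr_eq => /eqP ->.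
rewrite Rintegral_itv_obnd_cbnd; last first.
  apply: integrableS (jf v (v + lam^-1)) => //; exact: subset_itv_oc_cc.
have eR : \int[leb]_(x in `[v, v + lam^-1]) f x =
    \int[leb]_(x in `[v, v + lam^-1]) ((1 - lam * (x - v)) * cos (a * (x - v) + c)).
  apply: eq_Rintegral => x; rewrite inE /= in_itv /= => /andP[vx xl]; congr (_ * _).
  rewrite /tent ger0_norm ?subr_ge0//; apply/max_idPr; rewrite subr_ge0.
  by rewrite -ler_pdivlMl// mulr1 lerBlDl.
have eL : \int[leb]_(x in `[v - lam^-1, v]) f x =
    \int[leb]_(x in `[v - lam^-1, v]) ((1 - (- lam) * (x - v)) * cos (a * (x - v) + c)).
  apply: eq_Rintegral => x; rewrite inE /= in_itv /= => /andP[lx xv]; congr (_ * _).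
  rewrite /tent ler0_norm ?subr_le0// mulrN mulNr; apply/max_idPr; rewrite subr_ge0.
  by rewrite -mulrN -ler_pdivlMl// mulr1 opprB lerBlDr -lerBlDl.
rewrite eR eL /tent_hat; have [w0|w0] := eqVneq w 0.
  have a0 : a = 0 by rewrite /a w0 mulr0.
  under eq_Rintegral do rewrite a0 mul0r add0r.
  under [X in _ + X = _]eq_Rintegral do rewrite a0 mul0r add0r.
  rewrite !integral_slope_const//=; field; exact: lt0r_neq0.
have a0 : a != 0 by rewrite /a !mulf_neq0// gt_eqF// pi_gt0.
rewrite !integral_slope_cos//=.
have -> : v + lam^-1 - v = lam^-1 by ring.
have -> : v - lam^-1 - v = - lam^-1 by ring.
have -> : 2 * pi ^+ 2 * w ^+ 2 = a ^+ 2 / 2 by rewrite /a; field.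
have l0' := lt0r_neq0 l0.
rewrite [a * - _]mulrN; set q := a / lam.
rewrite subrr !mulr0 !add0r !cosD cosN sinN.
by field; rewrite l0' a0.
Qed.

End tent_transform.

(** * Bounds for the Fejer kernel *)

Section tent_hat_bounds.
Variable R : realType.
Local Notation leb := (@lebesgue_measure R).

(** The threshold 1/6 corresponds to the angle t = pi / 3. Since 2 t = pi - t, the double angle
    formula is a quadratic equation for cos t, with positive root 1/2. *)
Lemma cos_ge_half (x : R) : `|x| <= 6^-1 -> 2^-1 <= cos (2 * pi * x).
Proof.
move=> x6; have p0 := @pi_gt0 R; set t : R := pi / 3.
have ct : cos t = 2^-1.
  have c2 : cos (t *+ 2) = - cos t.
    have -> : t *+ 2 = - t + pi by rewrite /t mulr2n; field.
    by rewrite cosDpi cosN.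
  have c0 : 0 < cos t by apply: cos_gt0_pihalf; apply/andP; split; rewrite /t; lra.
  move: c2; rewrite cos_mulr2n -mulr_natl => c2.
  have : (cos t + 1) * (2 * cos t - 1) = 0.
    have -> : (cos t + 1) * (2 * cos t - 1) = (2 * cos t ^+ 2 - 1) + cos t by ring.
    by rewrite c2 addNr.
  move=> /eqP; rewrite mulf_eq0 => /orP[/eqP|/eqP]; lra.
rewrite -cos_norm -ct.
have xt : `|2 * pi * x| <= t.
  rewrite normrM gtr0_norm ?mulr_gt0//.
  have -> : t = 2 * pi * 6^-1 by rewrite /t; field.
  by rewrite ler_pM2l// mulr_gt0.
have xt' : `|2 * pi * x| <= pi by apply: le_trans xt _; rewrite /t; lra.
move: xt; rewrite le_eqVlt => /orP[/eqP ->//|xt].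
apply/ltW; rewrite ltr_cos// in_itv /= ?normr_ge0//.
by rewrite /t; apply/andP; split; lra.
Qed.

(** A form suited to measurability: the case distinction becomes an indicator and the division a
    real power. At w = 0 the second summand is 0. *)
Lemma tent_hatE (lam w : R) :
  tent_hat lam w = lam^-1 * (w == 0)%:R
    + lam * (1 - cos (2 * pi * w / lam)) * ((2 * pi ^+ 2 * w ^+ 2) `^ (-1)).
Proof.
rewrite powR_inv1; last by rewrite mulr_ge0 ?sqr_ge0// mulr_ge0 ?sqr_ge0.
rewrite /tent_hat; case: eqP => [->|_]; last by rewrite mulr0 add0r.
by rewrite mulr1 expr0n !mulr0 invr0 !mulr0 addr0.
Qed.

Lemma measurable_tent_hat (lam : R) : measurable_fun setT (tent_hat lam).
Proof.
have -> : tent_hat lam = fun w => lam^-1 * \1_[set 0%R] w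
    + lam * (1 - cos (2 * pi * w / lam)) * ((2 * pi ^+ 2 * w ^+ 2) `^ (-1)).
  apply/funext => w; rewrite tent_hatE indicE; congr (_ * _%:R + _).
  by case: eqP => w0; [rewrite mem_set|rewrite memNset].
apply: measurable_funD; first exact: measurable_funM.
apply: measurable_funM.
  apply: measurable_funM => //; apply: measurable_funB => //.
  apply: measurableT_comp; first exact: continuous_measurable_fun (@continuous_cos R).
  by apply: measurable_funM => //; exact: measurable_funM.
have m2 : measurable_fun setT (fun w : R => 2 * pi ^+ 2 * w ^+ 2).
  by apply: measurable_funM => //; exact: measurable_funX.
exact: (measurableT_comp (measurable_powR (-1)) m2).
Qed.

Lemma tent_hat_ge0 (lam w : R) : 0 < lam -> 0 <= tent_hat lam w.
Proof.
move=> l0; rewrite /tent_hat; case: ifPn => _; first by rewrite invr_ge0 ltW.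
by rewrite divr_ge0// mulr_ge0 ?sqr_ge0 ?(ltW l0)// ?subr_ge0 ?cos_le1// mulr_ge0 ?sqr_ge0.
Qed.

Lemma tent_integrable (lam v : R) : 0 < lam -> leb.-integrable setT (EFin \o tent lam v).
Proof.
move=> l0; have li0 : 0 < lam^-1 by rewrite invr_gt0.
have : leb.-integrable `[v - lam^-1, v + lam^-1] (EFin \o tent lam v).
  apply: continuous_compact_integrable; first exact: segment_compact.
  exact/continuous_subspaceT/continuous_tent.
rewrite integrable_mkcond//; apply: eq_integrable => // x _.
rewrite patchE; case: ifPn => //.
rewrite notin_setE /= in_itv /= => /negP; rewrite negb_and -!ltNge => xv.
rewrite tent_eq0//; case/orP: xv => xv.
  by rewrite ler0_norm; lra.
by rewrite ger0_norm; lra.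
Qed.

Lemma tent_cos_integrable (lam v w c : R) : 0 < lam ->
  leb.-integrable setT (fun x => (tent lam v x * cos (2 * pi * w * (x - v) + c))%:E).
Proof.
move=> l0; apply: le_integrable (tent_integrable v l0) => //.
  apply/measurable_EFinP/measurable_funM.
    by apply: continuous_measurable_fun; exact: continuous_tent.
  apply: measurableT_comp; first exact: continuous_measurable_fun (@continuous_cos R).
  by apply: measurable_funD => //; apply: measurable_funM => //; exact: measurable_funB.
by move=> x _; rewrite /= lee_fin normrM ler_piMr// cos_max.
Qed.

Lemma Rintegral_tent (lam v : R) : 0 < lam -> \int[leb]_x tent lam v x = lam^-1.
Proof.
move=> l0; have := tent_cos v 0 0 l0; rewrite /tent_hat eqxx cos0 mulr1 => <-.
by apply: eq_Rintegral => x _; rewrite mulr0 mul0r addr0 cos0 mulr1.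
Qed.

Lemma tent_hat_le (lam w : R) : 0 < lam -> tent_hat lam w <= lam^-1.
Proof.
move=> l0; have := tent_cos 0 w 0 l0; rewrite cos0 mulr1 => <-.
rewrite -(Rintegral_tent 0 l0); apply: le_Rintegral => //.
- exact: tent_cos_integrable.
- exact: tent_integrable.
- by move=> x _; rewrite ler_piMr ?tent_ge0// cos_le1.
Qed.

(** On the support of the tent, |x| < 1 / lam, hence |w x| <= 1/6 and the cosine is at least 1/2:
    half of the mass lam^-1 is kept. *)
Lemma tent_hat_lower (lam w : R) : 0 < lam -> `|w| <= lam / 6 ->
  (2 * lam)^-1 <= tent_hat lam w.
Proof.
move=> l0 wl; have := tent_cos 0 w 0 l0; rewrite cos0 mulr1 => <-.
rewrite invfM -(Rintegral_tent 0 l0) -RintegralZl//; last exact: tent_integrable.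
apply: le_Rintegral => //.
- by apply: eq_integrable (integrableZl measurableT (2^-1) (tent_integrable 0 l0)) => // x _; rewrite EFinM.
- exact: tent_cos_integrable.
move=> x _; rewrite subr0 addr0.
have [xl|xl] := leP (lam^-1) `|x|; first by rewrite tent_eq0 ?subr0// mulr0 mul0r.
rewrite mulrC ler_wpM2l ?tent_ge0// -mulrA; apply: cos_ge_half.
rewrite normrM; apply: le_trans (ler_pM _ _ wl (ltW xl)) _ => //.
by rewrite mulrAC divff ?lt0r_neq0// mul1r.
Qed.

(** The numerator is at most 2 lam, and pi >= 2 turns lam / pi^2 into lam / 4. *)
Lemma tent_hat_decay (lam w : R) : 0 < lam -> tent_hat lam w * w ^+ 2 <= lam / 4.
Proof.
move=> l0; rewrite /tent_hat; case: eqP => [->|/eqP w0].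
  rewrite expr0n /= mulr0 divr_ge0//. exact: ltW.
have p0 := @pi_gt0 R; have p2 := @pi_ge2 R.
have -> : lam * (1 - cos (2 * pi * w / lam)) / (2 * pi ^+ 2 * w ^+ 2) * w ^+ 2 =
    lam * ((1 - cos (2 * pi * w / lam)) / (2 * pi ^+ 2)).
  have := lt0r_neq0 p0; set c := 1 - cos _; move: c (pi : R) => c p pn0.
  by field; rewrite w0 pn0.
rewrite ler_pM2l// ler_pdivrMr ?mulr_gt0 ?exprn_gt0//.
have := cos_geN1 (2 * pi * w / lam).
have : (2 : R) ^+ 2 <= pi ^+ 2 by rewrite ler_pXn2r// nnegrE; lra.
rewrite expr2; lra.
Qed.

(** An affine substitution in the integral of 1 / (1 + x^2), which equals pi. This function serves
    as an integrable majorant with explicit mass. *)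
Lemma cauchy_integral (mu k : R) : 0 < mu ->
  leb.-integrable setT (fun x => ((1 + ((x - k) / mu) ^+ 2)^-1)%:E) /\
  \int[leb]_x (1 + ((x - k) / mu) ^+ 2)^-1 = mu * pi.
Proof.
move=> m0; set f : R -> R := fun x => (1 + ((x - k) / mu) ^+ 2)^-1.
have f0 x : 0 <= f x by rewrite invr_ge0 addr_ge0// sqr_ge0.
have dF (x : R) : is_derive x 1 (fun x : R => mu^-1 * (x - k) + 0) mu^-1 by exact: is_derive_affine.
have o0 x : 0 <= (oneDsqr x)^-1 :> R by rewrite invr_ge0 (le_trans ler01 (oneDsqr_ge1 x)).
have I1 : (\int[leb]_x ((oneDsqr x)^-1)%:E = pi%:E)%E.
  rewrite ge0_symfun_integralT//.
  - have -> : [set x : R | 0 <= x] = [set` `[0, +oo[%R].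
      by apply/seteqP; split => x /=; rewrite in_itv /= andbT.
    by rewrite integral0y_oneDsqr -EFinM; congr EFin; field.
  - exact: continuous_oneDsqrV.
  - by move=> x /=; rewrite /oneDsqr sqrrN.
have mi0 : 0 < mu^-1 by rewrite invr_gt0.
pose F (x : R) := mu^-1 * (x - k) + 0.
have F'E : derive1 F = cst mu^-1.
  by apply/funext => x; rewrite derive1E (@derive_val _ _ _ _ _ _ _ (dF x)).
have fE x : f x = (oneDsqr (F x))^-1 by rewrite /f /F /oneDsqr addr0 mulrC.
have cF : continuous F by apply: derivable_continuous => x; case: (dF x).
have mf : measurable_fun setT f.
  have -> : f = (fun x => (oneDsqr x)^-1) \o F by exact/funext.
  apply: continuous_measurable_fun => x.
  by apply: continuous_comp; [exact: cF|exact: continuous_oneDsqrV].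
have I2 : (\int[leb]_x ((f x)%:E) = (mu * pi)%:E)%E.
  have : (pi%:E = \int[leb]_x ((((fun x => (oneDsqr x)^-1) \o F) * derive1 F)%R x)%:E)%E.
    rewrite -I1; apply: increasing_ge0_integration_by_substitutionT.
    - by move=> x y xy; rewrite /F ltrD2r ltr_pM2l// ltrD2r.
    - by rewrite F'E => x; exact: cvg_cst.
    - by rewrite F'E; exact: is_cvg_cst.
    - by rewrite F'E; exact: is_cvg_cst.
    - by move=> x; case: (dF x).
    - apply: cvg_comp (@cvg_addrr_Ny _ 0); apply: gt0_cvgMrNy => //; exact: cvg_addrr_Ny.
    - apply: cvg_comp (@cvg_addrr _ 0); apply: gt0_cvgMry => //; exact: cvg_addrr.
    - exact: continuous_oneDsqrV.
    - exact: o0.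
  rewrite F'E => I3; rewrite EFinM I3.
  have -> : (\int[leb]_x ((((fun x => (oneDsqr x)^-1) \o F) * cst mu^-1)%R x)%:E =
      \int[leb]_x ((mu^-1)%:E * (f x)%:E))%E.
    by apply: eq_integral => x _; rewrite fE -EFinM mulrC.
  rewrite ge0_integralZl; [|by []|exact/measurable_EFinP|by move=> x _; rewrite lee_fin
    |by rewrite lee_fin ltW].
  by rewrite muleA -EFinM divff ?mul1e// lt0r_neq0.
split; last by rewrite /Rintegral I2.
apply/integrableP; split; first exact/measurable_EFinP.
have -> : (\int[leb]_x `|(f x)%:E| = \int[leb]_x (f x)%:E)%E.
  by apply: eq_integral => x _; rewrite gee0_abs// lee_fin.
by rewrite I2 ltry.
Qed.

(** The bound lam^-1 and the decay bound lam^-1 / 4 for the kernel times (w / lam)^2 are added;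
    hence 5 / 4. *)
Lemma tent_hat_cauchy (lam w : R) : 0 < lam ->
  tent_hat lam w <= 5 / 4 / lam * (1 + (w / lam) ^+ 2)^-1.
Proof.
move=> l0; rewrite ler_pdivlMr ?ltr_pwDl ?sqr_ge0// mulrDr mulr1.
have h1 := tent_hat_le w l0.
have h3 : tent_hat lam w * (w / lam) ^+ 2 <= lam^-1 / 4.
  rewrite expr_div_n mulrA ler_pdivrMr ?exprn_gt0//; apply: le_trans (tent_hat_decay w l0) _.
  by rewrite le_eqVlt; apply/orP; left; apply/eqP; field; exact: lt0r_neq0.
by rewrite [leRHS](_ : _ = lam^-1 + lam^-1 / 4); [exact: lerD|field; exact: lt0r_neq0].
Qed.

Lemma tent_hat_integrable (lam k : R) : 0 < lam ->
  leb.-integrable setT (fun x => (tent_hat lam (x - k))%:E).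
Proof.
move=> l0; have [jc _] := cauchy_integral k l0.
apply: le_integrable (integrableZl measurableT (5 / 4 / lam) jc) => //.
  apply/measurable_EFinP; apply: measurableT_comp; first exact: measurable_tent_hat.
  exact: measurable_funB.
move=> x _; rewrite -EFinM /= lee_fin ger0_norm ?tent_hat_ge0//.
by apply: le_trans (tent_hat_cauchy _ l0) _; rewrite ler_norm.
Qed.

Lemma Rintegral_tent_hat (lam k : R) : 0 < lam ->
  \int[leb]_x tent_hat lam (x - k) <= 5.
Proof.
move=> l0; have [jc ic] := cauchy_integral k l0.
apply: (@le_trans _ _ (\int[leb]_x (5 / 4 / lam * (1 + ((x - k) / lam) ^+ 2)^-1))).
  apply: le_Rintegral => //; first exact: tent_hat_integrable.
    by apply: eq_integrable (integrableZl measurableT (5 / 4 / lam) jc) => // x _; rewrite EFinM.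
  by move=> x _; exact: tent_hat_cauchy.
rewrite RintegralZl// ic.
have -> : 5 / 4 / lam * (lam * pi) = 5 / 4 * pi by field; exact: lt0r_neq0.
by have := @pihalf_lt2 R; lra.
Qed.

(* The inner region |xi - k| <= lam / 6 contributes at least 1/12 and the tail, where the
   phase is not controlled, at most 1/24 in absolute value; in between the integrand is
   nonnegative. *)
Lemma tent_hat_phase (lam k : R) (psi : R -> R) : 0 < lam -> measurable_fun setT psi ->
  (forall x, `|x - k| <= 48 * lam -> `|psi x| <= 6^-1) ->
  24^-1 <= \int[leb]_x (tent_hat lam (x - k) * cos (2 * pi * psi x)).
Proof.
move=> l0 mpsi hpsi.
have mu0 : 0 < 48 * lam by rewrite mulr_gt0.
have [jc ic] := cauchy_integral k mu0.
pose A := `[k - lam / 6, k + lam / 6]%classic : set (measurableTypeR R).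
have mA : measurable A by exact: measurable_itv.
have lA : leb A = (lam / 3)%:E.
  rewrite /A lebesgue_measure_itv /= lte_fin ltrD2l gtrN ?divr_gt0// -EFinB.
  by congr EFin; field.
have jA : leb.-integrable setT (fun x => (\1_A x)%:E).
  apply/integrableP; split; first exact/measurable_EFinP/measurable_indic.
  rewrite (eq_integral (EFin \o \1_A)); last by move=> x _; rewrite gee0_abs// lee_fin.
  by rewrite integral_indic// setIT (_ : _ A = (lam / 3)%:E) ?ltry.
have iA : \int[leb]_x \1_A x = lam / 3 by rewrite /Rintegral integral_indic// setIT (_ : _ A = (lam / 3)%:E).
(* The integrand is compared from below with [cA] on the inner interval minus a Cauchy bump of width
   48 lam. Here [cA] is 1 / (2 lam) times 1/2, and 4608 = 2 * 48^2 makes the bump at least lam / (4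
   q^2) once |q| > 48 lam, which dominates the kernel there. *)
set cA := (4 * lam)^-1; set cC := (4608 * lam)^-1.
have cC_ge0 : 0 <= cC.
  by rewrite /cC invr_ge0; apply: mulr_ge0; [exact: ler0n|exact: ltW].
have eqC : cA * (lam / 3) - cC * (48 * lam * pi) = 12^-1 - pi / 96.
  by rewrite /cA /cC; move: (pi : R) => p; field; exact: lt0r_neq0.
have cCE q : (48 * lam) ^+ 2 + q ^+ 2 != 0 ->
    cC * (1 + (q / (48 * lam)) ^+ 2)^-1 = lam / 2 / ((48 * lam) ^+ 2 + q ^+ 2).
  by move=> s0; rewrite /cC; field; rewrite s0 lt0r_neq0.
move: cC cC_ge0 eqC cCE => cC cC_ge0 eqC cCE.
have jA' : leb.-integrable setT (EFin \o (fun x => cA * \1_A x)).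
  by apply: eq_integrable (integrableZl measurableT cA jA) => // x _; rewrite EFinM.
have jC' : leb.-integrable setT (EFin \o (fun x => cC * (1 + ((x - k) / (48 * lam)) ^+ 2)^-1)).
  by apply: eq_integrable (integrableZl measurableT cC jc) => // x _; rewrite EFinM.
apply: (@le_trans _ _ (\int[leb]_x (cA * \1_A x - cC * (1 + ((x - k) / (48 * lam)) ^+ 2)^-1))).
  rewrite RintegralB// !RintegralZl// iA ic.
  by rewrite eqC; have := @pihalf_lt2 R; lra.
apply: le_Rintegral => //.
- by apply: eq_integrable (integrableB measurableT jA' jC').
- apply: le_integrable (tent_hat_integrable k l0) => //.
    apply/measurable_EFinP/measurable_funM.
      apply: measurableT_comp; first exact: measurable_tent_hat.
      exact: measurable_funB.
    apply: measurableT_comp; first exact: continuous_measurable_fun (@continuous_cos R).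
    exact: measurable_funM.
  by move=> x _; rewrite /= lee_fin normrM ler_piMr// cos_max.
move=> x _.
have cC0 : 0 <= cC * (1 + ((x - k) / (48 * lam)) ^+ 2)^-1.
  have d0 : 0 < 1 + ((x - k) / (48 * lam)) ^+ 2 by rewrite ltr_pwDl ?sqr_ge0.
  by apply: mulr_ge0 => //; rewrite invr_ge0; exact: ltW.
have t0 := tent_hat_ge0 (x - k) l0.
have [xk|xk] := leP `|x - k| (48 * lam).
  have c2 := cos_ge_half (hpsi _ xk).
  apply: (@le_trans _ _ (cA * \1_A x)); first by rewrite lerBlDr lerDl.
  rewrite indicE; have [xA|xA] := boolP (x \in A); last first.
    by rewrite mulr0 mulr_ge0// (le_trans _ c2).
  have := tent_hat_lower l0 (_ : `|x - k| <= lam / 6).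
  move: xA; rewrite inE /A /= in_itv /= => /andP[xA1 xA2].
  move=> /(_ _) h; rewrite mulr1.
  have {h} h : (2 * lam)^-1 <= tent_hat lam (x - k) by apply: h; rewrite ler_norml; lra.
  have -> : cA = (2 * lam)^-1 * 2^-1 by rewrite /cA; field; exact: lt0r_neq0.
  by apply: ler_pM => //; rewrite invr_ge0// mulr_ge0// ltW.
have xk0 : 0 < (x - k) ^+ 2.
  by rewrite -real_normK ?num_real// exprn_gt0// (lt_trans _ xk).
have -> : \1_A x = 0 :> R.
  rewrite indicE memNset// /A /= in_itv /= => /andP[x1 x2].
  move: xk; rewrite ltNge => /negP; apply.
  by rewrite ler_norml; lra.
rewrite mulr0 sub0r lerNl -mulrN.
apply: (@le_trans _ _ (tent_hat lam (x - k))).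
  by rewrite ler_piMr// lerNl cos_geN1.
have := tent_hat_decay (x - k) l0; rewrite -ler_pdivlMr// => h; apply: le_trans h _.
have q : (48 * lam) ^+ 2 <= (x - k) ^+ 2.
  rewrite -(real_normK (num_real (x - k))) ler_pXn2r ?nnegrE ?normr_ge0 ?ltW//.
have q0 : 0 < (48 * lam) ^+ 2 + (x - k) ^+ 2 by rewrite addr_gt0// exprn_gt0.
rewrite cCE ?lt0r_neq0//.
move: q q0; move: ((48 * lam) ^+ 2) ((x - k) ^+ 2) xk0 => a b b0 ab ab0.
rewrite ler_pdivrMr// mulrAC ler_pdivlMr//.
have := mulr_ge0 (ltW l0) (_ : 0 <= b - a); rewrite subr_ge0 => /(_ ab).
lra.
Qed.

End tent_hat_bounds.

(** * Sums of modulated tents *)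

Section wave.
Variable R : realType.
Local Notation leb := (@lebesgue_measure R).
Variables (lam v : R) (K : nat) (kap : 'I_K -> R).
Hypothesis lam0 : 0 < lam.

(** All the modulations have phase 0 at v, so in the transform every term carries the same factor
    e(- v xi) and otherwise a nonnegative coefficient. *)
Definition wave (x : R) : R[i] :=
  \sum_l (tent lam v x)%:C * expi2pi (kap l * (x - v)).

Definition wave_hat (xi : R) : R[i] :=
  \sum_l (tent_hat lam (xi - kap l))%:C * expi2pi (- (v * xi)).

Lemma measurable_tent : measurable_fun setT (tent lam v).
Proof. by apply: continuous_measurable_fun; exact: continuous_tent. Qed.

Lemma measurable_wave : @measurable_complex _ (measurableTypeR R) R wave.
Proof.
apply: measurable_complex_sum => l _; apply: measurable_complexM.
  by apply: measurable_complex_real; exact: measurable_tent.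
by apply: measurable_complex_expi2pi; apply: measurable_funM => //; exact: measurable_funB.
Qed.

Lemma normc_wave_le x : normc (wave x) <= K%:R * tent lam v x.
Proof.
apply: le_trans (normc_sum _ _ _) _.
under eq_bigr do rewrite Normc.normcM normc_real normc_expi2pi mulr1 ger0_norm ?tent_ge0//.
by rewrite sumr_const card_ord mulr_natl.
Qed.

Lemma wave_eq0 x : lam^-1 <= `|x - v| -> wave x = 0.
Proof.
by move=> xv; rewrite /wave big1// => l _; rewrite tent_eq0// mul0r.
Qed.

Lemma wave_integrable : integrable_complex leb wave.
Proof.
apply: (@integrable_complex_le _ _ _ leb wave (fun x => K%:R * tent lam v x) measurable_wave _ normc_wave_le).
by apply: eq_integrable (integrableZl measurableT K%:R (tent_integrable v lam0)) => // x _; rewrite EFinM.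
Qed.

Lemma Rintegral_normc_wave : \int[leb]_x normc (wave x) <= K%:R / lam.
Proof.
rewrite -(Rintegral_tent v lam0) -RintegralZl//; last exact: tent_integrable.
apply: le_Rintegral => //; first exact: integrable_normc wave_integrable.
  by apply: eq_integrable (integrableZl measurableT K%:R (tent_integrable v lam0)) => // x _; rewrite EFinM.
by move=> x _; exact: normc_wave_le.
Qed.

Lemma sqr_normc_wave_le x : normc (wave x) ^+ 2 <= K%:R ^+ 2 * tent lam v x.
Proof.
apply: le_trans (_ : (K%:R * tent lam v x) ^+ 2 <= _).
  by rewrite ler_pXn2r ?nnegrE ?normc_ge0 ?normc_wave_le// mulr_ge0 ?tent_ge0.
rewrite exprMn ler_wpM2l ?sqr_ge0// expr2 ler_piMl ?tent_ge0// tent_le1//; exact: ltW.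
Qed.

Lemma sqr_normc_wave_integrable : leb.-integrable setT (fun x => (normc (wave x) ^+ 2)%:E).
Proof.
apply: le_integrable (integrableZl measurableT (K%:R ^+ 2) (tent_integrable v lam0)) => //.
  apply/measurable_EFinP; apply: measurable_funX; apply: measurable_normc.
  exact: measurable_wave.
move=> x _; rewrite -EFinM lee_fin !ger0_norm ?sqr_ge0 ?sqr_normc_wave_le//.
by rewrite mulr_ge0 ?sqr_ge0// tent_ge0.
Qed.

Lemma Rintegral_sqr_normc_wave : \int[leb]_x (normc (wave x) ^+ 2) <= K%:R ^+ 2 / lam.
Proof.
rewrite -(Rintegral_tent v lam0) -RintegralZl//; last exact: tent_integrable.
apply: le_Rintegral => //; first exact: sqr_normc_wave_integrable.
  by apply: eq_integrable (integrableZl measurableT (K%:R ^+ 2) (tent_integrable v lam0)) => // x _; rewrite EFinM.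
by move=> x _; exact: sqr_normc_wave_le.
Qed.

Lemma tent_expi2pi (w c : R) :
  integrable_complex leb (fun x => (tent lam v x)%:C * expi2pi (w * (x - v) + c)) /\
  integral_complex leb (fun x => (tent lam v x)%:C * expi2pi (w * (x - v) + c)) =
  (tent_hat lam w)%:C * expi2pi c.
Proof.
have ph x : 2 * pi * (w * (x - v) + c) = 2 * pi * w * (x - v) + 2 * pi * c by ring.
have sc (x : R) : sin x = cos (x - pi / 2) by rewrite cosB cos_pihalf sin_pihalf mulr0 add0r mulr1.
have cr x : cRe ((tent lam v x)%:C * expi2pi (w * (x - v) + c)) =
    tent lam v x * cos (2 * pi * w * (x - v) + 2 * pi * c).
  by rewrite cReM /= mul0r subr0 ph.
have ci x : cIm ((tent lam v x)%:C * expi2pi (w * (x - v) + c)) =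
    tent lam v x * cos (2 * pi * w * (x - v) + (2 * pi * c - pi / 2)).
  by rewrite cImM /= mul0r addr0 ph addrA -sc.
split.
  split; [under eq_fun do rewrite cr|under eq_fun do rewrite ci]; exact: tent_cos_integrable.
apply: complex_ext; rewrite ?cRe_integral ?cIm_integral.
  by under eq_Rintegral do rewrite cr; rewrite tent_cos// cReM /= mul0r subr0.
by under eq_Rintegral do rewrite ci; rewrite tent_cos// cImM /= mul0r addr0 sc.
Qed.

Lemma wave_fourier xi :
  integrable_complex leb (fun x => wave x * expi2pi (- (x * xi))) /\
  integral_complex leb (fun x => wave x * expi2pi (- (x * xi))) = wave_hat xi.
Proof.
have e l x : (tent lam v x)%:C * expi2pi (kap l * (x - v)) * expi2pi (- (x * xi)) =
    (tent lam v x)%:C * expi2pi (- (xi - kap l) * (x - v) + - (v * xi)).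
  by rewrite -mulrA -expi2piD; congr (_ * expi2pi _); ring.
have -> : (fun x => wave x * expi2pi (- (x * xi))) =
    fun x => \sum_l (tent lam v x)%:C * expi2pi (- (xi - kap l) * (x - v) + - (v * xi)).
  by apply/funext => x; rewrite /wave mulr_suml; apply: eq_bigr => l _; rewrite e.
have h l := tent_expi2pi (- (xi - kap l)) (- (v * xi)).
split; first by apply: integrable_complex_sum => l _; exact: (h l).1.
rewrite integral_complex_sum; last by move=> l; exact: (h l).1.
apply: eq_bigr => l _; rewrite (h l).2; congr (_%:C * _).
by rewrite /tent_hat oppr_eq0 mulrN mulNr cosN sqrrN.
Qed.

Definition wave_maj (xi : R) : R := \sum_l tent_hat lam (xi - kap l).

Lemma normc_wave_hat_le xi : normc (wave_hat xi) <= wave_maj xi.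
Proof.
apply: le_trans (normc_sum _ _ _) _; apply: ler_sum => l _.
by rewrite Normc.normcM normc_real normc_expi2pi mulr1 ger0_norm ?tent_hat_ge0.
Qed.

Lemma wave_maj_ge0 xi : 0 <= wave_maj xi.
Proof. by apply: sumr_ge0 => l _; exact: tent_hat_ge0. Qed.

Lemma wave_maj_integrable : leb.-integrable setT (EFin \o wave_maj).
Proof.
have -> : EFin \o wave_maj = fun x => (\sum_l (tent_hat lam (x - kap l))%:E)%E.
  by apply/funext => x; rewrite sumEFin.
by apply: integrable_sum => // l _; exact: tent_hat_integrable.
Qed.

Lemma Rintegral_wave_maj : \int[leb]_x wave_maj x <= 5 * K%:R.
Proof.
rewrite /Rintegral /wave_maj; under eq_integral do rewrite -sumEFin.
rewrite integral_sum//; last by move=> l; exact: tent_hat_integrable.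
rewrite -sum_fine; last first.
  by move=> l _; apply: integrable_fin_num => //; exact: tent_hat_integrable.
apply: (@le_trans _ _ (\sum_(l < K) 5)); last by rewrite sumr_const card_ord mulr_natr.
by apply: ler_sum => l _; exact: Rintegral_tent_hat.
Qed.

Lemma measurable_wave_hat : @measurable_complex _ (measurableTypeR R) R wave_hat.
Proof.
apply: measurable_complex_sum => l _; apply: measurable_complexM.
  apply: measurable_complex_real; apply: measurableT_comp; first exact: measurable_tent_hat.
  exact: measurable_funB.
by apply: measurable_complex_expi2pi; apply: measurableT_comp => //; exact: measurable_funM.
Qed.

Lemma wave_hat_integrable : integrable_complex leb wave_hat.
Proof.
exact: (@integrable_complex_le _ _ _ leb wave_hat wave_maj measurable_wave_hat wave_maj_integrable normc_wave_hat_le).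
Qed.

(* The common phase c and the integers cancel, so that all the terms lie in the half plane
   of positive real part. *)
Lemma wave_evolution_lower (x t c : R) :
  (forall l, exists k : int, forall xi, `|xi - kap l| <= 48 * lam ->
    `|(x - v) * xi + t * xi ^+ 2 - c - k%:~R| <= 6^-1) ->
  K%:R / 24 <= normc (integral_complex leb
    (fun xi => expi2pi (x * xi + t * xi ^+ 2) * wave_hat xi)).
Proof.
move=> /(_ _)/cid - /all_sig[k kP].
set psi := fun l xi => (x - v) * xi + t * xi ^+ 2 - c - (k l)%:~R.
have mpsi l : measurable_fun setT (psi l).
  apply: measurable_funB => //; apply: measurable_funB => //; apply: measurable_funD.
    exact: measurable_funM.
  by apply: measurable_funM => //; exact: measurable_funX.
have E xi : expi2pi (- c) * (expi2pi (x * xi + t * xi ^+ 2) * wave_hat xi) =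
    \sum_l (tent_hat lam (xi - kap l))%:C * expi2pi (psi l xi).
  rewrite /wave_hat !mulr_sumr; apply: eq_bigr => l _.
  transitivity ((tent_hat lam (xi - kap l))%:C *
      (expi2pi (- c) * expi2pi (x * xi + t * xi ^+ 2) * expi2pi (- (v * xi)))); first by ring.
  rewrite -!expi2piD; congr (_ * _).
  by rewrite -(expi2piDint (psi l xi) (k l)); congr expi2pi; rewrite /psi; ring.
set g := (fun xi => expi2pi (x * xi + _) * _).
have jg : integrable_complex leb g.
  apply: integrable_complexMb; first exact: wave_hat_integrable.
    apply: measurable_complex_expi2pi; apply: measurable_funD; first exact: measurable_funM.
    by apply: measurable_funM => //; exact: measurable_funX.
  by move=> xi; rewrite normc_expi2pi.
have <- : normc (expi2pi (- c) * integral_complex leb g) = normc (integral_complex leb g).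
  by rewrite Normc.normcM normc_expi2pi mul1r.
rewrite -integral_complexZ//; apply: le_trans (le_trans (ler_norm _) (normr_cRe_le _)).
rewrite cRe_integral; under eq_Rintegral do rewrite E cRe_sum.
rewrite /Rintegral; under eq_integral do rewrite -sumEFin.
have j1 l : leb.-integrable setT
    (fun xi => (cRe ((tent_hat lam (xi - kap l))%:C * expi2pi (psi l xi)))%:E).
  apply: le_integrable (tent_hat_integrable (kap l) lam0) => //.
    apply/measurable_EFinP; apply: (proj1 (measurable_complexM _ _)).
      apply: measurable_complex_real; apply: measurableT_comp; first exact: measurable_tent_hat.
      exact: measurable_funB.
    by apply: measurable_complex_expi2pi; exact: mpsi.
  move=> xi _; rewrite lee_fin; apply: le_trans (normr_cRe_le _) _.
  by rewrite Normc.normcM normc_real normc_expi2pi mulr1.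
rewrite integral_sum// -sum_fine; last by move=> l _; exact: integrable_fin_num.
have -> : K%:R / 24 = \sum_(l < K) 24^-1 :> R by rewrite sumr_const card_ord mulr_natl.
apply: ler_sum => l _.
have := tent_hat_phase lam0 (mpsi l) (kP l); rewrite /Rintegral => /le_trans; apply.
by rewrite le_eqVlt; apply/orP; left; apply/eqP; congr fine; apply: eq_integral => xi _;
  rewrite cReM /= mul0r subr0.
Qed.

(** The L^1 norm of the transform gives a bound uniform in position, time and cutoff [h]; 10 is
    twice the constant 5 of a single kernel, real and imaginary parts being treated separately. *)
Lemma wave_evolution_le (x t : R) (h : R -> R) : measurable_fun setT h ->
  (forall xi, `|h xi| <= 1) ->
  integrable_complex leb (fun xi => expi2pi (x * xi + t * xi ^+ 2) * ((h xi)%:C * wave_hat xi)) /\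
  normc (integral_complex leb
    (fun xi => expi2pi (x * xi + t * xi ^+ 2) * ((h xi)%:C * wave_hat xi))) <= 10 * K%:R.
Proof.
move=> mh h1.
have jg : integrable_complex leb
    (fun xi => expi2pi (x * xi + t * xi ^+ 2) * ((h xi)%:C * wave_hat xi)).
  apply: integrable_complexMb; last by move=> xi; rewrite normc_expi2pi.
    apply: integrable_complexMb; first exact: wave_hat_integrable.
      exact: measurable_complex_real.
    by move=> xi; rewrite normc_real.
  apply: measurable_complex_expi2pi; apply: measurable_funD; first exact: measurable_funM.
  by apply: measurable_funM => //; exact: measurable_funX.
split => //; apply: le_trans (normc_integral_le jg wave_maj_integrable _) _.
  move=> xi; rewrite !Normc.normcM normc_expi2pi mul1r normc_real.
  by apply: le_trans (normc_wave_hat_le xi); rewrite ler_piMl ?normc_ge0.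
by have := Rintegral_wave_maj; lra.
Qed.

End wave.

(** * Weighted L^2 norm of a wave: almost orthogonality of its terms *)

Section wave_weight.
Variable R : realType.
Local Notation leb := (@lebesgue_measure R).
Variables (lam v L D : R) (K : nat) (kap : 'I_K -> R).
Hypotheses (lam0 : 0 < lam) (K0 : (0 < K)%N) (lamL : lam <= L).
Hypothesis KD : K%:R * lam <= D.
Hypothesis kapL : forall l, `|kap l| <= L.
Hypothesis sep : forall l l', l != l' -> D <= `|kap l - kap l'|.

Let K1 : 1 <= K%:R :> R. Proof. by rewrite ler1n. Qed.
Let L0 : 0 < L. Proof. exact: lt_le_trans lamL. Qed.
Let lamD : lam <= D.
Proof. by apply: le_trans KD; rewrite ler_peMl// ltW. Qed.
Let D0 : 0 < D. Proof. exact: lt_le_trans lamD. Qed.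

Let weight_le l xi : (1 + `|xi| / L) * tent_hat lam (xi - kap l) <=
  2 * tent_hat lam (xi - kap l) + `|xi - kap l| * tent_hat lam (xi - kap l) / L.
Proof.
have t0 := tent_hat_ge0 (xi - kap l) lam0.
have h : `|xi| / L <= 1 + `|xi - kap l| / L.
  rewrite ler_pdivrMr// mulrDl mul1r divfK ?lt0r_neq0//.
  have := ler_normD (kap l) (xi - kap l); rewrite addrC subrK => /le_trans; apply.
  by rewrite lerD2r.
have := ler_wpM2r t0 (_ : 1 + `|xi| / L <= 2 + `|xi - kap l| / L).
move=> /(_ _) g; apply: le_trans (g _) _; first lra.
by rewrite mulrDl mulrAC.
Qed.

Let tent_hat_abs w : `|w| * tent_hat lam w <= 2^-1.
Proof.
have t0 := tent_hat_ge0 w lam0.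
rewrite -(@ler_pXn2r _ 2)// ?nnegrE ?mulr_ge0// exprMn real_normK ?num_real//.
have -> : w ^+ 2 * tent_hat lam w ^+ 2 = (tent_hat lam w * w ^+ 2) * tent_hat lam w by ring.
have -> : (2^-1 : R) ^+ 2 = (lam / 4) * lam^-1 by field; exact: lt0r_neq0.
by apply: ler_pM => //; [rewrite mulr_ge0 ?sqr_ge0|exact: tent_hat_decay|exact: tent_hat_le].
Qed.

Let near_le l xi : (1 + `|xi| / L) * tent_hat lam (xi - kap l) <= 3 / lam.
Proof.
apply: le_trans (weight_le l xi) _.
have h1 := tent_hat_le (xi - kap l) lam0.
have h2 : `|xi - kap l| * tent_hat lam (xi - kap l) / L <= 2^-1 / lam.
  by apply: ler_pM; rewrite ?mulr_ge0 ?invr_ge0 ?tent_hat_ge0 ?lef_pV2 ?posrE// ltW.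
have li : 0 < lam^-1 by rewrite invr_gt0.
lra.
Qed.

Let far_le l xi : D / 2 <= `|xi - kap l| ->
  (1 + `|xi| / L) * tent_hat lam (xi - kap l) <= 3 / lam / K%:R.
Proof.
move=> far; apply: le_trans (weight_le l xi) _; move: (xi - kap l) far => w far.
have t0 := tent_hat_ge0 w lam0.
have w0 : 0 < `|w| by apply: lt_le_trans far; rewrite divr_gt0.
have dec : tent_hat lam w * `|w| ^+ 2 <= lam / 4.
  by rewrite real_normK ?num_real//; exact: tent_hat_decay.
have k0 : 0 < K%:R :> R by rewrite ltr0n.
have h2 : `|w| * tent_hat lam w <= 2^-1 / K%:R.
  rewrite mulrC ler_pdivlMr//.
  apply: (@le_trans _ _ (tent_hat lam w * `|w| ^+ 2 * (2 * K%:R / D))).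
    have -> : tent_hat lam w * `|w| ^+ 2 * (2 * K%:R / D) =
      tent_hat lam w * `|w| * K%:R * (`|w| / (D / 2)) by field; exact: lt0r_neq0.
    by rewrite ler_peMr ?mulr_ge0// ler_pdivlMr ?divr_gt0// mul1r.
  apply: le_trans (ler_wpM2r _ dec) _; first by rewrite !mulr_ge0// invr_ge0 ltW.
  have -> : lam / 4 * (2 * K%:R / D) = 2^-1 * (K%:R * lam / D) by field; exact: lt0r_neq0.
  by rewrite ler_piMr// ler_pdivrMr// mul1r.
have h1 : tent_hat lam w <= lam^-1 / K%:R.
  have -> : tent_hat lam w = `|w| * tent_hat lam w / `|w| by field; exact: lt0r_neq0.
  apply: le_trans (ler_wpM2r _ h2) _; first by rewrite invr_ge0.
  rewrite mulrAC ler_wpM2r ?invr_ge0// -invfM lef_pV2 ?posrE ?mulr_gt0//.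
  by rewrite -ler_pdivrMl// mulrC; apply: le_trans far; rewrite ler_wpM2r.
have h3 : `|w| * tent_hat lam w / L <= 2^-1 / K%:R / lam.
  by apply: ler_pM; rewrite ?mulr_ge0 ?invr_ge0 ?lef_pV2 ?posrE// ltW.
have -> : 3 / lam / K%:R = 2 * (lam^-1 / K%:R) + 2^-1 / K%:R / lam + 2^-1 / K%:R / lam.
  by field; rewrite !lt0r_neq0.
have : 0 <= 2^-1 / K%:R / lam by rewrite !mulr_ge0 ?invr_ge0// ltW.
lra.
Qed.

(** The frequencies are D apart, so at most one of them lies within D / 2 of xi, and it contributes
    at most 3 / lam. Each of the others contributes at most 3 / (lam K), by the quadratic decay and
    K lam <= D. The bound is therefore independent of K. *)
Lemma wave_maj_weight xi : (1 + `|xi| / L) * wave_maj lam kap xi <= 6 / lam.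
Proof.
have li : 0 < lam^-1 by rewrite invr_gt0.
have far_sum (P : pred 'I_K) : (forall l, P l -> D / 2 <= `|xi - kap l|) ->
    \sum_(l | P l) (1 + `|xi| / L) * tent_hat lam (xi - kap l) <= 3 / lam.
  move=> far; apply: (@le_trans _ _ (\sum_(l < K) 3 / lam / K%:R)).
    rewrite [leRHS](bigID P) /= -[leLHS]addr0 lerD//.
      by apply: ler_sum => l Pl; exact: far_le (far _ Pl).
    by apply: sumr_ge0 => l _; rewrite !divr_ge0// ltW.
  rewrite sumr_const card_ord -[X in X <= _]mulr_natr divfK// gt_eqF//.
  by rewrite ltr0n.
rewrite /wave_maj mulr_sumr.
have [[l0 l0n]|no] := pselect (exists l, `|xi - kap l| < D / 2); last first.
  apply: le_trans (far_sum predT _) _; last lra.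
  by move=> l _; rewrite leNgt; apply/negP => h; apply: no; exists l.
rewrite (bigD1 l0)//= -[leRHS](_ : 3 / lam + 3 / lam = _); last by field; exact: lt0r_neq0.
apply: lerD; first exact: near_le.
apply: far_sum => l ll0; rewrite leNgt; apply/negP => h.
have := sep ll0; rewrite leNgt => /negP; apply.
have -> : kap l - kap l0 = (xi - kap l0) - (xi - kap l) by ring.
by apply: le_lt_trans (ler_normB _ _) _; lra.
Qed.

(** After rescaling by L, a weight linear in |xi| dominates every Sobolev weight (1 + xi^2)^s with s
    <= 1/2. *)
Definition weighted_wave_hat xi := (1 + `|xi| / L) * normc (wave_hat lam v kap xi) ^+ 2.

(** Of the two factors of the square, one absorbs the weight pointwise and the other is left to be
    integrated. *)
Lemma weighted_wave_hat_le xi : weighted_wave_hat xi <= 6 / lam * wave_maj lam kap xi.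
Proof.
have m0 : 0 <= wave_maj lam kap xi by exact: wave_maj_ge0.
apply: le_trans (ler_wpM2r m0 (wave_maj_weight xi)).
rewrite /weighted_wave_hat expr2 mulrA.
have w0 : 0 <= 1 + `|xi| / L by rewrite addr_ge0// divr_ge0// ltW.
have n := normc_wave_hat_le v kap lam0 xi.
by apply: ler_pM => //; rewrite ?mulr_ge0 ?normc_ge0//; apply: ler_wpM2l.
Qed.

Lemma weighted_wave_hat_ge0 xi : 0 <= weighted_wave_hat xi.
Proof. by rewrite mulr_ge0 ?sqr_ge0// addr_ge0// divr_ge0// ltW. Qed.

Lemma weighted_wave_hat_integrable : leb.-integrable setT (EFin \o weighted_wave_hat).
Proof.
have jm := integrableZl measurableT (6 / lam) (wave_maj_integrable kap lam0).
apply: le_integrable jm => //.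
  apply/measurable_EFinP; apply: measurable_funM.
    by apply: measurable_funD => //; apply: measurable_funM.
  apply: measurable_funX; apply: measurable_normc; exact: measurable_wave_hat.
move=> xi _; rewrite -EFinM lee_fin ger0_norm ?weighted_wave_hat_ge0//.
by apply: le_trans (weighted_wave_hat_le xi) _; rewrite ler_norm.
Qed.

Lemma Rintegral_weighted_wave_hat :
  \int[leb]_x weighted_wave_hat x <= 30 * K%:R / lam.
Proof.
have jm := integrableZl measurableT (6 / lam) (wave_maj_integrable kap lam0).
apply: (@le_trans _ _ (\int[leb]_x (6 / lam * wave_maj lam kap x))).
  apply: le_Rintegral => //; first exact: weighted_wave_hat_integrable.
  by move=> x _; exact: weighted_wave_hat_le.
rewrite RintegralZl//; last exact: wave_maj_integrable.
have l6 : 0 <= 6 / lam by rewrite divr_ge0// ltW.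
apply: le_trans (ler_wpM2l l6 (Rintegral_wave_maj kap lam0)) _.
by rewrite le_eqVlt; apply/orP; left; apply/eqP; ring.
Qed.

End wave_weight.

(** * Separation of variables for the transform and the evolution *)

Section packet.
Variables (R : realType) (n m : nat).
Local Notation leb := (@lebesgue_measure R).
Local Notation circ := (circle_measure R).
Local Notation cnt := (@counting int R).
Implicit Types (a : 'I_n -> measurableTypeR R -> R[i]) (g : 'I_m -> measurableTypeR R -> R[i]).
Implicit Types (A : 'I_n -> measurableTypeR R -> R[i]) (G : 'I_m -> int -> R[i]).

Lemma fourierL1_tensor a g (z : freq R n m) :
  (forall i xi, integrable_complex leb (fun x => a i x * expi2pi (- (x * xi)))) ->
  (forall j (k : int), integrable_complex circ (fun y => g j y * expi2pi (- (y * k%:~R)))) ->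
  integrable_complex (phys_measure R n m) (fun p => tensor a g p * expi2pi (- pairing p z)) /\
  fourierL1 (tensor a g) z =
  tensor (fun i xi => integral_complex leb (fun x => a i x * expi2pi (- (x * xi))))
         (fun j k => integral_complex circ (fun y => g j y * expi2pi (- (y * k%:~R)))) z.
Proof.
move=> ja jg.
have [j e] := mixed_tensor (fun i => ja i (tnth z.1 i)) (fun j => jg j (tnth z.2 j)).
have E : (fun p => tensor a g p * expi2pi (- pairing p z)) =
  tensor (fun i x => a i x * expi2pi (- (x * tnth z.1 i)))
         (fun j y => g j y * expi2pi (- (y * (tnth z.2 j)%:~R))).
  apply/funext => p; rewrite /tensor !big_split /= mulrACA; congr (_ * _).
  by rewrite -!expi2pi_sum -expi2piD /pairing !sumrN -opprD.
by rewrite /fourierL1 E; split => //; apply: etrans e.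
Qed.

(** The pairing, |xi|^2 + |k|^2 and the cutoff all split over the coordinates, so a tensor product
    evolves as a product of one-dimensional evolutions at the common time t. *)
Lemma evolution_tensor A G (h : R -> R) (t : R) (p : phys R n m) :
  (forall i, integrable_complex leb
     (fun xi => expi2pi (tnth p.1 i * xi + t * xi ^+ 2) * ((h xi)%:C * A i xi))) ->
  (forall j, integrable_complex cnt
     (fun k => expi2pi (tnth p.2 j * k%:~R + t * k%:~R ^+ 2) * ((h k%:~R)%:C * G j k))) ->
  let E := fun z : freq R n m => expi2pi (pairing p z + t * sqnorm z) *
    (((\prod_i h (tnth z.1 i)) * \prod_j h (tnth z.2 j)%:~R)%:C * tensor A G z) in
  integrable_complex (freq_measure R n m) E /\
  integral_complex (freq_measure R n m) E =
  (\prod_i integral_complex leb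
     (fun xi => expi2pi (tnth p.1 i * xi + t * xi ^+ 2) * ((h xi)%:C * A i xi))) *
  \prod_j integral_complex cnt
     (fun k => expi2pi (tnth p.2 j * k%:~R + t * k%:~R ^+ 2) * ((h k%:~R)%:C * G j k)).
Proof.
move=> jA jG E.
have [j1 i1] := mixed_tensor jA jG.
suff EE : E = tensor
    (fun i xi => expi2pi (tnth p.1 i * xi + t * xi ^+ 2) * ((h xi)%:C * A i xi))
    (fun j k => expi2pi (tnth p.2 j * k%:~R + t * k%:~R ^+ 2) * ((h k%:~R)%:C * G j k)).
  by rewrite EE; split.
apply/funext => z; rewrite /E /tensor rmorphM !rmorph_prod /= !big_split /=.
have -> : expi2pi (pairing p z + t * sqnorm z) =
    (\prod_i expi2pi (tnth p.1 i * tnth z.1 i + t * tnth z.1 i ^+ 2)) *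
    \prod_j expi2pi (tnth p.2 j * (tnth z.2 j)%:~R + t * (tnth z.2 j)%:~R ^+ 2).
  rewrite -!expi2pi_sum -expi2piD; congr expi2pi.
  by rewrite /pairing /sqnorm !big_split /= -!mulr_sumr; ring.
by rewrite !mulrA; ring.
Qed.

End packet.

(** * Exponential sums on the circle *)

Section circle_wave.
Variable R : realType.
Local Notation circ := (circle_measure R).
Local Notation cnt := (@counting int R).
Variables (K : nat) (kap : 'I_K -> int).
Hypothesis kap_inj : injective kap.

Definition circle_wave (y : R) : R[i] := \sum_l expi2pi ((kap l)%:~R * y).

Definition circle_wave_hat (k : int) : R[i] := \sum_l ((kap l == k)%:R)%:C.

Lemma measurable_circle_wave : @measurable_complex _ (measurableTypeR R) R circle_wave.
Proof.
apply: measurable_complex_sum => l _; apply: measurable_complex_expi2pi.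
exact: measurable_funM.
Qed.

Lemma normc_circle_wave_le y : normc (circle_wave y) <= K%:R.
Proof.
apply: le_trans (normc_sum _ _ _) _.
by under eq_bigr do rewrite normc_expi2pi; rewrite sumr_const card_ord.
Qed.

Lemma circle_wave_periodic y (k : int) : circle_wave (y + k%:~R) = circle_wave y.
Proof.
by apply: eq_bigr => l _; rewrite mulrDr -intrM expi2piDint.
Qed.

Lemma circle_wave_fourier (k : int) :
  integrable_complex circ (fun y => circle_wave y * expi2pi (- (y * k%:~R))) /\
  integral_complex circ (fun y => circle_wave y * expi2pi (- (y * k%:~R))) =
  circle_wave_hat k.
Proof.
have -> : (fun y => circle_wave y * expi2pi (- (y * k%:~R))) =
    fun y => \sum_l expi2pi ((kap l - k)%:~R * y + 0).
  apply/funext => y; rewrite /circle_wave mulr_suml; apply: eq_bigr => l _.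
  by rewrite -expi2piD; congr expi2pi; rewrite intrB; ring.
have jl l : integrable_complex circ (fun y : R => expi2pi ((kap l - k)%:~R * y + 0)).
  apply: (@circle_integrable_complex _ _ 1).
    apply: measurable_complex_expi2pi; apply: measurable_funD => //; exact: measurable_funM.
  by move=> x; rewrite normc_expi2pi.
split; first by apply: integrable_complex_sum => l _.
rewrite integral_complex_sum//; apply: eq_bigr => l _.
by rewrite circle_expi2pi expi2pi0 mulr1 subr_eq0.
Qed.

Lemma circle_wave_hat_counting (w : int -> R[i]) :
  integrable_complex cnt (fun k => w k * circle_wave_hat k) /\
  integral_complex cnt (fun k => w k * circle_wave_hat k) = \sum_l w (kap l).
Proof.
pose s := [seq kap l | l : 'I_K].
have us : uniq s by rewrite map_inj_uniq ?enum_uniq.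
have hs k : k \notin s -> w k * circle_wave_hat k = 0.
  move=> ks; rewrite /circle_wave_hat big1 ?mulr0// => l _; case: eqP => // lk.
  by rewrite -lk map_f ?mem_enum in ks.
have [j ->] := counting_integral us hs; split => //.
rewrite big_map big_enum /=; apply: eq_bigr => l _.
rewrite /circle_wave_hat (bigD1 l)//= eqxx big1 ?addr0 ?mulr1// => l' /negbTE ll'.
by rewrite (inj_eq kap_inj) ll'.
Qed.

Lemma Rintegral_weighted_circle_wave_hat (w : int -> R) :
  cnt.-integrable setT (EFin \o (fun k => w k * normc (circle_wave_hat k) ^+ 2)) /\
  \int[cnt]_k (w k * normc (circle_wave_hat k) ^+ 2) = \sum_l w (kap l).
Proof.
pose s := [seq kap l | l : 'I_K].
have us : uniq s by rewrite map_inj_uniq ?enum_uniq.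
have hs k : k \notin s -> w k * normc (circle_wave_hat k) ^+ 2 = 0.
  move=> ks; rewrite /circle_wave_hat big1 ?Normc.normc0 ?expr0n ?mulr0// => l _; case: eqP => // lk.
  by rewrite -lk map_f ?mem_enum in ks.
have [j ->] := counting_Rintegral us hs; split => //.
rewrite big_map big_enum /=; apply: eq_bigr => l _.
rewrite /circle_wave_hat (bigD1 l)//= eqxx big1 ?addr0; last first.
  by move=> l' /negbTE ll'; rewrite (inj_eq kap_inj) ll'.
by rewrite normc_real normr1 expr1n mulr1.
Qed.

(** Time enters through unimodular factors only, and a multiplier bounded by 1 does not increase the
    coefficients; Parseval then bounds the mean square at every time. *)
Lemma Rintegral_sqr_circle_evolution (t : R) (h : int -> R) : (forall k, `|h k| <= 1) ->
  circ.-integrable setT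
    (fun y => (normc (\sum_l expi2pi (y * (kap l)%:~R + t * (kap l)%:~R ^+ 2) * (h (kap l))%:C)
               ^+ 2)%:E) /\
  \int[circ]_y (normc (\sum_l expi2pi (y * (kap l)%:~R + t * (kap l)%:~R ^+ 2) * (h (kap l))%:C)
     ^+ 2) <= K%:R.
Proof.
move=> h1.
pose f (y : R) := \sum_l expi2pi (y * (kap l)%:~R + t * (kap l)%:~R ^+ 2) * (h (kap l))%:C.
change (circ.-integrable setT (fun y => (normc (f y) ^+ 2)%:E) /\
  \int[circ]_y (normc (f y) ^+ 2) <= K%:R).
have fE y : f y = \sum_l (h (kap l))%:C * expi2pi ((kap l)%:~R * y + t * (kap l)%:~R ^+ 2).
  by apply: eq_bigr => l _; rewrite mulrC [y * _]mulrC.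
split.
  have mf : @measurable_complex _ (measurableTypeR R) R f.
    apply: measurable_complex_sum => l _; apply: measurable_complexM.
      apply: measurable_complex_expi2pi; apply: measurable_funD => //; exact: measurable_funM.
    exact: measurable_complex_cst.
  apply: (@circle_integrable _ _ (K%:R ^+ 2)).
    by apply: measurable_funX; exact: measurable_normc.
  move=> y; rewrite ger0_norm ?sqr_ge0// ler_pXn2r ?nnegrE ?normc_ge0//.
  apply: le_trans (normc_sum _ _ _) _.
  rewrite -[K in leRHS]card_ord -sumr_const; apply: ler_sum => l _.
  by rewrite Normc.normcM normc_expi2pi mul1r normc_real.
under eq_Rintegral do rewrite fE.
rewrite circle_Parseval// -[K in leRHS]card_ord -sumr_const; apply: ler_sum => l _.
by rewrite -real_normK ?num_real// expr_le1.
Qed.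

Lemma Rintegral_normc_circle_wave :
  circ.-integrable setT (fun y => (normc (circle_wave y) ^+ 2)%:E) /\
  \int[circ]_y (normc (circle_wave y) ^+ 2) <= K%:R.
Proof.
have [] := @Rintegral_sqr_circle_evolution 0 (fun=> 1) (fun=> _); first by rewrite normr1.
have e y : \sum_l expi2pi (y * (kap l)%:~R + 0 * (kap l)%:~R ^+ 2) * (1 : R)%:C = circle_wave y.
  by apply: eq_bigr => l _; rewrite mulr1 mul0r addr0 mulrC.
by under eq_fun do rewrite e; under [in X in _ -> X -> _]eq_Rintegral do rewrite e.
Qed.

End circle_wave.

(** * Arithmetic of the frequencies *)

Section arithmetic.
Variable R : realType.

(** Up to the common phase c, all the terms lie in the sector where the real part is at least
    1/2. *)
Lemma sum_phase_lower K (a : 'I_K -> R) (c : R) :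
  (forall l, exists k : int, `|a l - c - k%:~R| <= 6^-1) ->
  K%:R / 2 <= normc (\sum_l expi2pi (a l)).
Proof.
move=> /(_ _)/cid - /all_sig[k kP].
have <- : normc (expi2pi (- c) * \sum_l expi2pi (a l)) = normc (\sum_l expi2pi (a l)).
  by rewrite Normc.normcM normc_expi2pi mul1r.
apply: le_trans (le_trans (ler_norm _) (normr_cRe_le _)).
rewrite mulr_sumr cRe_sum.
have -> : K%:R / 2 = \sum_(l < K) 2^-1 :> R by rewrite sumr_const card_ord mulr_natl.
apply: ler_sum => l _; rewrite -expi2piD.
have -> : - c + a l = (a l - c - (k l)%:~R) + (k l)%:~R by ring.
by rewrite expi2piDint; exact: cos_ge_half.
Qed.

(* The base-B digits of r make r / B, r / B^2, ... simultaneously close modulo 1 to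
   prescribed targets. *)
Lemma digits (B : nat) (z : nat -> R) d : (0 < B)%N ->
  exists r : nat, (r < B ^ d)%N /\
    forall i, (i < d)%N -> exists k : int, `|r%:R / B%:R ^+ i.+1 - z i - k%:~R| <= B%:R^-1.
Proof.
move=> B0; have Br0 : 0 < B%:R :> R by rewrite ltr0n.
elim: d => [|d [r [rB IH]]]; first by exists 0%N.
pose fr := z d - (Num.floor (z d))%:~R.
have fr0 : 0 <= fr by rewrite subr_ge0 floor_le_tmp.
have fr1 : fr < 1 by rewrite ltrBlDl; have := lt_succ_floor (z d); rewrite intrD.
(* The new leading digit is the integer part of B times the fractional part of z d. The error is
   that rounding, in (-1, 0], plus r / B^d in [0, 1], all divided by B. *)
pose e := Num.truncn (B%:R * fr).
have Bf0 : 0 <= B%:R * fr by rewrite mulr_ge0// ltW.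
have /andP[e1 e2] : e%:R <= B%:R * fr < e.+1%:R by exact: truncn_itv.
have eB : (e < B)%N.
  rewrite -(ltr_nat R); apply: le_lt_trans e1 _.
  by rewrite -[ltRHS]mulr1 ltr_pM2l.
exists (r + e * B ^ d)%N; split.
  by rewrite expnS; nia.
move=> i; rewrite ltnS leq_eqVlt => /orP[/eqP ->|id].
  exists (- Num.floor (z d)).
  rewrite intrN opprK.
  have -> : (r + e * B ^ d)%:R / B%:R ^+ d.+1 - z d + (Num.floor (z d))%:~R =
      (r%:R / B%:R ^+ d + (e%:R - B%:R * fr)) / B%:R :> R.
    rewrite /fr natrD natrM natrX exprS; field.
    by rewrite expf_neq0 gt_eqF.
  rewrite normrM [`|B%:R^-1|]ger0_norm ?invr_ge0 ?(ltW Br0)// ler_piMl ?invr_ge0 ?(ltW Br0)//.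
  have q0 : 0 <= r%:R / B%:R ^+ d :> R by rewrite divr_ge0// exprn_ge0// ltW.
  have q1 : r%:R / B%:R ^+ d <= 1 :> R.
    by rewrite ler_pdivrMr ?exprn_gt0// mul1r -natrX ler_nat ltnW.
  by rewrite ler_norml; move: e1 e2; rewrite -natr1; lra.
have [k kP] := IH i id.
(* For i < d the new digit changes r / B^(i + 1) by an integer. *)
exists (k + (e * B ^ (d - i.+1))%:Z).
have -> : (r + e * B ^ d)%:R / B%:R ^+ i.+1 = r%:R / B%:R ^+ i.+1 + (e * B ^ (d - i.+1))%:R :> R.
  rewrite natrD mulrDl; congr (_ + _).
  rewrite -{1}(subnK id) expnD mulnA natrM natrX mulfK// expf_neq0// gt_eqF//.
rewrite intrD.
by move: kP; congr (`|_| <= _); rewrite -[((e * _)%N%:Z)%:~R]/((e * B ^ (d - i.+1))%:R); ring.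
Qed.

(** The offset [p0] is absorbed into the targets. *)
Lemma digits_window (B : nat) (z : nat -> R) d p0 : (0 < B)%N ->
  exists p : nat, (p0 <= p < p0 + B ^ d)%N /\
    forall i, (i < d)%N -> exists k : int, `|p%:R / B%:R ^+ i.+1 - z i - k%:~R| <= B%:R^-1.
Proof.
move=> B0; have [r [rB rP]] := digits (fun i => z i - p0%:R / B%:R ^+ i.+1) d B0.
exists (p0 + r)%N; split; first by rewrite leq_addr ltn_add2l.
move=> i /rP [k kP]; exists k; move: kP; congr (`|_| <= _).
by rewrite natrD mulrDl; ring.
Qed.

Lemma weight_prod_bound I (r : seq I) (X : I -> R) : (forall i, 0 <= X i) ->
  1 + \sum_(i <- r) X i <= \prod_(i <- r) (1 + X i).
Proof.
move=> X0; elim: r => [|i r IH]; first by rewrite !big_nil addr0.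
rewrite !big_cons; have s0 : 0 <= \sum_(j <- r) X j by exact: sumr_ge0.
apply: le_trans (ler_wpM2l (addr_ge0 ler01 (X0 i)) IH).
by have := mulr_ge0 (X0 i) s0; lra.
Qed.

Lemma powR_sqr_le (x s : R) : 0 <= x -> s <= 2^-1 -> (1 + x ^+ 2) `^ s <= 1 + x.
Proof.
move=> x0 s2.
have x1 : 1 <= 1 + x ^+ 2 by rewrite lerDl sqr_ge0.
apply: le_trans (ler_powR x1 s2) _; rewrite powR12_sqrt ?(le_trans ler01)//.
rewrite -[leRHS]ger0_norm ?addr_ge0// -sqrtr_sqr ler_wsqrtr//.
by rewrite sqrrD expr1n mul1r addrAC lerDl mulrn_wge0.
Qed.

(** The tensor structure calls for a weight that is a product over the coordinates. After rescaling
    by L, 1 + |z|^2 is at most L^2 times the product of the 1 + (z_i / L)^2, and an exponent at most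
    1/2 reduces each factor to 1 + |z_i| / L. A negative s is replaced by 0. *)
Lemma sobolev_weight_le n m (z : freq R n m) (L s : R) : 1 <= L -> s <= 2^-1 ->
  (1 + sqnorm z) `^ s <= L `^ (2 * Num.max s 0) *
    ((\prod_i (1 + `|tnth z.1 i| / L)) * \prod_j (1 + `|(tnth z.2 j)%:~R| / L)).
Proof.
move=> L1 s2; set s1 := Num.max s 0.
have L0 : 0 < L by exact: lt_le_trans L1.
have s10 : 0 <= s1 by rewrite le_max lexx orbT.
have s12 : s1 <= 2^-1 by rewrite ge_max s2 /=; lra.
have q0 : 0 <= sqnorm z by rewrite addr_ge0// sumr_ge0// => i _; rewrite sqr_ge0.
have h1 : (1 + sqnorm z) `^ s <= (1 + sqnorm z) `^ s1.
  by apply: ler_powR; rewrite ?lerDl// le_max lexx.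
apply: le_trans h1 _.
pose P : R := (\prod_i (1 + (`|tnth z.1 i| / L) ^+ 2)) * \prod_j (1 + (`|(tnth z.2 j)%:~R| / L) ^+ 2).
have P1i I (r : seq I) (X : I -> R) : 0 <= \prod_(i <- r) (1 + X i ^+ 2).
  by rewrite prodr_ge0// => i _; rewrite addr_ge0// sqr_ge0.
have h2 : 1 + sqnorm z <= L ^+ 2 * P.
  have -> : sqnorm z = L ^+ 2 * (\sum_i (`|tnth z.1 i| / L) ^+ 2 + \sum_j (`|(tnth z.2 j)%:~R| / L) ^+ 2).
    have e (x : R) : x ^+ 2 = L ^+ 2 * (`|x| / L) ^+ 2.
      by rewrite expr_div_n real_normK ?num_real// mulrC divfK// expf_neq0// gt_eqF.
    by rewrite /sqnorm mulrDr !mulr_sumr; congr (_ + _); apply: eq_bigr => i _; exact: e.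
  set S1 := \sum_i _; set S2 := \sum_j _.
  have hS1 : 1 + S1 <= \prod_i (1 + (`|tnth z.1 i| / L) ^+ 2).
    by apply: weight_prod_bound => i; rewrite sqr_ge0.
  have hS2 : 1 + S2 <= \prod_j (1 + (`|(tnth z.2 j)%:~R| / L) ^+ 2).
    by apply: weight_prod_bound => i; rewrite sqr_ge0.
  have S10 : 0 <= S1 by apply: sumr_ge0 => i _; rewrite sqr_ge0.
  have S20 : 0 <= S2 by apply: sumr_ge0 => i _; rewrite sqr_ge0.
  apply: (@le_trans _ _ (L ^+ 2 * ((1 + S1) * (1 + S2)))).
    have : 1 <= L ^+ 2 by exact: exprn_ege1.
    have : 0 <= L ^+ 2 * (S1 * S2) by rewrite mulr_ge0 ?sqr_ge0// mulr_ge0.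
    by lra.
  by rewrite ler_wpM2l ?sqr_ge0//; apply: ler_pM => //; rewrite addr_ge0.
have P0 : 0 <= P by rewrite mulr_ge0.
apply: (@le_trans _ _ ((L ^+ 2 * P) `^ s1)).
  have LP0 : 0 <= L ^+ 2 * P by rewrite mulr_ge0 ?sqr_ge0.
  by apply: ge0_ler_powR => //; rewrite nnegrE addr_ge0.
rewrite powRM ?sqr_ge0//.
have -> : (L ^+ 2) `^ s1 = L `^ (2 * s1) by rewrite -powR_mulrn ?(ltW L0)// -powRrM.
rewrite ler_wpM2l ?powR_ge0//.
have pp I (r : seq I) (X : I -> R) : (forall i, 0 <= X i) ->
    (\prod_(i <- r) (1 + X i ^+ 2)) `^ s1 <= \prod_(i <- r) (1 + X i).
  move=> X0; elim: r => [|i r IH]; first by rewrite !big_nil powR1.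
  rewrite !big_cons powRM ?addr_ge0 ?sqr_ge0//.
  by apply: ler_pM; rewrite ?powR_ge0//; exact: powR_sqr_le.
by rewrite /P powRM//; apply: ler_pM; rewrite ?powR_ge0//; apply: pp => i; rewrite divr_ge0// ltW.
Qed.

Lemma powR_small (e C eps : R) : 0 < e -> 0 < eps ->
  exists b0, forall b, (b0 <= b)%N -> C * (2 ^+ b) `^ (- e) <= eps.
Proof.
move=> e0 eps0.
have q1 : `|2 `^ (- e)| < 1 :> R.
  rewrite ger0_norm ?powR_ge0// powRN invf_lt1 ?powR_gt0//.
  rewrite -[ltLHS](_ : 1 `^ e = 1); last by rewrite powR1.
  by apply: gt0_ltr_powR; rewrite ?nnegrE ?ltr1n.
have := cvg_geometric C q1 => /cvgrPdist_lt /(_ _ eps0)[b0 _ hb].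
exists b0 => b /hb; rewrite /geometric /= sub0r normrN => /ltW.
apply: le_trans; apply: le_trans (ler_norm _).
rewrite le_eqVlt; apply/orP; left; apply/eqP; congr (_ * _).
by rewrite -powR_mulrn// -powRrM mulrC powRrM powR_mulrn ?powR_ge0.
Qed.

End arithmetic.

(** * Wave packets *)

Section generic_packet.
Variables (R : realType) (n m : nat).
Local Notation leb := (@lebesgue_measure R).
Local Notation circ := (circle_measure R).
Local Notation cnt := (@counting int R).
Variables (c L : R) (lam v D : 'I_n -> R) (K : 'I_n -> nat) (kap : forall i, 'I_(K i) -> R).
Variables (N r : nat) (kT : 'I_m -> 'I_N -> nat).
Hypotheses (c0 : 0 <= c) (L1 : 1 <= L).
Hypotheses (lam0 : forall i, 0 < lam i) (K0 : forall i, (0 < K i)%N) (lamL : forall i, lam i <= L).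
Hypothesis KD : forall i, (K i)%:R * lam i <= D i.
Hypothesis kapL : forall i l, `|@kap i l| <= L.
Hypothesis sep : forall i l l', l != l' -> D i <= `|@kap i l - @kap i l'|.
Hypothesis kT_inj : forall j, injective (kT j).
Hypothesis kT_lb : forall j l, (2 ^ r <= kT j l)%N.
Hypothesis kT_ub : forall j l, (kT j l < 2 ^ r.+1)%N.
Hypothesis kTL : forall j l, (kT j l)%:R <= L.

Let a i : measurableTypeR R -> R[i] := wave (lam i) (v i) (@kap i).
Let ahat i : measurableTypeR R -> R[i] := wave_hat (lam i) (v i) (@kap i).
Let kZ j (l : 'I_N) : int := (kT j l)%:Z.
Let g j : measurableTypeR R -> R[i] := circle_wave (kZ j).
Let ghat j : int -> R[i] := circle_wave_hat R (kZ j).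

Let kZ_inj j : injective (kZ j).
Proof. by move=> l l' [] /kT_inj. Qed.

Definition packet (p : phys R n m) : R[i] := c%:C * tensor a g p.
Definition packet_hat (z : freq R n m) : R[i] := c%:C * tensor ahat ghat z.

Lemma packet_periodic : Defs.periodic packet.
Proof.
move=> x y k; rewrite /packet /tensor /=; congr (_ * (_ * _)).
by apply: eq_bigr => j _; rewrite tnth_mktuple /g circle_wave_periodic.
Qed.

Lemma packet_support (p : phys R n m) i : packet p != 0 -> `|tnth p.1 i - v i| < (lam i)^-1.
Proof.
move=> p0; rewrite ltNge; apply/negP => h; move: p0; rewrite /packet /tensor (bigD1 i)//=.
by rewrite /a wave_eq0// !(mul0r, mulr0) eqxx.
Qed.

Let g_integrable j : integrable_complex circ (g j).
Proof.
apply: (@circle_integrable_complex _ _ N%:R); first exact: measurable_circle_wave.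
by move=> y; exact: normc_circle_wave_le.
Qed.

Let ghat_integrable j : integrable_complex cnt (ghat j).
Proof.
have [h _] := circle_wave_hat_counting (@kZ_inj j) (fun _ : int => 1 : R[i]).
suff -> : ghat j = fun k => 1 * circle_wave_hat R (kZ j) k by [].
by apply/funext => k; rewrite mul1r.
Qed.

Lemma packet_integrable : integrable_complex (phys_measure R n m) packet.
Proof.
apply: integrable_complexZ.
by have [] := mixed_tensor (fun i => wave_integrable (v i) (@kap i) (lam0 i)) g_integrable.
Qed.

Lemma packet_hat_integrable : integrable_complex (freq_measure R n m) packet_hat.
Proof.
apply: integrable_complexZ.
by have [] := mixed_tensor (fun i => wave_hat_integrable (v i) (@kap i) (lam0 i)) ghat_integrable.
Qed.

Lemma packet_fourier z : fourierL1 packet z = packet_hat z.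
Proof.
have [j e] := fourierL1_tensor z
  (fun i xi => (wave_fourier (v i) (@kap i) (lam0 i) xi).1)
  (fun j k => (@circle_wave_fourier R N (kZ j) k).1).
rewrite /fourierL1 /packet.
under eq_integral_complex do rewrite -mulrA.
rewrite integral_complexZ//; congr (_ * _); rewrite -/(fourierL1 _ _) e /tensor.
congr (_ * _); apply: eq_bigr => i _.
  by have [_ ->] := wave_fourier (v i) (@kap i) (lam0 i) (tnth z.1 i).
by have [_ ->] := @circle_wave_fourier R N (kZ i) (tnth z.2 i).
Qed.

Lemma packet_hat_support z j : packet_hat z != 0 -> (2 ^ r <= `|tnth z.2 j|)%N.
Proof.
move=> z0; apply: contraT => h.
suff e : ghat j (tnth z.2 j) = 0.
  by move: z0; rewrite /packet_hat /tensor [X in _ * (_ * X)](bigD1 j)//= e mul0r !mulr0 eqxx.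
rewrite /ghat /circle_wave_hat big1// => l _; case: eqP => // e.
by case/negP: h; rewrite -e /kZ absz_nat; exact: kT_lb.
Qed.

Let normc_packet p : normc (packet p) =
  c * ((\prod_i normc (a i (tnth p.1 i))) * \prod_j normc (g j (tnth p.2 j))).
Proof.
by rewrite /packet Normc.normcM normc_real ger0_norm// /tensor Normc.normcM !normc_prod.
Qed.

Let normc_packet_hat z : normc (packet_hat z) =
  c * ((\prod_i normc (ahat i (tnth z.1 i))) * \prod_j normc (ghat j (tnth z.2 j))).
Proof.
by rewrite /packet_hat Normc.normcM normc_real ger0_norm// /tensor Normc.normcM !normc_prod.
Qed.

Lemma Rintegral_normc_packet :
  \int[phys_measure R n m]_p normc (packet p) <=
  c * ((\prod_i ((K i)%:R / lam i)) * N%:R ^+ m).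
Proof.
have ja i : leb.-integrable setT (EFin \o (fun x => normc (a i x))).
  exact: integrable_normc (wave_integrable (v i) (@kap i) (lam0 i)).
have jg j : circ.-integrable setT (EFin \o (fun y => normc (g j y))).
  exact: integrable_normc (g_integrable j).
have [j e] := mixed_tensor_real ja jg.
under eq_Rintegral do rewrite normc_packet.
rewrite RintegralZl// e ler_wpM2l//; apply: ler_pM.
- by apply: prodr_ge0 => i _; apply: Rintegral_ge0 => x _; exact: normc_ge0.
- by apply: prodr_ge0 => i _; apply: Rintegral_ge0 => x _; exact: normc_ge0.
- apply: ler_prod => i _; apply/andP; split; last exact: Rintegral_normc_wave.
  by apply: Rintegral_ge0 => x _; exact: normc_ge0.
rewrite -[m in leRHS]card_ord -prodr_const; apply: ler_prod => i _; apply/andP; split.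
  by apply: Rintegral_ge0 => x _; exact: normc_ge0.
apply: (@le_trans _ _ (\int[circ]_y N%:R)).
  apply: le_Rintegral => //.
    by apply: (@circle_integrable _ _ N%:R) => // x; rewrite ger0_norm.
  by move=> y _; exact: normc_circle_wave_le.
rewrite Rintegral_cst// /circle_measure /= /mfrestr /mrestr setTI lebesgue_measure_itv/= lte01.
by rewrite oppr0 adde0 mulr1.
Qed.

Lemma Rintegral_sqr_normc_packet :
  (phys_measure R n m).-integrable setT (fun p => (normc (packet p) ^+ 2)%:E) /\
  \int[phys_measure R n m]_p (normc (packet p) ^+ 2) <=
  c ^+ 2 * ((\prod_i ((K i)%:R ^+ 2 / lam i)) * N%:R ^+ m).
Proof.
have ja i : leb.-integrable setT (EFin \o (fun x => normc (a i x) ^+ 2)).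
  exact: (sqr_normc_wave_integrable (v i) (@kap i) (lam0 i)).
have hg j := @Rintegral_normc_circle_wave R N (kZ j) (@kZ_inj j).
have jg j : circ.-integrable setT (EFin \o (fun y => normc (g j y) ^+ 2)) := (hg j).1.
have [j e] := mixed_tensor_real ja jg.
have E p : normc (packet p) ^+ 2 = c ^+ 2 *
  ((\prod_i normc (a i (tnth p.1 i)) ^+ 2) * \prod_j normc (g j (tnth p.2 j)) ^+ 2).
  by rewrite normc_packet exprMn exprMn !prodrXl.
split.
  by apply: eq_integrable (integrableZl measurableT (c ^+ 2) j) => // p _; rewrite E EFinM.
under eq_Rintegral do rewrite E.
rewrite RintegralZl// e ler_wpM2l ?sqr_ge0//; apply: ler_pM.
- by apply: prodr_ge0 => i _; apply: Rintegral_ge0 => x _; exact: sqr_ge0.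
- by apply: prodr_ge0 => i _; apply: Rintegral_ge0 => x _; exact: sqr_ge0.
- apply: ler_prod => i _; apply/andP; split; last exact: Rintegral_sqr_normc_wave.
  by apply: Rintegral_ge0 => x _; exact: sqr_ge0.
rewrite -[m in leRHS]card_ord -prodr_const; apply: ler_prod => i _; apply/andP; split.
  by apply: Rintegral_ge0 => x _; exact: sqr_ge0.
exact: (hg i).2.
Qed.

(** The dominating weight is a product, so the integral factors. A torus factor counts N
    frequencies, each with a weight 1 + k / L of at most 2. *)
Lemma Rintegral_sobolev_packet (s : R) : s <= 2^-1 ->
  (freq_measure R n m).-integrable setT
    (fun z => ((1 + sqnorm z) `^ s * normc (packet_hat z) ^+ 2)%:E) /\
  \int[freq_measure R n m]_z ((1 + sqnorm z) `^ s * normc (packet_hat z) ^+ 2) <=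
  c ^+ 2 * L `^ (2 * Num.max s 0) * ((\prod_i (30 * (K i)%:R / lam i)) * (2 * N%:R) ^+ m).
Proof.
move=> s2; have L0 : 0 < L by exact: lt_le_trans L1.
have ja i : leb.-integrable setT (EFin \o weighted_wave_hat (lam i) (v i) L (@kap i)).
  exact: (weighted_wave_hat_integrable (v i) (lam0 i) (K0 i) (lamL i) (KD i) (@kapL i) (@sep i)).
have hg j := Rintegral_weighted_circle_wave_hat (@kZ_inj j) (fun k => 1 + `|k%:~R| / L).
have [j e] := mixed_tensor_real ja (fun j => (hg j).1).
set w : R := L `^ (2 * Num.max s 0).
have w0 : 0 <= w by exact: powR_ge0.
have E z : (1 + sqnorm z) `^ s * normc (packet_hat z) ^+ 2 <= c ^+ 2 * w *
  ((\prod_i weighted_wave_hat (lam i) (v i) L (@kap i) (tnth z.1 i)) *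
   \prod_j ((1 + `|(tnth z.2 j)%:~R| / L) * normc (ghat j (tnth z.2 j)) ^+ 2)).
  apply: le_trans (ler_wpM2r (sqr_ge0 _) (sobolev_weight_le z L1 s2)) _.
  rewrite normc_packet_hat /weighted_wave_hat !big_split /= !exprMn.
  rewrite le_eqVlt; apply/orP; left; apply/eqP; rewrite /ahat -/w; ring.
have mS : measurable_fun setT (fun z : freq R n m => (1 + sqnorm z) `^ s * normc (packet_hat z) ^+ 2).
  apply: measurable_funM; last first.
    apply: measurable_funX; apply: measurable_normc.
    exact: integrable_complex_measurable packet_hat_integrable.
  suff m1 : measurable_fun setT (fun z : freq R n m => 1 + sqnorm z).
    exact: (measurableT_comp (measurable_powR s) m1).
  apply: measurable_funD => //; rewrite /sqnorm; apply: measurable_funD.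
    apply: measurable_sum => i; apply: measurable_funX.
    exact: (measurableT_comp (measurable_tnth i) measurable_fst).
  apply: measurable_sum => i; apply: measurable_funX.
  apply: (measurableT_comp (measurable_fun_int (fun k : int => k%:~R : R))).
  exact: (measurableT_comp (measurable_tnth i) measurable_snd).
have jM := integrableZl measurableT (c ^+ 2 * w) j.
have S0 z : 0 <= (1 + sqnorm z) `^ s * normc (packet_hat z) ^+ 2.
  by rewrite mulr_ge0 ?powR_ge0 ?sqr_ge0.
have jS : (freq_measure R n m).-integrable setT
    (fun z => ((1 + sqnorm z) `^ s * normc (packet_hat z) ^+ 2)%:E).
  apply: le_integrable jM => //; first exact/measurable_EFinP.
  move=> z _; rewrite -EFinM lee_fin ger0_norm//.
  by apply: le_trans (E z) _; rewrite ler_norm.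
split => //.
apply: (@le_trans _ _ (\int[freq_measure R n m]_z (c ^+ 2 * w *
  ((\prod_i weighted_wave_hat (lam i) (v i) L (@kap i) (tnth z.1 i)) *
   \prod_j ((1 + `|(tnth z.2 j)%:~R| / L) * normc (ghat j (tnth z.2 j)) ^+ 2))))).
  by apply: le_Rintegral.
rewrite RintegralZl// e ler_wpM2l ?mulr_ge0 ?sqr_ge0//; apply: ler_pM.
- apply: prodr_ge0 => i _; apply: Rintegral_ge0 => x _.
  by apply: weighted_wave_hat_ge0 (lam0 i) (lamL i) _.
- apply: prodr_ge0 => i _; apply: Rintegral_ge0 => x _.
  by rewrite mulr_ge0 ?sqr_ge0// addr_ge0// divr_ge0// ltW.
- apply: ler_prod => i _; apply/andP; split.
    apply: Rintegral_ge0 => x _; by apply: weighted_wave_hat_ge0 (lam0 i) (lamL i) _.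
  exact: (Rintegral_weighted_wave_hat (v i) (lam0 i) (K0 i) (lamL i) (KD i) (@kapL i) (@sep i)).
rewrite -[m in leRHS]card_ord -prodr_const; apply: ler_prod => i _; apply/andP; split.
  by apply: Rintegral_ge0 => x _; rewrite mulr_ge0 ?sqr_ge0// addr_ge0// divr_ge0// ltW.
have -> : 2 * N%:R = \sum_(l < N) 2 :> R by rewrite sumr_const card_ord mulr_natr.
rewrite (hg i).2; apply: ler_sum => l _.
rewrite ger0_norm//; have : (kT i l)%:R / L <= 1 by rewrite ler_pdivrMr// mul1r.
by rewrite /kZ /=; lra.
Qed.

Definition torus_evolution (h : R -> R) (t : R) (y : m.-tuple (measurableTypeR R)) : R[i] :=
  \prod_j \sum_l expi2pi (tnth y j * (kZ j l)%:~R + t * (kZ j l)%:~R ^+ 2) * (h (kZ j l)%:~R)%:C.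

Lemma packet_evolution (h : R -> R) (t : R) (p : phys R n m) : measurable_fun setT h ->
  (forall x, `|h x| <= 1) ->
  let E := fun z : freq R n m => expi2pi (pairing p z + t * sqnorm z) *
    (((\prod_i h (tnth z.1 i)) * \prod_j h (tnth z.2 j)%:~R)%:C * packet_hat z) in
  integrable_complex (freq_measure R n m) E /\
  integral_complex (freq_measure R n m) E = c%:C *
    ((\prod_i integral_complex leb (fun xi =>
       expi2pi (tnth p.1 i * xi + t * xi ^+ 2) * ((h xi)%:C * ahat i xi))) *
    torus_evolution h t p.2).
Proof.
move=> mh h1 E.
have hi i := wave_evolution_le (v i) (@kap i) (lam0 i) (tnth p.1 i) t mh h1.
have hj j := circle_wave_hat_counting (@kZ_inj j) (fun k : int =>
  expi2pi (tnth p.2 j * k%:~R + t * k%:~R ^+ 2) * (h k%:~R)%:C).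
have jj j : integrable_complex cnt (fun k : int =>
    expi2pi (tnth p.2 j * k%:~R + t * k%:~R ^+ 2) * ((h k%:~R)%:C * ghat j k)).
  have [+ _] := hj j; congr integrable_complex.
  by apply/funext => k; rewrite mulrA.
have [j e] := evolution_tensor (fun i => (hi i).1) jj.
have -> : E = fun z => c%:C * (expi2pi (pairing p z + t * sqnorm z) *
    (((\prod_i h (tnth z.1 i)) * \prod_j h (tnth z.2 j)%:~R)%:C * tensor ahat ghat z)).
  by apply/funext => z; rewrite /E /packet_hat; ring.
split; first exact: integrable_complexZ.
rewrite integral_complexZ// e; congr (_ * (_ * _)).
apply: eq_bigr => i _; have [_ <-] := hj i.
by apply: eq_integral_complex => k; rewrite mulrA.
Qed.

Lemma packet_lower (t : R) (p : phys R n m) :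
  (forall i, exists q : R, forall l, exists k : int, forall xi, `|xi - @kap i l| <= 48 * lam i ->
    `|(tnth p.1 i - v i) * xi + t * xi ^+ 2 - q - k%:~R| <= 6^-1) ->
  (forall j, exists q : R, forall l, exists k : int,
    `|tnth p.2 j * (kT j l)%:R + t * (kT j l)%:R ^+ 2 - q - k%:~R| <= 6^-1) ->
  c * ((\prod_i ((K i)%:R / 24)) * (N%:R / 2) ^+ m) <=
  normc (integral_complex (freq_measure R n m) (schrodinger_integrand packet_hat t p)).
Proof.
move=> hx hy.
have m1 : measurable_fun setT (fun _ : R => 1 : R) by [].
have [] := packet_evolution t p m1 (fun x => (_ : `|1 : R| <= 1)); first by rewrite normr1.
set E := (fun z : freq R n m => _); move=> _.
have -> : schrodinger_integrand packet_hat t p = E.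
  by apply/funext => z; rewrite /E !big1// mulr1 mul1r.
move=> ->; rewrite !Normc.normcM normc_real (ger0_norm c0) ler_wpM2l//.
rewrite normc_prod /torus_evolution normc_prod; apply: ler_pM.
- by apply: prodr_ge0 => i _; rewrite divr_ge0.
- by rewrite exprn_ge0// divr_ge0.
- apply: ler_prod => i _; apply/andP; split; first by rewrite divr_ge0.
  have [q qP] := hx i.
  apply: le_trans (wave_evolution_lower (lam0 i) qP) _.
  rewrite le_eqVlt; apply/orP; left; apply/eqP; congr normc.
  by apply: eq_integral_complex => xi; rewrite mul1r.
rewrite -[m in leLHS]card_ord -prodr_const; apply: ler_prod => j _; apply/andP; split.
  by rewrite divr_ge0.
have [q qP] := hy j.
have := sum_phase_lower (a := fun l => tnth p.2 j * (kT j l)%:R + t * (kT j l)%:R ^+ 2) qP.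
move=> /le_trans; apply; rewrite le_eqVlt; apply/orP; left; apply/eqP; congr normc.
by apply: eq_bigr => l _; rewrite mulr1.
Qed.

Section tail.
Variables (eta1 : R -> R) (ts : seq R).
Hypothesis ceta : cutoff eta1.

(** On the torus frequencies every dyadic cutoff reduces to 0, to 1 or to the one at scale 2^r, so
    two terms per time control all of them. The Euclidean factors are replaced by their bounds 10
    K_i, which makes the majorant a function of y alone. *)
Definition torus_majorant (y : m.-tuple (measurableTypeR R)) : R :=
  (c * \prod_i (10 * (K i)%:R)) ^+ 2 *
  \sum_(t <- ts) (normc (torus_evolution (fun x => eta1 (x / 2 ^+ r)) t y) ^+ 2 +
                  normc (torus_evolution (fun=> 1) t y) ^+ 2).

Let meta (q : R) : measurable_fun setT (fun x : R => eta1 (x / q)).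
Proof.
have [de _ _ _ _] := ceta.
have ce : continuous eta1 by apply: derivable_continuous => x; exact: (de 0%N).
apply: (measurableT_comp (continuous_measurable_fun ce)).
exact: measurable_funM.
Qed.

Let eta_le1 x : `|eta1 x| <= 1.
Proof. by have [_ /(_ x)/andP[e0 e1] _ _ _] := ceta; rewrite ger0_norm. Qed.

Let torus_evolution_integrable (h : R -> R) (t : R) : (forall x, `|h x| <= 1) ->
  (tuple_measure circ m).-integrable setT (fun y => (normc (torus_evolution h t y) ^+ 2)%:E) /\
  \int[tuple_measure circ m]_y (normc (torus_evolution h t y) ^+ 2) <= N%:R ^+ m.
Proof.
move=> h1.
have hj j := @Rintegral_sqr_circle_evolution R N (kZ j) (@kZ_inj j) t
  (fun k => h k%:~R) (fun k => h1 _).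
have [j e] := tuple_tensor_real (fun j => (hj j).1).
have E y : normc (torus_evolution h t y) ^+ 2 = \prod_j (normc (\sum_l
    expi2pi (tnth y j * (kZ j l)%:~R + t * (kZ j l)%:~R ^+ 2) * (h (kZ j l)%:~R)%:C) ^+ 2).
  by rewrite /torus_evolution normc_prod prodrXl.
split; first by under eq_fun do rewrite E.
under eq_Rintegral do rewrite E.
rewrite e -[m in leRHS]card_ord -prodr_const; apply: ler_prod => i _; apply/andP; split.
  by apply: Rintegral_ge0 => x _; exact: sqr_ge0.
exact: (hj i).2.
Qed.

Lemma torus_majorant_ge0 y : 0 <= torus_majorant y.
Proof.
rewrite mulr_ge0 ?sqr_ge0//; apply: sumr_ge0 => t _; apply: addr_ge0; exact: sqr_ge0.
Qed.

Lemma Rintegral_torus_majorant :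
  (tuple_measure circ m).-integrable setT (EFin \o torus_majorant) /\
  \int[tuple_measure circ m]_y torus_majorant y <=
  (c * \prod_i (10 * (K i)%:R)) ^+ 2 * ((size ts)%:R * (2 * N%:R ^+ m)).
Proof.
have h1 (t : R) := torus_evolution_integrable t (fun x => eta_le1 (x / 2 ^+ r)).
have n1 (x : R) : `|1 : R| <= 1 by rewrite normr1.
have h2 (t : R) := @torus_evolution_integrable (fun=> 1) t n1.
have j3 (t : R) := integrableD measurableT (h1 t).1 (h2 t).1.
pose s y := \sum_(t <- ts) (normc (torus_evolution (fun x => eta1 (x / 2 ^+ r)) t y) ^+ 2 +
                  normc (torus_evolution (fun=> 1) t y) ^+ 2).
have js : (tuple_measure circ m).-integrable setT (EFin \o s).
  have -> : EFin \o s = fun y => (\sum_(t <- ts)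
     ((normc (torus_evolution (fun x => eta1 (x / 2 ^+ r)) t y) ^+ 2)%:E +
      (normc (torus_evolution (fun=> 1) t y) ^+ 2)%:E))%E.
    by apply/funext => y; rewrite /s /= -sumEFin.
  by apply: integrable_sum => // t _; exact: j3.
split.
  by apply: eq_integrable (integrableZl measurableT _ js) => // y _; rewrite /= /torus_majorant EFinM.
rewrite /torus_majorant RintegralZl// ler_wpM2l ?sqr_ge0//.
have -> : (size ts)%:R * (2 * N%:R ^+ m) = \sum_(t <- ts) (N%:R ^+ m + N%:R ^+ m) :> R.
  by rewrite big_const_seq count_predT iter_addr_0 mulr_natl; congr (_ *+ _); ring.
rewrite /Rintegral; under eq_integral do rewrite -sumEFin.
rewrite integral_sum// -sum_fine; last by move=> t _; apply: integrable_fin_num => //; exact: j3.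
apply: ler_sum => t _.
have := RintegralD measurableT (h1 t).1 (h2 t).1; rewrite {1}/Rintegral => ->.
by apply: lerD; [exact: (h1 t).2|exact: (h2 t).2].
Qed.

Lemma packet_tail (t : R) (i : nat) (p : phys R n m) : (0 < m)%N -> t \in ts ->
  normc (schrodinger_P eta1 packet_hat t p (2 ^+ i)) ^+ 2 <= torus_majorant p.2.
Proof.
move=> m0 tts; pose h (x : R) := eta1 (x / 2 ^+ i).
have mh : measurable_fun setT h by exact: meta.
have h1 x : `|h x| <= 1 by exact: eta_le1.
have [_ e] := packet_evolution t p mh h1.
have -> : schrodinger_P eta1 packet_hat t p (2 ^+ i) = c%:C *
    ((\prod_i integral_complex leb (fun xi =>
       expi2pi (tnth p.1 i * xi + t * xi ^+ 2) * ((h xi)%:C * ahat i xi))) *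
    torus_evolution h t p.2) by exact: e.
rewrite !Normc.normcM normc_real (ger0_norm c0) mulrA exprMn.
rewrite /torus_majorant; apply: ler_pM; rewrite ?sqr_ge0//.
  rewrite ler_pXn2r ?nnegrE ?mulr_ge0 ?normc_ge0//; last first.
    by apply: prodr_ge0 => j _; rewrite mulr_ge0.
  rewrite ler_wpM2l// normc_prod; apply: ler_prod => j _; rewrite normc_ge0/=.
  exact: (wave_evolution_le (v j) (@kap j) (lam0 j) (tnth p.1 j) t mh h1).2.
have rest0 : 0 <= \sum_(t <- rem t ts) (normc (torus_evolution (fun x => eta1 (x / 2 ^+ r)) t p.2) ^+ 2 +
                  normc (torus_evolution (fun=> 1) t p.2) ^+ 2).
  by apply: sumr_ge0 => s _; apply: addr_ge0; exact: sqr_ge0.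
rewrite (perm_big _ (perm_to_rem tts)) big_cons /=.
have s1 := sqr_ge0 (normc (torus_evolution (fun x => eta1 (x / 2 ^+ r)) t p.2)).
have s2 := sqr_ge0 (normc (torus_evolution (fun=> 1) t p.2)).
have [_ _ _ e1 e0] := ceta.
have p2 (q : nat) : 0 < 2 ^+ q :> R by rewrite exprn_gt0.
(* The torus frequencies lie in [2^r, 2^(r + 1)). For i < r they are at least 2 * 2^i, where the
   cutoff is 0; for i > r they are at most 2^i, where it is 1. *)
case: (ltngtP i r) => ir.
- have -> : torus_evolution h t p.2 = 0.
    rewrite /torus_evolution (bigD1 (Ordinal m0))//= big1 ?mul0r// => l _.
    rewrite /h e0 ?mulr0// ger0_norm ?divr_ge0 ?(ltW (p2 _))// ler_pdivlMr//.
    rewrite -exprS -natrX ler_nat; apply: leq_trans (kT_lb _ _).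
    by rewrite leq_exp2l.
  by rewrite Normc.normc0 expr0n /=; lra.
- have -> : torus_evolution h t p.2 = torus_evolution (fun=> 1) t p.2.
    apply: eq_bigr => j _; apply: eq_bigr => l _; congr (_ * _%:C).
    rewrite /h e1// ger0_norm ?divr_ge0 ?(ltW (p2 _))// ler_pdivrMr// mul1r.
    rewrite -natrX ler_nat; apply: leq_trans (ltnW (kT_ub _ _)) _.
    by rewrite leq_exp2l.
  lra.
- by rewrite /h ir; lra.
Qed.

End tail.

End generic_packet.

(** * The numerical parameters, all powers of 2 *)

Section parameters.
Variables (R : realType) (e h b : nat).
Hypothesis b5 : (5 <= b)%N.

(* In the notation of the header B = base, D = step (up to the factor 2 ^ h), R = carrier,
   th = shift q = D / (2 B^q), and ladder q l is the frequency th + D (K + l), K = count.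
   The exponent e is d - 1. *)
Definition base : nat := 2 ^ b.
Definition step : nat := 2 ^ (h + b * (2 * e + 3)).
Definition count : nat := 2 ^ (b - 5).
Definition shift (q : nat) : nat := 2 ^ (h + b * (2 * e + 3 - q) - 1).
Definition carrier : nat := 2 ^ (b * (2 * e + 4)).
Definition top : nat := 2 ^ (h + b * (2 * e + 4)).
Definition ladder (q l : nat) : nat := shift q + step * (count + l).

Lemma count_base : (32 * count = base)%N.
Proof. by rewrite /count /base -[32%N]/(2 ^ 5)%N -expnD subnKC. Qed.

(** The division of D by 2 B^q is exact; q <= e keeps the natural subtractions in the exponent of
    [shift] from truncating. *)
Lemma shift_step q : (q <= e)%N -> (2 * shift q * base ^ q = step)%N.
Proof.
move=> qe; rewrite /shift /base /step -expnS -expnM -expnD; congr (2 ^ _)%N.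
by nia.
Qed.

Lemma shift_lt q : (q <= e)%N -> (shift q < step)%N.
Proof.
move=> qe; rewrite /shift /step ltn_exp2l//.
by nia.
Qed.

(** The index count + l, rather than l, runs over [count, 2 count). With [ladder_ub] this puts all
    the frequencies of a coordinate in one dyadic interval. *)
Lemma ladder_lb q l : (2 ^ (h + b * (2 * e + 3) + (b - 5)) <= ladder q l)%N.
Proof. by rewrite /ladder expnD -/step -/count; nia. Qed.

Lemma ladder_ub q l : (q <= e)%N -> (l < count)%N ->
  (ladder q l < 2 ^ (h + b * (2 * e + 3) + (b - 5)).+1)%N.
Proof.
move=> /shift_lt sq lc; rewrite /ladder expnS expnD -/step -/count.
have : (step * (count + l).+1 <= step * (2 * count))%N by rewrite leq_mul2l; lia.
by rewrite mulnS; lia.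
Qed.

Lemma top_step : (top = step * base)%N.
Proof. by rewrite /top /step /base -expnD; congr (2 ^ _)%N; nia. Qed.

Lemma ladder_top q l : (q <= e)%N -> (l < count)%N -> (16 * ladder q l <= top)%N.
Proof.
move=> qe lc; have := ladder_ub qe lc; rewrite expnS expnD -/step -/count.
by rewrite top_step -count_base; nia.
Qed.

Lemma ladder_inj q : injective (fun l : 'I_count => ladder q l).
Proof.
move=> l l'; rewrite /ladder => /addnI /eqP; rewrite eqn_mul2l expn_eq0 /= => /eqP /addnI.
exact: val_inj.
Qed.

Lemma ladder_sep q (l l' : 'I_count) : l != l' ->
  step%:R <= `|(ladder q l)%:R - (ladder q l')%:R| :> R.
Proof.
move=> ll'.
have -> : (ladder q l)%:R - (ladder q l')%:R = step%:R * ((l : nat)%:R - (l' : nat)%:R) :> R.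
  by rewrite /ladder !natrD !natrM !natrD; ring.
rewrite normrM ger0_norm// ler_peMr// distrC.
have : (l : nat) != l' by apply: contra ll' => /eqP /val_inj ->.
rewrite neq_ltn => /orP[|] lt; rewrite -(ler_nat R) -natr1 in lt.
  by rewrite ger0_norm; lra.
by rewrite ler0_norm; lra.
Qed.

Let X : R := 2 ^+ b.
Let H : R := 2 ^+ h.

Lemma base_real : base%:R = X. Proof. by rewrite /base natrX. Qed.
Lemma step_real : step%:R = H * X ^+ (2 * e + 3) :> R.
Proof. by rewrite /step natrX exprD exprM. Qed.
Lemma count_real : count%:R = X / 32 :> R.
Proof. by rewrite -base_real -count_base natrM mulrAC divff ?mul1r. Qed.
Lemma carrier_real : carrier%:R = X ^+ (2 * e + 4) :> R.
Proof. by rewrite /carrier natrX exprM. Qed.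
Lemma top_real : top%:R = H * X ^+ (2 * e + 4) :> R.
Proof. by rewrite /top natrX exprD exprM. Qed.

End parameters.

(** * Phases near a frequency and the choice of the time *)

Section phases.
Variable R : realType.

(** Expansion at th + D j. In the application p, k0 and j are integers, so p j^2 + k0 j does not
    affect the phase. There remain j delta, the linear term and the dispersion, with 1/16 + 1/24 +
    1/24 < 1/6. *)
Lemma phase_core (u th D t p k0 delta W xi j : R) :
  t * D ^+ 2 = p -> D * u + 2 * t * th * D = k0 + delta ->
  0 <= j -> j * `|delta| <= 16^-1 -> 0 <= t -> 0 <= th + D * j ->
  `|xi - (th + D * j)| <= W ->
  (`|u| + 2 * t * (th + D * j)) * W <= 24^-1 -> t * W ^+ 2 <= 24^-1 ->
  `|u * xi + t * xi ^+ 2 - (u * th + t * th ^+ 2) - (p * j ^+ 2 + k0 * j)| <= 6^-1.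
Proof.
set kap := th + D * j => tp uk j0 jd t0 kap0 xW h1 h2.
have W0 : 0 <= W by exact: le_trans xW.
have -> : u * xi + t * xi ^+ 2 - (u * th + t * th ^+ 2) - (p * j ^+ 2 + k0 * j) =
    j * delta + (u + 2 * t * kap) * (xi - kap) + t * (xi - kap) ^+ 2.
  have -> : delta = D * u + 2 * t * th * D - k0 by rewrite uk addrC addKr.
  by rewrite -tp /kap; ring.
have a1 : `|j * delta| <= 16^-1 by rewrite normrM (ger0_norm j0).
have a2 : `|(u + 2 * t * kap) * (xi - kap)| <= 24^-1.
  apply: le_trans h1; rewrite normrM; apply: ler_pM => //.
  apply: le_trans (ler_normD _ _) _; rewrite lerD2l ger0_norm//.
  by rewrite mulr_ge0// mulr_ge0.
have a3 : `|t * (xi - kap) ^+ 2| <= 24^-1.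
  apply: le_trans h2; rewrite normrM (ger0_norm t0) ler_wpM2l//.
  by rewrite normrX ler_pXn2r ?nnegrE.
have := ler_normD (j * delta + (u + 2 * t * kap) * (xi - kap)) (t * (xi - kap) ^+ 2).
have := ler_normD (j * delta) ((u + 2 * t * kap) * (xi - kap)).
lra.
Qed.

Variables (e b : nat) (rho : R).
Hypotheses (e0 : (0 < e)%N) (rho0 : 0 < rho) (rho1 : rho <= 1).
Variables X H : R.
Hypotheses (Xe : (base b)%:R = X) (X2 : 2 <= X) (H1 : 1 <= H).
(** The value is such that 2 window (48 / rho)^2 = 1 / (24 H). As the narrowest tent has lam^2 =
    X^(2 e + 4) / rho^2, this keeps the dispersion t (48 lam)^2 below 1/24 as long as t X^(2 e + 4)
    <= 2 window. *)
Definition window : R := (rho / 48) ^+ 2 / (48 * H).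
Hypothesis Xc : (H ^+ 2 * X ^+ (e + 2))^-1 <= window.

Let X1 : 1 <= X. Proof. by apply: le_trans X2; rewrite ler1n. Qed.
Let X0 : 0 < X. Proof. exact: lt_le_trans X1. Qed.
Let H0 : 0 < H. Proof. exact: lt_le_trans H1. Qed.
Let w0 : 0 < window.
Proof. by rewrite divr_gt0 ?exprn_gt0 ?divr_gt0// mulr_gt0. Qed.

Definition wave_time (p : nat) : R := p%:R / (H * X ^+ (2 * e + 3)) ^+ 2.

(* The times p / D ^ 2 with p in a window of base ^ e consecutive integers refocus at the
   given point: the first coordinate selects the window, the others the digits of p. *)
Lemma choose_time (u0 : R) (u : nat -> R) : - (2 * window) <= u0 <= - window ->
  exists p : nat, [/\ (0 < p)%N, p%:R <= 2 * H ^+ 2 * X ^+ (2 * e + 2),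
    wave_time p * X ^+ (2 * e + 4) <= 2 * window,
    `|u0 + 2 * wave_time p * X ^+ (2 * e + 4)| <= 2 * (H ^+ 2 * X ^+ (e + 2))^-1 &
    forall q, (q < e)%N -> exists k : int,
      `|H * X ^+ (2 * e + 3) * u q + p%:R / X ^+ q.+1 - k%:~R| <= X^-1].
Proof.
have n1 k : ((2 * k + 3) * 2 = 2 * k + 2 + (2 * k + 4))%N by clear; lia.
have n2 k : (2 * k + 2 = k + 2 + k)%N by clear; lia.
move=> /andP[u1 u2].
have W1 : window <= 1.
  rewrite ler_pdivrMr ?mulr_gt0// mul1r.
  have r1 : rho / 48 <= 1 by rewrite ler_pdivrMr// mul1r (le_trans rho1)// ler1n.
  apply: (@le_trans _ _ 1); last by move: H1; lra.
  by rewrite expr_le1// divr_ge0// ltW.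
(* G is D^2 / R, so p = y would solve u0 + 2 t R = 0 exactly, and a p within X^e of y misses by at
   most 2 X^e / G. *)
pose G := H ^+ 2 * X ^+ (2 * e + 2).
have G0 : 0 < G by rewrite mulr_gt0 ?exprn_gt0.
pose y := - u0 * G / 2.
have y0 : 0 <= y by rewrite divr_ge0// mulr_ge0 ?(ltW G0)//; lra.
pose p0 := Num.truncn y.
have /andP[y1 y2] : p0%:R <= y < p0.+1%:R by exact: truncn_itv.
have B0 : (0 < base b)%N by rewrite expn_gt0.
have [p [/andP[p1 p2] pP]] := digits_window (fun q => - (H * X ^+ (2 * e + 3) * u q)) e p0 B0.
have pXe : p%:R < p0%:R + X ^+ e by rewrite -Xe -natrX -natrD ltr_nat.
have pp0 : p0%:R <= p%:R :> R by rewrite ler_nat.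
have Xe1 : 1 <= X ^+ e by exact: exprn_ege1.
have py : `|p%:R - y| <= X ^+ e.
  by rewrite ler_norml; move: y2; rewrite -natr1; lra.
have D2 : (H * X ^+ (2 * e + 3)) ^+ 2 = G * X ^+ (2 * e + 4).
  rewrite /G exprMn -exprM -mulrA -exprD.
  by rewrite n1.
have XX : 0 < X ^+ (2 * e + 4) by rewrite exprn_gt0.
have tR : wave_time p * X ^+ (2 * e + 4) = p%:R / G.
  by rewrite /wave_time D2 invfM [p%:R * _]mulrA divfK// gt_eqF.
have uE : u0 + 2 * wave_time p * X ^+ (2 * e + 4) = 2 / G * (p%:R - y).
  by rewrite -[2 * _ * _]mulrA tR /y; field; exact: lt0r_neq0.
have GE : X ^+ e / G = (H ^+ 2 * X ^+ (e + 2))^-1.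
  have -> : G = (H ^+ 2 * X ^+ (e + 2)) * X ^+ e.
    by rewrite /G -mulrA -exprD -n2.
  by rewrite invfM mulrCA divff ?mulr1// expf_neq0// gt_eqF.
have ub : `|u0 + 2 * wave_time p * X ^+ (2 * e + 4)| <= 2 * (H ^+ 2 * X ^+ (e + 2))^-1.
  rewrite uE normrM ger0_norm ?divr_ge0 ?(ltW G0)// -GE -mulrA.
  by rewrite ler_wpM2l// [G^-1 * _]mulrC ler_wpM2r// invr_ge0 ltW.
have tw : wave_time p * X ^+ (2 * e + 4) <= 2 * window.
  by move: ub; rewrite ler_norml => /andP[_]; move: Xc u1; lra.
exists p; split => //.
- rewrite (leq_trans _ p1)// -(ltr0n R).
  have : 2 <= X ^+ e.
    by apply: le_trans X2 _; rewrite -[leLHS]expr1 ler_weXn2l.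
  have wG : X ^+ e <= window * G.
    by rewrite -ler_pdivrMr// GE.
  have : window * G <= - u0 * G by rewrite ler_wpM2r ?(ltW G0)//; lra.
  by move: y2; rewrite /y -[p0.+1%:R]natr1 => y2 q1 q2; lra.
- move: tw; rewrite tR ler_pdivrMr// => /le_trans; apply.
  by rewrite -mulrA -/G ler_wpM2r ?(ltW G0)// ler_piMr.
- move=> q qe; have [k kP] := pP q qe; exists k.
  by rewrite -Xe; move: kP; rewrite opprK Xe [_ + H * _ * _]addrC.
Qed.

End phases.

(** * What is required of a packet *)

Section packet_spec.
Variables (R : realType) (n' m : nat).
Local Notation n := n'.+1.
Local Notation circ := (circle_measure R).

(** The phase u xi + t xi^2 is stationary at u = - 2 t xi, so a packet of positive frequency moves
    towards smaller x_0. The region is where it passes at small times; it stays away from the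
    centre, so that these times are positive. *)
Definition region (v : 'I_n -> R) (c1 : R) (p : phys R n m) : Prop :=
  - (2 * c1) <= tnth p.1 ord0 - v ord0 <= - c1 /\
  forall i, i != ord0 -> `|tnth p.1 i - v i| <= c1.

(* [ts] are times at which the packet has to be small, [T] the times at which it is large. *)
Record packet_spec (eta1 : R -> R) (s rho c1 : R) (v : 'I_n -> R) (eps M : R) (ts : seq R)
    (r0 : nat) (f : phys R n m -> R[i]) (F : freq R n m -> R[i]) (T : seq R)
    (W : m.-tuple (measurableTypeR R) -> R) : Prop := PacketSpec {
  spec_periodic : Defs.periodic f;
  spec_integrable : integrable_complex (phys_measure R n m) f;
  spec_support : forall p i, f p != 0 -> `|tnth p.1 i - v i| < rho;
  spec_L1 : \int[phys_measure R n m]_p normc (f p) <= eps;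
  spec_L2i : (phys_measure R n m).-integrable setT (fun p => (normc (f p) ^+ 2)%:E);
  spec_L2 : \int[phys_measure R n m]_p (normc (f p) ^+ 2) <= eps;
  spec_fourier : forall z, fourierL1 f z = F z;
  spec_hat_integrable : integrable_complex (freq_measure R n m) F;
  spec_sobolevi : (freq_measure R n m).-integrable setT
    (fun z => ((1 + sqnorm z) `^ s * normc (F z) ^+ 2)%:E);
  spec_sobolev : \int[freq_measure R n m]_z ((1 + sqnorm z) `^ s * normc (F z) ^+ 2) <= eps;
  spec_hat_L2i : (freq_measure R n m).-integrable setT (fun z => (normc (F z) ^+ 2)%:E);
  spec_hat_L2 : \int[freq_measure R n m]_z (normc (F z) ^+ 2) <= eps;
  spec_hat_support : forall z j, F z != 0 -> (2 ^ r0 <= `|tnth z.2 j|)%N;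
  spec_maj_ge0 : forall y, 0 <= W y;
  spec_maji : (tuple_measure circ m).-integrable setT (EFin \o W);
  spec_maj : \int[tuple_measure circ m]_y W y <= eps;
  spec_tail : forall t i p, t \in ts ->
    normc (schrodinger_P eta1 F t p (2 ^+ i)) ^+ 2 <= W p.2;
  spec_times : forall t, t \in T -> 0 < t <= eps;
  spec_large : forall p, region v c1 p -> exists2 t, t \in T &
    M <= normc (integral_complex (freq_measure R n m) (schrodinger_integrand F t p)) }.

End packet_spec.

(** * The packet with explicit parameters *)

Section instance.
Variables (R : realType) (n' m h b : nat).
Local Notation n := n'.+1.
Local Notation e := (n' + m)%N.
Variables (eta1 : R -> R) (s rho c eps M : R) (v : 'I_n -> R) (ts : seq R) (r0 : nat).
Variables X H : R.
Hypotheses (XE : X = 2 ^+ b) (HE : H = 2 ^+ h).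
Hypotheses (m0 : (0 < m)%N) (ceta : cutoff eta1) (s2 : s <= 2^-1).
Hypotheses (rho0 : 0 < rho) (rho1 : rho <= 1) (b5 : (5 <= b)%N) (rb : (r0 <= b)%N).
Hypothesis Hrho : 24 * 48 <= H ^+ 2 * rho.
Local Notation c1 := (window rho H).
Hypothesis Xc : (H ^+ 2 * X ^+ (e + 2))^-1 <= c1.
Hypothesis c0 : 0 <= c.

Let X2 : 2 <= X.
Proof.
rewrite XE; apply: (@le_trans _ _ (2 ^+ 1)); first by rewrite expr1.
by rewrite ler_weXn2l ?ler1n//; exact: leq_trans b5.
Qed.
Let X1 : 1 <= X. Proof. by apply: le_trans X2; rewrite ler1n. Qed.
Let X0 : 0 < X. Proof. exact: lt_le_trans X1. Qed.
Let H1 : 1 <= H. Proof. by rewrite HE; apply: exprn_ege1; rewrite ler1n. Qed.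
Let H0 : 0 < H. Proof. exact: lt_le_trans H1. Qed.
Let e0 : (0 < e)%N. Proof. by rewrite addn_gt0 m0 orbT. Qed.

Let K : nat := count b.
Let kX : K%:R = X / 32. Proof. by rewrite XE; exact: count_real. Qed.
Let K_gt0 : (0 < K)%N. Proof. by rewrite expn_gt0. Qed.
Let L : R := (top e h b)%:R.
Let Dr : R := (step e h b)%:R.
Let LE : L = H * X ^+ (2 * e + 4). Proof. by rewrite XE HE; exact: top_real. Qed.
Let DE : Dr = H * X ^+ (2 * e + 3). Proof. by rewrite XE HE; exact: step_real. Qed.

Let lam (i : 'I_n) : R := if i == ord0 then X ^+ (e + 2) / rho else rho^-1.
(** In the first variable there is a single frequency: the separation condition is void, and [Ds]
    only has to dominate [lam]. *)
Let Ds (i : 'I_n) : R := if i == ord0 then X ^+ (e + 2) / rho else Dr.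
Let Ks (i : 'I_n) : nat := if i == ord0 then 1%N else K.
Let kap (i : 'I_n) (l : 'I_(Ks i)) : R :=
  if i == ord0 then (carrier e b)%:R else (ladder e h b i l)%:R.
Let kT (j : 'I_m) (l : 'I_K) : nat := ladder e h b (n' + j.+1) l.
Let r := (h + b * (2 * e + 3) + (b - 5))%N.

Let ij (i : 'I_n) : (i <= e)%N.
Proof. by apply: leq_trans (leq_addr _ _); rewrite -ltnS. Qed.
Let jj (j : 'I_m) : (n' + j.+1 <= e)%N.
Proof. by rewrite leq_add2l; exact: ltn_ord. Qed.

Let ri : rho^-1 <= H * X ^+ (e + 2).
Proof.
have XX : 0 < X ^+ (e + 2) by rewrite exprn_gt0.
rewrite -[leRHS]invrK lef_pV2 ?posrE ?invr_gt0 ?mulr_gt0//.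
have -> : (H * X ^+ (e + 2))^-1 = H * (H ^+ 2 * X ^+ (e + 2))^-1.
  by rewrite expr2 -mulrA [in RHS]invfM mulrA divff ?mul1r// gt_eqF.
apply: le_trans (ler_wpM2l (ltW H0) Xc) _; rewrite /window.
have -> : H * ((rho / 48) ^+ 2 / (48 * H)) = rho * (rho / 48 / 48 / 48).
  by move: H0 => /lt0r_neq0 h0; field.
rewrite ler_piMr ?(ltW rho0)//.
by rewrite !ler_pdivrMr// !mul1r; apply: le_trans rho1 _; rewrite -!natrM ler1n.
Qed.

Let XM k l : (k <= l)%N -> X ^+ k <= X ^+ l.
Proof. by move=> kl; rewrite ler_weXn2l. Qed.

Let L1 : 1 <= L.
Proof. by rewrite LE -[leLHS]mulr1 ler_pM// exprn_ege1. Qed.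

Let lam_gt0 i : 0 < lam i.
Proof. by rewrite /lam; case: ifP => _; rewrite ?invr_gt0// divr_gt0// exprn_gt0. Qed.

Let Ks_gt0 i : (0 < Ks i)%N.
Proof. by rewrite /Ks; case: ifP. Qed.

Let lamL i : lam i <= L.
Proof.
have ke : (e + 2 + (e + 2) = 2 * e + 4)%N by clear; lia.
have LE' : L = X ^+ (e + 2) * (H * X ^+ (e + 2)) by rewrite LE -ke exprD; ring.
rewrite /lam; case: ifP => _; first by rewrite LE' ler_wpM2l// exprn_ge0// ltW.
apply: le_trans ri _; rewrite LE' ler_peMl ?exprn_ege1//.
by apply: mulr_ge0; [exact: ltW|rewrite exprn_ge0// ltW].
Qed.

Let KD i : (Ks i)%:R * lam i <= Ds i.
Proof.
rewrite /Ks /lam /Ds; case: ifP => _; first by rewrite mul1r.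
have kk : (1 + (e + 2) <= 2 * e + 3)%N by clear; lia.
rewrite DE; apply: (@le_trans _ _ (X * (H * X ^+ (e + 2)))).
  apply: ler_pM => //; first by rewrite invr_ge0 ltW.
  by rewrite kX ler_pdivrMr// ler_peMr ?(ltW X0)// ler1n.
by rewrite mulrCA ler_wpM2l ?(ltW H0)// -exprS; apply: XM.
Qed.

Let kapL i l : `|@kap i l| <= L.
Proof.
rewrite /kap ger0_norm; last by case: ifP.
case: ifPn => i0.
  by rewrite carrier_real -XE LE ler_peMl// exprn_ge0// ltW.
have lK : (l < K)%N by have := ltn_ord l; rewrite {2}/Ks (negbTE i0).
by rewrite /L ler_nat; apply: leq_trans (ladder_top h b5 (ij i) lK); rewrite leq_pmull.
Qed.

Let sep i l l' : l != l' -> Ds i <= `|@kap i l - @kap i l'|.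
Proof.
rewrite /kap /Ds; move: l l'; rewrite /Ks; case: ifP => i0 l l'.
  by rewrite !ord1.
by move=> ll'; exact: ladder_sep.
Qed.

Let kT_inj j : injective (kT j). Proof. exact: ladder_inj. Qed.
Let kT_lb j l : (2 ^ r <= kT j l)%N. Proof. exact: ladder_lb. Qed.
Let kT_ub j l : (kT j l < 2 ^ r.+1)%N.
Proof. by apply: ladder_ub => //; exact: jj. Qed.
Let kTL j l : (kT j l)%:R <= L.
Proof. by rewrite /L ler_nat; apply: leq_trans (ladder_top h b5 (jj j) (ltn_ord l)); rewrite leq_pmull. Qed.

Let f := packet c lam v kap kT.
Let F := packet_hat c lam v kap kT.
Let times := [seq wave_time e X H p.+1 | p <- iota 0 (2 * (2 ^ h) ^ 2 * base b ^ (2 * e + 2))].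
Let W := torus_majorant c Ks r kT eta1 ts.

Let prod_if (x y : R) : \prod_(i < n) (if i == ord0 then x else y) = x * y ^+ n'.
Proof.
by rewrite big_ord_recl /= prodr_const card_ord.
Qed.

Let prod1 a : \prod_(i < n) (a * (Ks i)%:R / lam i) = a ^+ n * K%:R ^+ n' * rho ^+ n / X ^+ (e + 2).
Proof.
have -> : \prod_(i < n) (a * (Ks i)%:R / lam i) =
    \prod_(i < n) (if i == ord0 then a * rho / X ^+ (e + 2) else a * K%:R * rho).
  apply: eq_bigr => i _; rewrite /Ks /lam; case: ifP => _; last by rewrite invrK.
  by rewrite mulr1 invf_div mulrA.
by rewrite prod_if !exprMn !exprS; ring.
Qed.

Let rn : rho ^+ n <= 1. Proof. by rewrite exprn_ile1// ltW. Qed.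
Let KX : K%:R <= X.
Proof. by rewrite kX ler_pdivrMr// ler_peMr ?(ltW X0)// ler1n. Qed.
Let KXn k : K%:R ^+ k <= X ^+ k.
Proof. by rewrite lerXn2r ?nnegrE// ltW. Qed.
Let Xn0 k : 0 < X ^+ k. Proof. exact: exprn_gt0. Qed.

Let L1_bound : c * ((\prod_i ((Ks i)%:R / lam i)) * K%:R ^+ m) <= c / X ^+ 2.
Proof.
rewrite ler_wpM2l//.
have -> : \prod_i ((Ks i)%:R / lam i) = \prod_i (1 * (Ks i)%:R / lam i).
  by apply: eq_bigr => i _; rewrite mul1r.
rewrite prod1 expr1n mul1r mulrAC ler_pdivrMr//.
have -> : (X ^+ 2)^-1 * X ^+ (e + 2) = X ^+ n' * X ^+ m.
  by rewrite -exprD exprD mulrCA mulVf ?mulr1// gt_eqF.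
rewrite mulrAC; apply: le_trans (ler_piMr _ rn) _; first by rewrite mulr_ge0 ?exprn_ge0.
by apply: ler_pM; rewrite ?exprn_ge0.
Qed.

Let L2_bound : c ^+ 2 * ((\prod_i ((Ks i)%:R ^+ 2 / lam i)) * K%:R ^+ m) <=
  c ^+ 2 * (X ^+ (2 * n' + m)).
Proof.
rewrite ler_wpM2l ?sqr_ge0// exprD; apply: ler_pM; rewrite ?exprn_ge0//.
  by apply: prodr_ge0 => i _; rewrite divr_ge0 ?sqr_ge0// ltW.
have -> : X ^+ (2 * n') = \prod_(i < n) (if i == ord0 then 1 else X ^+ 2).
  by rewrite prod_if mul1r exprM.
apply: ler_prod => i _; apply/andP; split; first by rewrite divr_ge0 ?sqr_ge0// ltW.
rewrite /Ks /lam; case: ifP => _.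
  rewrite expr1n mul1r invf_div ler_pdivrMr// mul1r (le_trans rho1)//.
  exact: exprn_ege1.
by rewrite invrK -[leRHS]mulr1; apply: ler_pM; rewrite ?exprn_ge0// ltW.
Qed.

Let W_bound : (c * \prod_i (10 * (Ks i)%:R)) ^+ 2 * ((size ts)%:R * (2 * K%:R ^+ m)) <=
  c ^+ 2 * X ^+ (2 * n' + m) * (100 ^+ n * (size ts)%:R * 2).
Proof.
have -> : \prod_i (10 * (Ks i)%:R) = 10 ^+ n * K%:R ^+ n' :> R.
  have -> : \prod_i (10 * (Ks i)%:R) = \prod_(i < n) (if i == ord0 then 10 else 10 * K%:R) :> R.
    by apply: eq_bigr => i _; rewrite /Ks; case: ifP => _ //; rewrite mulr1.
  by rewrite prod_if exprMn exprS mulrA.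
have -> : (c * (10 ^+ n * K%:R ^+ n')) ^+ 2 * ((size ts)%:R * (2 * K%:R ^+ m)) =
    c ^+ 2 * (K%:R ^+ (2 * n' + m)) * ((10 ^+ n) ^+ 2 * (size ts)%:R * 2).
  by rewrite exprD [(2 * n')%N]mulnC exprM; ring.
have -> : (10 ^+ n) ^+ 2 = 100 ^+ n :> R by rewrite -exprM mulnC exprM; congr (_ ^+ _); rewrite -natrX.
rewrite ler_wpM2r ?mulr_ge0 ?exprn_ge0// ler_wpM2l ?sqr_ge0//.
Qed.

(** Power count: the widths of the tents give X^(- e - 2), the e ladders give X^e, and the weight
    gives X^(4 (e + 2) s) for s >= 0, up to factors independent of X. *)
Let S_bound : c ^+ 2 * L `^ (2 * Num.max s 0) *
    ((\prod_i (30 * (Ks i)%:R / lam i)) * (2 * K%:R) ^+ m) <=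
  c ^+ 2 * X `^ (4 * (e + 2)%:R * Num.max s 0) / X ^+ 2 *
    (H `^ (2 * Num.max s 0) * 30 ^+ n * 2 ^+ m).
Proof.
have -> : L `^ (2 * Num.max s 0) =
    H `^ (2 * Num.max s 0) * X `^ (4 * (e + 2)%:R * Num.max s 0).
  rewrite LE powRM ?(ltW H0) ?exprn_ge0 ?(ltW X0)// -powR_mulrn ?(ltW X0)// -powRrM.
  congr (_ * _ `^ _); rewrite mulrA; congr (_ * _); rewrite -!natrM; congr (_%:R).
  by clear; lia.
set h1 := H `^ _; set x1 := X `^ _.
have h10 : 0 <= h1 by exact: powR_ge0.
have x10 : 0 <= x1 by exact: powR_ge0.
have pb : (\prod_i (30 * (Ks i)%:R / lam i)) * (2 * K%:R) ^+ m <=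
    30 ^+ n * 2 ^+ m / X ^+ 2.
  rewrite prod1 exprMn.
  have -> : 30 ^+ n * K%:R ^+ n' * rho ^+ n / X ^+ (e + 2) * (2 ^+ m * K%:R ^+ m) =
     30 ^+ n * 2 ^+ m / X ^+ 2 * (rho ^+ n * (K%:R ^+ e / X ^+ e)).
    by rewrite !exprD invfM; ring.
  rewrite ler_piMr ?divr_ge0 ?mulr_ge0 ?exprn_ge0// ?(ltW X0)//.
  have q1 : K%:R ^+ e / X ^+ e <= 1 by rewrite ler_pdivrMr// mul1r.
  have q0 : 0 <= K%:R ^+ e / X ^+ e by rewrite divr_ge0 ?exprn_ge0// ltW.
  rewrite -[leRHS]mulr1; apply: ler_pM => //; exact/exprn_ge0/ltW.
apply: le_trans (ler_wpM2l _ pb) _; first by rewrite !mulr_ge0 ?sqr_ge0.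
by rewrite le_eqVlt; apply/orP; left; apply/eqP; ring.
Qed.

(** Each of the e ladders contributes at least K / 24 = X / (32 * 24), and the single tent 1 /
    24. *)
Let lower_bound : c * X ^+ e / (24 * (32 * 24) ^+ e) <=
  c * ((\prod_i ((Ks i)%:R / 24)) * (K%:R / 2) ^+ m).
Proof.
have -> : \prod_i ((Ks i)%:R / 24) = 24^-1 * (K%:R / 24) ^+ n' :> R.
  have -> : \prod_i ((Ks i)%:R / 24) = \prod_(i < n) (if i == ord0 then 24^-1 else K%:R / 24) :> R.
    by apply: eq_bigr => i _; rewrite /Ks; case: ifP => _ //; rewrite mul1r.
  by rewrite prod_if.
have -> : c * X ^+ e / (24 * (32 * 24) ^+ e) = c * (24^-1 * (K%:R / 24) ^+ n' * (K%:R / 24) ^+ m).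
  rewrite -[in RHS]mulrA -exprD kX -mulrA; congr (_ * _).
  by rewrite invfM mulrCA -expr_div_n invfM mulrA.
rewrite ler_wpM2l// ler_wpM2l ?mulr_ge0 ?exprn_ge0 ?divr_ge0//.
by rewrite lerXn2r ?nnegrE ?divr_ge0// ler_wpM2l// lef_pV2 ?posrE// ler_nat.
Qed.

Hypothesis L1_eps : c / X ^+ 2 <= eps.
Hypothesis L2_eps : c ^+ 2 * (X ^+ (2 * n' + m)) <= eps.
Hypothesis W_eps : c ^+ 2 * X ^+ (2 * n' + m) * (100 ^+ n * (size ts)%:R * 2) <= eps.
Hypothesis S_eps : c ^+ 2 * X `^ (4 * (e + 2)%:R * Num.max s 0) / X ^+ 2 *
    (H `^ (2 * Num.max s 0) * 30 ^+ n * 2 ^+ m) <= eps.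
Hypothesis T_eps : 2 / X <= eps.
Hypothesis M_large : M <= c * X ^+ e / (24 * (32 * 24) ^+ e).

(** The spatial variable belonging to digit q is coordinate q + 1, the first coordinate having been
    spent on the window: Euclidean while q + 1 < n, then torus coordinate q - n'. The value 0 is a
    default outside the range. *)
Let rest (u : 'I_n -> R) (y : 'I_m -> R) (q : nat) : R :=
  if insub q.+1 is Some i then u i else if insub (q - n')%N is Some j then y j else 0.

Let times_small t : t \in times -> 0 < t <= eps.
Proof.
case/mapP => p; rewrite mem_iota /= => pP ->.
have D0 : 0 < (H * X ^+ (2 * e + 3)) ^+ 2 by rewrite exprn_gt0// mulr_gt0.
rewrite /wave_time divr_gt0//= (le_trans _ T_eps)//.
rewrite ler_pdivrMr//.
have pb : p.+1%:R <= 2 * H ^+ 2 * X ^+ (2 * e + 2) :> R.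
  by rewrite HE XE -!natrX -!natrM ler_nat -/(base b).
apply: le_trans pb _.
have -> : 2 / X * (H * X ^+ (2 * e + 3)) ^+ 2 = 2 * H ^+ 2 * (X ^+ ((2 * e + 3) * 2) / X).
  by rewrite exprMn -exprM; ring.
rewrite ler_wpM2l ?mulr_ge0 ?exprn_ge0 ?(ltW H0)//.
rewrite ler_pdivlMr// -exprSr; apply: XM.
by clear; lia.
Qed.

Let Xb : (base b)%:R = X. Proof. by rewrite XE; exact: base_real. Qed.

(** Since 2 th X^q = D and t = p / D^2, the term 2 t th D equals p / X^q, so the digit condition
    says that D u + 2 t th D is within 1 / X of an integer. As K + l <= X / 16, this error grows to
    at most 1/16 along the ladder. *)
Let rung (p : nat) (u W0 : R) (q : nat) (k : int) (l : 'I_K) (xi : R) :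
  (q <= e)%N -> `|H * X ^+ (2 * e + 3) * u + p%:R / X ^+ q - k%:~R| <= X^-1 ->
  let t := wave_time e X H p in
  `|xi - (ladder e h b q l)%:R| <= W0 ->
  (`|u| + 2 * t * (ladder e h b q l)%:R) * W0 <= 24^-1 -> t * W0 ^+ 2 <= 24^-1 ->
  `|u * xi + t * xi ^+ 2 - (u * (shift e h b q)%:R + t * (shift e h b q)%:R ^+ 2)
    - ((p * (K + l) ^ 2)%:Z + k * (K + l)%:Z)%:~R| <= 6^-1.
Proof.
move=> qe du t xW h1 h2.
set th : R := (shift e h b q)%:R; set D := H * X ^+ (2 * e + 3).
have D0 : 0 < D by rewrite mulr_gt0.
have lE : (ladder e h b q l)%:R = th + D * (K + l)%:R.
  by rewrite /ladder natrD natrM -/K -/th -/Dr DE.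
have -> : ((p * (K + l) ^ 2)%:Z + k * (K + l)%:Z)%:~R = p%:R * (K + l)%:R ^+ 2 + k%:~R * (K + l)%:R :> R.
  by rewrite intrD intrM -!pmulrn natrM natrX.
have thD : 2 * th * X ^+ q = D.
  by rewrite /D -DE /Dr -(shift_step h b5 qe) !natrM natrX Xb.
rewrite lE in xW h1.
have Xq : X ^+ q != 0 by rewrite gt_eqF.
apply: (phase_core (D := D) (delta := D * u + p%:R / X ^+ q - k%:~R) _ _ _ _ _ _ xW h1 h2) => //.
- by rewrite /t /wave_time divfK// gt_eqF// exprn_gt0.
- rewrite [RHS]addrC subrK; congr (_ + _); rewrite /t /wave_time -/D.
  have -> : 2 * (p%:R / D ^+ 2) * th * D = p%:R * (2 * th) / D.
    by move: D0 => /lt0r_neq0 dn; field.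
  have th0 : 2 * th != 0.
    by apply/eqP => z; move: D0; rewrite -thD z mul0r ltxx.
  have -> : p%:R * (2 * th) / D = p%:R * (2 * th) / (2 * th) / X ^+ q.
    by rewrite -[in LHS]thD invfM !mulrA.
  by rewrite mulfK.
- have jX : (K + l)%:R <= X / 16.
    apply: (@le_trans _ _ (K + K)%:R); first by rewrite ler_nat leq_add2l ltnW.
    by rewrite natrD kX; lra.
  apply: le_trans (ler_pM _ _ jX du) _ => //.
  by rewrite mulrAC divff ?mul1r// gt_eqF.
- by rewrite divr_ge0 ?sqr_ge0.
- by rewrite -lE.
Qed.

Let rho_small : 5 / 4 / 48 / 2 * rho <= 1.
Proof. by move: rho0 rho1; lra. Qed.

Let large p : region v c1 p -> exists2 t, t \in times &
  M <= normc (integral_complex (freq_measure R n m) (schrodinger_integrand F t p)).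
Proof.
move=> [u0 us].
pose u i := tnth p.1 i - v i.
have [z [z0 zP tR uR zu]] :=
  choose_time e0 rho0 rho1 Xb X2 H1 Xc (rest u (fun j => tnth p.2 j)) u0.
set t := wave_time e X H z in tR uR zu.
have t0 : 0 <= t by rewrite divr_ge0 ?sqr_ge0.
have w0 : 0 < c1 by rewrite divr_gt0 ?exprn_gt0 ?divr_gt0// mulr_gt0.
have hn := lt0r_neq0 H0; have rn0 := lt0r_neq0 rho0.
have tw : 2 * c1 * (48 / rho) ^+ 2 <= 24^-1.
  have -> : 2 * c1 * (48 / rho) ^+ 2 = 24^-1 / H by rewrite /window; field; rewrite hn.
  by rewrite ler_pdivrMr// ler_peMr.
exists t.
  apply/mapP; exists z.-1; last by rewrite prednK.
  rewrite mem_iota /= add0n prednK// -(ler_nat R) !natrM !natrX.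
  by rewrite -XE -HE.
apply: le_trans M_large _; apply: le_trans lower_bound _.
apply: packet_lower => // [i|j]; last first.
  exists (tnth p.2 j * (shift e h b (n' + j.+1))%:R + t * (shift e h b (n' + j.+1))%:R ^+ 2) => l.
  have [|k kP] := zu (n' + j)%N; first by rewrite -addnS; exact: jj.
  have rE : rest u (fun j => tnth p.2 j) (n' + j)%N = tnth p.2 j.
    rewrite /rest insubF ?addKn ?valK//.
    by apply/negbTE; rewrite -leqNgt ltnS leq_addr.
  rewrite rE -addnS in kP.
  exists ((z * (K + l) ^ 2)%:Z + k * (K + l)%:Z).
  (* Torus frequencies are exact, hence the spread 0. *)
  by apply: (rung (W0 := 0) (jj j) kP); rewrite ?subrr ?normr0 ?mulr0// expr0n mulr0.
have [i0|i0] := boolP (i == ord0).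
  (* With one frequency there are no terms to align: the phase only has to be nearly constant across
     the transform of the tent. *)
  exists (u i * (carrier e b)%:R + t * (carrier e b)%:R ^+ 2) => l.
  exists 0 => xi; rewrite /kap /lam i0 carrier_real -XE subr0 => xW.
  set R0 := X ^+ (2 * e + 4) in xW *.
  have -> : (tnth p.1 i - v i) * xi + t * xi ^+ 2 - (u i * R0 + t * R0 ^+ 2) =
    (u i + 2 * t * R0) * (xi - R0) + t * (xi - R0) ^+ 2 by rewrite /u; ring.
  have W0 : 0 <= 48 * (X ^+ (e + 2) / rho) by exact: le_trans xW.
  have b1 : `|(u i + 2 * t * R0) * (xi - R0)| <= 12^-1.
    rewrite (eqP i0) normrM; apply: le_trans (ler_pM _ _ uR xW) _ => //.
    (* This is where 24 * 48 in [Hrho] comes from: the linear term is at most 2 * 48 / (H^2 rho) <=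
       1 / 12. *)
    have -> : 2 * (H ^+ 2 * X ^+ (e + 2))^-1 * (48 * (X ^+ (e + 2) / rho)) =
      12^-1 * (24 * 48 / (H ^+ 2 * rho)).
      by have xn := lt0r_neq0 (Xn0 (e + 2)); field; rewrite rn0 xn hn.
    by rewrite ler_piMr// ler_pdivrMr ?mul1r// mulr_gt0// exprn_gt0.
  have b2 : `|t * (xi - R0) ^+ 2| <= 24^-1.
    apply: le_trans tw; rewrite normrM (ger0_norm t0) normrX.
    apply: (@le_trans _ _ (t * (48 * (X ^+ (e + 2) / rho)) ^+ 2)).
      by rewrite ler_wpM2l// lerXn2r ?nnegrE.
    have -> : t * (48 * (X ^+ (e + 2) / rho)) ^+ 2 = t * R0 * (48 / rho) ^+ 2.
      have -> : R0 = X ^+ (e + 2) ^+ 2.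
        by rewrite /R0 -exprM; congr (_ ^+ _); clear; lia.
      by ring.
    by rewrite ler_wpM2r ?sqr_ge0.
  by have := ler_normD ((u i + 2 * t * R0) * (xi - R0)) (t * (xi - R0) ^+ 2); lra.
exists (u i * (shift e h b i)%:R + t * (shift e h b i)%:R ^+ 2) => l.
have i1 : (0 < i)%N by rewrite lt0n.
have [|k kP] := zu i.-1; first by rewrite prednK//; exact: ij.
have rE : rest u (fun j => tnth p.2 j) i.-1 = u i by rewrite /rest prednK// valK.
rewrite rE prednK// in kP.
have lK : (l < K)%N by have := ltn_ord l; rewrite {2}/Ks (negbTE i0).
exists ((z * (K + l) ^ 2)%:Z + k * (K + l)%:Z) => xi.
rewrite /kap /lam (negbTE i0) => xW.
apply: (rung (l := Ordinal lK) (ij i) kP xW).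
  have kL : (ladder e h b i l)%:R <= L / 16.
    by rewrite ler_pdivlMr// -natrM ler_nat mulnC; exact: ladder_top.
  have tk : 2 * t * (ladder e h b i l)%:R <= c1 * H / 4.
    apply: (@le_trans _ _ (2 * t * (L / 16))); first by rewrite ler_wpM2l// mulr_ge0.
    rewrite LE.
    have -> : 2 * t * (H * X ^+ (2 * e + 4) / 16) = (t * X ^+ (2 * e + 4)) * (H / 8) by field.
    have -> : c1 * H / 4 = 2 * c1 * (H / 8) by field.
    by rewrite ler_wpM2r// divr_ge0// ltW.
  apply: (@le_trans _ _ ((c1 * H + c1 * H / 4) * (48 / rho))).
    apply: ler_pM; rewrite ?divr_ge0 ?(ltW rho0)//.
      by rewrite addr_ge0// mulr_ge0// mulr_ge0.
    by apply: lerD => //; apply: le_trans (us i i0) _; rewrite ler_peMr// ltW.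
  have -> : (c1 * H + c1 * H / 4) * (48 / rho) = 24^-1 * (5 / 4 / 48 / 2 * rho).
    by rewrite /window; field; rewrite ?hn ?rn0.
  by rewrite ler_piMr.
apply: le_trans tw; rewrite ler_wpM2r ?sqr_ge0//; apply: le_trans tR.
by rewrite ler_peMr// exprn_ege1.
Qed.

Lemma instance_spec : exists (f : phys R n m -> R[i]) F T W,
  packet_spec eta1 s rho c1 v eps M ts r0 f F T W.
Proof.
exists f, F, times, W.
have [f2i f2] := Rintegral_sqr_normc_packet v (@kap) c0 lam_gt0 kT_inj.
have [Si Sb] := Rintegral_sobolev_packet v c0 L1 lam_gt0 Ks_gt0 lamL KD kapL sep kT_inj kTL s2.
(* The estimate of order 0 bounds the L^2 norm of the transform; since L >= 1, its right-hand side
   is at most the one for [s]. *)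
have h2 : (0 : R) <= 2^-1 by rewrite invr_ge0.
have [S0i S0b] := Rintegral_sobolev_packet v c0 L1 lam_gt0 Ks_gt0 lamL KD kapL sep kT_inj kTL h2.
have E0 : (fun z => ((1 + sqnorm z) `^ 0 * normc (F z) ^+ 2)%:E) = fun z => (normc (F z) ^+ 2)%:E.
  by apply/funext => z; rewrite powRr0 mul1r.
split.
- exact: packet_periodic.
- exact: packet_integrable.
- move=> p i fp; apply: lt_le_trans (packet_support lam_gt0 i fp) _.
  rewrite /lam; case: ifP => _; last by rewrite invrK.
  by rewrite invf_div ler_pdivrMr// ler_peMr ?(ltW rho0)// exprn_ege1.
- apply: le_trans (Rintegral_normc_packet v (@kap) kT c0 lam_gt0) _.
  exact: le_trans L1_bound L1_eps.
- exact: f2i.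
- by apply: le_trans f2 _; exact: le_trans L2_bound L2_eps.
- exact: packet_fourier.
- exact: packet_hat_integrable.
- exact: Si.
- by apply: le_trans Sb _; exact: le_trans S_bound S_eps.
- by rewrite -E0.
- have -> : \int[freq_measure R n m]_z (normc (F z) ^+ 2) =
      \int[freq_measure R n m]_z ((1 + sqnorm z) `^ 0 * normc (F z) ^+ 2).
    by apply: eq_Rintegral => z _; rewrite powRr0 mul1r.
  apply: le_trans S0b _; apply: le_trans (le_trans S_bound S_eps).
  rewrite maxxx mulr0 powRr0 mulr1 ler_wpM2r//.
    rewrite mulr_ge0 ?exprn_ge0 ?mulr_ge0//.
    by apply: prodr_ge0 => i _; rewrite divr_ge0 ?mulr_ge0// ltW.
  rewrite ler_peMr ?sqr_ge0//.
  rewrite -[leLHS](powRr0 L); apply: ler_powR => //.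
  by rewrite mulr_ge0// le_max lexx orbT.
- move=> z j Fz; apply: leq_trans (packet_hat_support kT_lb j Fz).
  rewrite leq_exp2l// /r; apply: leq_trans rb _.
  by apply: leq_trans (leq_addr _ _); apply: leq_trans (leq_addl _ _); rewrite leq_pmulr// addn_gt0 orbT.
- exact: torus_majorant_ge0.
- by have [] := Rintegral_torus_majorant c Ks r kT_inj ts ceta.
- have [_ Wb] := Rintegral_torus_majorant c Ks r kT_inj ts ceta.
  by apply: le_trans Wb _; exact: le_trans W_bound W_eps.
- by move=> t i p tts; apply: packet_tail.
- exact: times_small.
- exact: large.
Qed.

End instance.

(** * Choice of the amplitude and of the base *)

Section packet_exists.
Variables (R : realType) (n' m : nat) (eta1 : R -> R) (s rho : R).
Local Notation n := n'.+1.
Local Notation e := (n' + m)%N.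
Hypotheses (m0 : (0 < m)%N) (ceta : cutoff eta1).
Hypothesis sP : s < (n + m)%:R / (2 * (n + m + 1)%:R).
Hypotheses (rho0 : 0 < rho) (rho1 : rho <= 1).

Let E : R := e%:R.

Let E1 : 1 <= E.
Proof. by rewrite ler1n addn_gt0 m0 orbT. Qed.

Let sE : s < (E + 1) / (2 * (E + 2)).
Proof.
have := sP; rewrite addn1 addSn; congr (_ < _ / (2 * _)).
  by rewrite /E -[_.+1%:R]natr1.
by rewrite /E -[_.+2%:R]natr1 -[_.+1%:R]natr1 -addrA.
Qed.

Let s2 : s <= 2^-1.
Proof.
apply: ltW; apply: lt_le_trans sE _; rewrite ler_pdivrMr; last by move: E1; lra.
by move: E1; lra.
Qed.

Let sigma : R := 4 * (e + 2)%:R * Num.max s 0.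

Let sigma_lt : sigma < 2 * (E + 1).
Proof.
have EE : (e + 2)%:R = E + 2 :> R by rewrite natrD.
have E2 : 0 < E + 2 by move: E1; lra.
rewrite /sigma EE maxEle; case: ifP => _; first by rewrite mulr0; move: E1; lra.
have := sE; rewrite ltr_pdivlMr; last by lra.
by lra.
Qed.

(** The size [c1] of the region depends on [rho] but not on [eps] or [M]: all the packets placed at
    one location are large on the same region, however small their norms are required to be. *)
Lemma packet_exists : exists2 c1 : R, 0 < c1 <= rho &
  forall (v : 'I_n -> R) (eps M : R) (ts : seq R) (r0 : nat), 0 < eps ->
  exists (f : phys R n m -> R[i]) (F : freq R n m -> R[i]) (T : seq R)
    (W : m.-tuple (measurableTypeR R) -> R), packet_spec eta1 s rho c1 v eps M ts r0 f F T W.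
Proof.
(* H = 2^h has to exceed 24 * 48 / rho, and 2^h >= h suffices for that. *)
pose h := Num.Def.archi_bound (24 * 48 / rho).
pose H : R := 2 ^+ h.
have hH : 24 * 48 / rho <= H.
  apply: (@le_trans _ _ h%:R); first exact/ltW/archi_boundP/divr_ge0/ltW.
  by rewrite /H -natrX ler_nat ltnW// ltn_expl.
have H1 : 1 <= H by apply: exprn_ege1; rewrite ler1n.
have H0 : 0 < H by exact: lt_le_trans H1.
have Hrho : 24 * 48 <= H ^+ 2 * rho.
  rewrite -ler_pdivrMr//; apply: le_trans hH _.
  by rewrite expr2 ler_peMl// ltW.
have w0 : 0 < window rho H by rewrite divr_gt0 ?exprn_gt0 ?divr_gt0// mulr_gt0.
have w1 : window rho H <= rho.
  rewrite ler_pdivrMr ?mulr_gt0// expr2 ler_pM ?divr_ge0 ?(ltW rho0)//.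
  - by rewrite ler_pdivrMr// ler_peMr ?ler1n// ltW.
  - by rewrite ler_pdivrMr//; move: rho1 H1; lra.
exists (window rho H) => [|v eps M ts r0 eps0]; first exact/andP.
(* A quarter of the gap between the exponents, capped at 1/4: the peak will be X^d up to a constant,
   and every quantity to be made small O(X^(- 2 d)). *)
pose d := Num.min ((2 * (E + 1) - sigma) / 4) 4^-1.
have d0 : 0 < d by rewrite lt_min invr_gt0 ltr0n divr_gt0//= subr_gt0.
have [dS d4] : 4 * d <= 2 * (E + 1) - sigma /\ 4 * d <= 1.
  have : d <= (2 * (E + 1) - sigma) / 4 by rewrite ge_min lexx.
  have : d <= 4^-1 by rewrite ge_min lexx orbT.
  by split; lra.
pose C1 : R := 100 ^+ n * (size ts)%:R * 2.
pose C2 : R := H `^ (2 * Num.max s 0) * 30 ^+ n * 2 ^+ m.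
pose C0 : R := 24 * (32 * 24) ^+ e.
have C10 : 0 <= C1 by rewrite !mulr_ge0 ?exprn_ge0.
have C20 : 0 <= C2 by rewrite !mulr_ge0 ?exprn_ge0 ?powR_ge0.
have C00 : 0 < C0 by rewrite mulr_gt0 ?exprn_gt0 ?mulr_gt0.
have dd0 : 0 < 2 * d by rewrite mulr_gt0.
have [b1 hb1] := powR_small (2 + C1 + C2) dd0 eps0.
have [b2 hb2] := powR_small 1 dd0 w0.
have [b3 hb3] := powR_small (M * C0) d0 ltr01.
pose b := (5 + r0 + b1 + b2 + b3)%N.
have Y1 : (2 + C1 + C2) * (2 ^+ b) `^ (- (2 * d)) <= eps.
  by apply: hb1; rewrite /b; clear; lia.
have Y2 : 1 * (2 ^+ b) `^ (- (2 * d)) <= window rho H.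
  by apply: hb2; rewrite /b; clear; lia.
have Y3 : M * C0 * (2 ^+ b) `^ (- d) <= 1.
  by apply: hb3; rewrite /b; clear; lia.
have b5 : (5 <= b)%N by rewrite /b; clear; lia.
have rb : (r0 <= b)%N by rewrite /b; clear; lia.
move: (b) b5 rb Y1 Y2 Y3 => {}b b5 rb.
set X : R := 2 ^+ b; set Y := X `^ (- (2 * d)) => Y1 Y2 Y3.
have X1 : 1 <= X by apply: exprn_ege1; rewrite ler1n.
have X0 : 0 < X by exact: lt_le_trans X1.
have Xn k : X ^+ k = X `^ k%:R by rewrite powR_mulrn// ltW.
have XV k : (X ^+ k)^-1 = X `^ (- k%:R) by rewrite powRN Xn.
have Xd x y : X `^ x * X `^ y = X `^ (x + y).
  by rewrite powRD// (gt_eqF X0) implybT.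
have Yle x : x <= - (2 * d) -> X `^ x <= Y by move=> xd; exact: ler_powR.
have Y0 : 0 <= Y by exact: powR_ge0.
have Y1' C : 0 <= C -> C <= 2 + C1 + C2 -> C * Y <= eps.
  by move=> C3 C4; apply: le_trans Y1; exact: ler_wpM2r.
have XY : X^-1 <= Y.
  by have := XV 1%N; rewrite expr1 => ->; apply: Yle; lra.
(* The peak c X^E is X^d. The Sobolev exponent is 2 d - (2 (E + 1) - sigma) <= - 2 d; the exponent
   of the torus mean square is 2 d - m <= - 2 d, where m >= 1 is the gain from averaging over the
   torus. *)
pose c := X `^ (d - E).
have c2 : c ^+ 2 = X `^ (2 * d - 2 * E).
  by rewrite expr2 Xd; congr (_ `^ _); ring.
have L2e : c ^+ 2 * (X ^+ (2 * n' + m)) <= Y.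
  rewrite c2 Xn Xd; apply: Yle; rewrite natrD natrM.
  have m1 : 1 <= m%:R :> R by rewrite ler1n.
  have -> : E = n'%:R + m%:R by rewrite /E natrD.
  by lra.
apply: (@instance_spec _ _ _ h b _ s rho c _ _ v _ _ X H) => //.
- apply: le_trans Y2; rewrite mul1r; apply: le_trans XY; rewrite lef_pV2 ?posrE//.
    rewrite -[leLHS]mul1r; apply: ler_pM => //; first exact: ltW.
      exact: exprn_ege1.
    by rewrite addn2 exprS; apply: ler_peMr; [exact: ltW|exact: exprn_ege1].
  by rewrite mulr_gt0 ?exprn_gt0.
- exact: powR_ge0.
- rewrite XV Xd; apply: (@le_trans _ _ (1 * Y)).
    by rewrite mul1r; apply: Yle; move: E1; lra.
  by apply: Y1'; lra.
- by apply: le_trans L2e _; rewrite -[leLHS]mul1r; apply: Y1'; lra.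
- apply: (@le_trans _ _ (Y * C1)); first by rewrite ler_wpM2r.
  by rewrite mulrC; apply: Y1'; lra.
- apply: (@le_trans _ _ (Y * C2)); last by rewrite mulrC; apply: Y1'; lra.
  rewrite ler_wpM2r// -/sigma c2 Xd XV Xd; apply: Yle.
  by move: dS; lra.
- apply: (@le_trans _ _ (2 * Y)); first by rewrite ler_wpM2l.
  by apply: Y1'; lra.
- rewrite Xn Xd addrNK ler_pdivlMr// -/C0.
  by move: Y3; rewrite powRN ler_pdivrMr ?powR_gt0// mul1r.
Qed.

End packet_exists.

(** * Sums of packets *)

Section complex_limits.
Variable R : realType.
Implicit Types (z w l : R[i]).

Lemma normcD_le z w : normc (z + w) <= normc z + normc w.
Proof. by rewrite -lecR rmorphD /= -!normr_normc ler_normD. Qed.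

Lemma normc_opp z : normc (- z) = normc z.
Proof. by case: z => a b; rewrite /= !sqrrN. Qed.

(** Radii in R[i] are elements of its own partial order, so a positive one is real and the
    real-valued modulus can be used instead. *)
Lemma cvg_normc (T : Type) (F : set_system T) {FF : Filter F} (u : T -> R[i]^o) (l : R[i]^o) :
  u @ F --> l <-> forall d : R, 0 < d -> \forall x \near F, normc ((l : R[i]) - u x) < d.
Proof.
split=> [/cvgrPdist_lt ul d d0|ul].
  have := ul d%:C; rewrite ltcR => /(_ d0); apply: filterS => x.
  by rewrite normr_normc ltcR.
apply/cvgrPdist_lt => d d0; have d1 : 0 < complex.Re d.
  by move: d0; rewrite ltcE => /andP[].
have dE : d = (complex.Re d)%:C.
  by apply: complex_ext => //=; apply/eqP; rewrite eq_sym; move: d0; rewrite ltcE => /andP[/eqP ->].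
by apply: filterS (ul _ d1) => x; rewrite dE normr_normc ltcR.
Qed.

Lemma cvg_ReIm (T : Type) (F : set_system T) {FF : Filter F} (u : T -> R[i]) (l : R[i]) :
  cRe (u x) @[x --> F] --> cRe l -> cIm (u x) @[x --> F] --> cIm l ->
  (u : T -> R[i]^o) @ F --> (l : R[i]^o).
Proof.
move=> /cvgrPdist_lt ur /cvgrPdist_lt ui; apply/cvg_normc => d d0.
have d2 : 0 < d / 2 by rewrite divr_gt0.
apply: filterS2 (ur _ d2) (ui _ d2) => x hr hi.
apply: le_lt_trans (normc_le_ReIm _) _; rewrite cReB cImB.
by rewrite [ltRHS](splitr d) ltrD.
Qed.

End complex_limits.

Section complex_dominated.
Context d (T : measurableType d) (R : realType).
Variable mu : {measure set T -> \bar R}.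

Lemma integrable_cvg (u : nat -> T -> R) (v : T -> R) (g : T -> \bar R) :
  (forall N, measurable_fun setT (u N)) -> measurable_fun setT v ->
  {ae mu, forall x, u N x @[N --> \oo] --> v x} -> mu.-integrable setT g ->
  (forall N x, (`|u N x|%:E <= g x)%E) ->
  mu.-integrable setT (EFin \o v) /\
  (\int[mu]_x u N x) @[N --> \oo] --> (\int[mu]_x v x).
Proof.
move=> mu_ mv uv ig ug.
have [] := @dominated_convergence _ _ _ mu _ measurableT (fun N => EFin \o u N) (EFin \o v) g.
- by move=> N; exact/measurable_EFinP.
- exact/measurable_EFinP.
- by apply: filterS uv => x ux _; apply: cvg_EFin => //; exact: nearW.
- by [].
- by apply: aeW => x N _; rewrite /= ug.
move=> iv _ h; split => //.
have iu N : mu.-integrable setT (EFin \o u N).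
  apply: le_integrable ig => //; first exact/measurable_EFinP.
  by move=> x _; apply: le_trans (ug N x) _; exact: lee_abs.
have ivf := integrable_fin_num measurableT iv.
have := h; rewrite -[X in _ --> X](fineK ivf) => /fine_cvg; apply: cvg_trans; apply: near_eq_cvg.
by apply: nearW => N.
Qed.

Lemma integral_complex_cvg (u : nat -> T -> R[i]) (v : T -> R[i]) (g : T -> \bar R) :
  (forall N, measurable_complex (u N)) -> measurable_complex v ->
  {ae mu, forall x, cRe (u N x) @[N --> \oo] --> cRe (v x)} ->
  {ae mu, forall x, cIm (u N x) @[N --> \oo] --> cIm (v x)} ->
  mu.-integrable setT g -> (forall N x, ((normc (u N x))%:E <= g x)%E) ->
  [/\ integrable_complex mu v,
      cRe (integral_complex mu (u N)) @[N --> \oo] --> cRe (integral_complex mu v) &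
      cIm (integral_complex mu (u N)) @[N --> \oo] --> cIm (integral_complex mu v)].
Proof.
move=> mu_ [mr mi] hr hi ig ug.
have [] := integrable_cvg (fun N => (mu_ N).1) mr hr ig.
  by move=> N x; apply: le_trans (ug N x); rewrite lee_fin normr_cRe_le.
have [] := integrable_cvg (fun N => (mu_ N).2) mi hi ig.
  by move=> N x; apply: le_trans (ug N x); rewrite lee_fin normr_cIm_le.
by move=> ii ci ir cr; split.
Qed.

Lemma L2normE (g : T -> R[i]) : L2norm mu g = poweR (\int[mu]_x (normc (g x) ^+ 2)%:E)%E 2^-1.
Proof.
rewrite /L2norm unlock /Lnorm /=; congr (_ `^ _)%E.
apply: eq_integral => x _ /=; congr EFin.
by rewrite ger0_norm ?normc_ge0// powR_mulrn// normc_ge0.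
Qed.

Lemma L2norm_lty (g : T -> R[i]) :
  ((\int[mu]_x (normc (g x) ^+ 2)%:E) < +oo -> L2norm mu g < +oo)%E.
Proof. by move=> h; rewrite L2normE poweR_lty. Qed.

Lemma L2norm_cvg0 (g : nat -> T -> R[i]) :
  (forall e : R, 0 < e ->
     \forall j \near \oo, (\int[mu]_x (normc (g j x) ^+ 2)%:E <= e%:E)%E) ->
  L2norm mu (g j) @[j --> \oo] --> 0%E.
Proof.
move=> gb.
have I0 j : (0 <= \int[mu]_x (normc (g j x) ^+ 2)%:E)%E.
  by apply: integral_ge0 => x _; rewrite lee_fin sqr_ge0.
have L0 j : (0 <= L2norm mu (g j))%E by rewrite L2normE poweR_ge0.
have Lb e : 0 < e -> \forall j \near \oo, (L2norm mu (g j) <= e%:E)%E.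
  move=> e0; have := gb (e ^+ 2); rewrite exprn_gt0// => /(_ isT).
  apply: filterS => j h; rewrite L2normE.
  have -> : e%:E = poweR (e ^+ 2)%:E 2^-1.
    by rewrite poweR_EFin powR12_sqrt ?sqr_ge0// sqrtr_sqr gtr0_norm.
  by apply: gt0_ler_poweR => //; rewrite ?invr_ge0// in_itv /= leey ?andbT ?I0 ?lee_fin ?sqr_ge0.
apply/fine_cvgP; split.
  by apply: filterS (Lb 1 ltr01) => j h; rewrite ge0_fin_numE// (le_lt_trans h)// ltry.
apply/cvgrPdist_le => e e0; apply: filterS (Lb e e0) => j h.
rewrite sub0r normrN /= ger0_norm ?fine_ge0// -lee_fin fineK//.
by rewrite ge0_fin_numE// (le_lt_trans h)// ltry.
Qed.

End complex_dominated.

(** * Numerical series and series in L^2 *)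

Section sums.
Variable R : realType.

Lemma geometric_tail (q : R) k N : 0 <= q <= 2^-1 -> \sum_(k <= j < N) q ^+ j <= 2 * q ^+ k.
Proof.
move=> /andP[q0 q2]; have [Nk|kN] := leqP N k.
  by rewrite big_geq// mulr_ge0// exprn_ge0.
suff : \sum_(k <= j < N) q ^+ j <= 2 * (q ^+ k - q ^+ N).
  by move/le_trans; apply; rewrite ler_wpM2l// gerBl exprn_ge0.
elim: N kN => // N IH; rewrite ltnS leq_eqVlt => /predU1P[<-|kN].
  rewrite big_nat1 exprSr mulrBr; have := ler_wpM2l (exprn_ge0 k q0) q2; lra.
rewrite (big_nat_recr _ _ _ (ltnW kN)) exprSr /=.
have h1 := IH kN; have h2 := ler_wpM2l (exprn_ge0 N q0) q2.
by apply: le_trans (lerD h1 (lexx _)) _; lra.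
Qed.

(** Iteration of (a + b)^2 <= 2 a^2 + 2 b^2. The geometric weights are harmless against terms
    decaying like 8^-j. *)
Lemma sqr_sum_le (a : nat -> R) N :
  (\sum_(j < N) a j) ^+ 2 <= \sum_(j < N) 2 ^+ j.+1 * a j ^+ 2.
Proof.
elim: N a => [|N IH] a; first by rewrite !big_ord0 expr2 mulr0 lexx.
rewrite !big_ord_recl /=; set S := \sum_(i < N) a _.
have h : 2 * S ^+ 2 <= \sum_(i < N) 2 ^+ (bump 0 i).+1 * a (bump 0 i) ^+ 2.
  apply: le_trans (ler_wpM2l _ (IH (fun j => a j.+1))) _ => //.
  by rewrite mulr_sumr; apply: ler_sum => i _; rewrite mulrA -exprS.
apply: le_trans (lerD (lexx _) h); rewrite expr1 -subr_ge0.
have -> : 2 * a 0%N ^+ 2 + 2 * S ^+ 2 - (a 0%N + S) ^+ 2 = (a 0%N - S) ^+ 2 by ring.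
exact: sqr_ge0.
Qed.

(** Dominated convergence for sums whose length grows with i: each term converges, and those beyond
    index k are bounded by 2^-j. The sums are Cauchy because they come close to finite sums of the
    limits [al]. *)
Lemma tannery (a : nat -> nat -> R) (al : nat -> R) k :
  (forall j, a i j @[i --> \oo] --> al j) ->
  (forall i j, (k < j)%N -> `|a i j| <= 2^-1 ^+ j) ->
  cvgn (fun i => \sum_(j < i.+1) a i j).
Proof.
move=> aal ab; apply: cauchy_cvg; apply: cauchy_exP => e e0.
have q1 : `|2^-1| < 1 :> R by rewrite ger0_norm ?invr_ge0// invf_lt1// ltr1n.
have /cvgrPdist_lt/(_ e e0)[J0 _ hJ] := cvg_geometric 4 q1.
pose J := (maxn J0 k).+1.
have eJ : 4 * 2^-1 ^+ J < e.
  by have := hJ J; rewrite /= sub0r normrN /geometric /= ger0_norm ?mulr_ge0 ?exprn_ge0 ?invr_ge0//;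
    apply; rewrite /J ltnW// ltnS leq_maxl.
exists (\sum_(j < J) al j).
have cB : (\sum_(j < J) a i j) @[i --> \oo] --> \sum_(j < J) al j.
  elim: (J) => [|j IH].
    by under eq_fun do rewrite big_ord0; rewrite big_ord0; exact: cvg_cst.
  by under eq_fun do rewrite big_ord_recr; rewrite big_ord_recr; apply: cvgD => //; exact: aal.
have d0 : 0 < e - 2 * 2^-1 ^+ J.
  by have : 0 <= 2^-1 ^+ J :> R; [rewrite exprn_ge0 ?invr_ge0|lra].
move/cvgrPdist_lt : cB => /(_ _ d0) hB.
change (\forall i \near \oo, `|\sum_(j < J) al j - \sum_(j < i.+1) a i j| < e).
near=> i; rewrite -(big_mkord xpredT (a i)).
have Ji : (J <= i.+1)%N by near: i; exists J => // i /= h; exact: leqW.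
rewrite (big_cat_nat _ Ji)//= big_mkord opprD addrA.
apply: le_lt_trans (ler_normB _ _) _.
rewrite [ltRHS](_ : e = e - 2 * 2^-1 ^+ J + 2 * 2^-1 ^+ J); last by ring.
apply: ltr_leD; first by near: i.
apply: le_trans (ler_norm_sum _ _ _) _.
apply: (@le_trans _ _ (\sum_(J <= j < i.+1) 2^-1 ^+ j)).
  rewrite big_nat [leRHS]big_nat; apply: ler_sum => j /andP[Jj _]; apply: ab.
  by apply: leq_trans Jj; rewrite /J ltnS leq_maxr.
by apply: geometric_tail; rewrite lexx invr_ge0 ler0n.
Unshelve. all: by end_near.
Qed.

End sums.

Section L2_series.
Context d (T : measurableType d) (R : realType).
Variable mu : {measure set T -> \bar R}.

(** With the weights 2^(j + 1) of [sqr_sum_le] the j-th term integrates to at most 2 * 4^-j. The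
    selection [P] allows the bound to serve for tails and subseries. *)
Lemma L2_series_le (g : T -> R) (u : nat -> T -> R) (P : pred nat) j0 :
  (forall j, P j -> (j0 <= j)%N) -> measurable_fun setT g ->
  (forall x, 0 <= g x) ->
  (forall j, measurable_fun setT (u j)) -> (forall j x, 0 <= u j x) ->
  (forall j, (\int[mu]_x (u j x)%:E <= (8^-1 ^+ j)%:E)%E) ->
  (forall x, ((g x)%:E <= \sum_(j <oo | P j) (2 ^+ j.+1 * u j x)%:E)%E) ->
  (\int[mu]_x (g x)%:E <= (4 * 4^-1 ^+ j0)%:E)%E.
Proof.
move=> Pj mg g0 mu_ u0 ui gu.
pose b j x : \bar R := if P j then (2 ^+ j.+1 * u j x)%:E else 0%E.
have b0 j x : (0 <= b j x)%E.
  by rewrite /b; case: ifP => // _; rewrite lee_fin mulr_ge0 ?exprn_ge0.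
have mb j : measurable_fun setT (b j).
  rewrite /b; case: (P j); last exact: measurable_cst.
  by apply/measurable_EFinP; apply: measurable_funM.
apply: (@le_trans _ _ (\int[mu]_x \sum_(0 <= j <oo) b j x)%E).
  apply: ge0_le_integral => //; first by move=> x _; rewrite lee_fin.
  - exact/measurable_EFinP.
  - exact: ge0_emeasurable_sum.
  - by move=> x _; apply: le_trans (gu x) _; rewrite eseries_mkcond.
rewrite integral_nneseries//; apply: lime_le.
  by apply: is_cvg_nneseries => j _ _; exact: integral_ge0.
apply: nearW => N; apply: (@le_trans _ _ (\sum_(0 <= j < N | (j0 <= j)%N) (2 * 4^-1 ^+ j)%:E)%E).
  rewrite [leRHS]big_mkcond; apply: lee_sum => j _; rewrite /b; case: (P j) (Pj j) => [/(_ isT) ->|_].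
    under eq_integral do rewrite EFinM.
    rewrite ge0_integralZl_EFin//; last 2 first.
    - by move=> x _; rewrite lee_fin.
    - exact/measurable_EFinP.
    apply: le_trans (lee_wpmul2l _ (ui j)) _; first by rewrite lee_fin exprn_ge0.
    rewrite -EFinM lee_fin exprS -mulrA -exprMn ler_wpM2l//.
    by rewrite (_ : 2 * 8^-1 = 4^-1 :> R)//; field.
  by rewrite integral0; case: ifP => // _; rewrite lee_fin mulr_ge0 ?exprn_ge0 ?invr_ge0.
rewrite sumEFin lee_fin.
have [Nj|jN] := leqP N j0.
  rewrite big_nat_cond big1 ?mulr_ge0 ?exprn_ge0 ?invr_ge0// => j /andP[/andP[_ jN] j0j].
  by move: (leq_trans jN (leq_trans Nj j0j)); rewrite ltnn.
rewrite (big_cat_nat _ (ltnW jN))//= big_nat_cond big1 ?add0r; last first.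
  by move=> j /andP[/andP[_ jj]]; rewrite leqNgt jj.
rewrite big_nat_cond (eq_bigl (fun j => (j0 <= j < N)%N)); last first.
  by move=> j; case: (j0 <= j)%N => //=; rewrite andbT.
rewrite -big_nat -mulr_sumr; apply: (@le_trans _ _ (2 * (2 * 4^-1 ^+ j0))); last by lra.
rewrite ler_wpM2l//; apply: geometric_tail.
by rewrite invr_ge0 ler0n lef_pV2 ?posrE ?ler_nat.
Qed.

End L2_series.

(** * Measurability on the frequency space and properties of the cutoff *)

Section measurability.
Variables (R : realType) (n m : nat).

Lemma measurable_int_fun d (T : measurableType d) (f : int -> T) : measurable_fun setT f.
Proof. by []. Qed.

Lemma measurable_freq_torus d (T : measurableType d) (f : int -> T) (j : 'I_m) :
  measurable_fun setT (fun z : freq R n m => f (tnth z.2 j)).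
Proof.
apply: (measurableT_comp (measurable_int_fun f)).
exact: (measurableT_comp (measurable_tnth j) measurable_snd).
Qed.

Lemma measurable_freq_euclid (f : R -> R) (i : 'I_n) : measurable_fun setT f ->
  measurable_fun setT (fun z : freq R n m => f (tnth z.1 i)).
Proof.
move=> mf; apply: (measurableT_comp mf).
exact: (measurableT_comp (measurable_tnth i) measurable_fst).
Qed.

Lemma measurable_sqnorm : measurable_fun setT (@sqnorm R n m).
Proof.
apply: measurable_funD; apply: measurable_sum => i.
  by apply: (@measurable_freq_euclid (fun x => x ^+ 2)); exact: measurable_funX.
exact: (@measurable_freq_torus _ _ (fun k : int => k%:~R ^+ 2 : measurableTypeR R)).
Qed.

Lemma measurable_pairing (p : phys R n m) : measurable_fun setT (pairing p).
Proof.
apply: measurable_funD; apply: measurable_sum => i.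
  by apply: (@measurable_freq_euclid (fun x => tnth p.1 i * x)); exact: measurable_funM.
exact: (@measurable_freq_torus _ _ (fun k : int => tnth p.2 i * k%:~R : measurableTypeR R)).
Qed.

Lemma measurable_pairing_phys (z : freq R n m) : measurable_fun setT (fun p : phys R n m => pairing p z).
Proof.
apply: measurable_funD; apply: measurable_sum => i; apply: measurable_funM => //.
  exact: (measurableT_comp (measurable_tnth i) measurable_fst).
exact: (measurableT_comp (measurable_tnth i) measurable_snd).
Qed.

Lemma measurable_phase (t : R) (p : phys R n m) :
  measurable_complex (fun z : freq R n m => expi2pi (pairing p z + t * sqnorm z)).
Proof.
apply: measurable_complex_expi2pi; apply: measurable_funD; first exact: measurable_pairing.
by apply: measurable_funM => //; exact: measurable_sqnorm.
Qed.

Variable eta1 : R -> R.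
Hypothesis ceta : cutoff eta1.

Lemma measurable_eta (N : R) : measurable_fun setT (fun z : freq R n m => Defs.eta eta1 N z).
Proof.
have [de _ _ _ _] := ceta.
have ce : continuous eta1 by apply: derivable_continuous => x; exact: (de 0%N).
have me : measurable_fun setT (fun x : R => eta1 (x / N)).
  by apply: (measurableT_comp (continuous_measurable_fun ce)); exact: measurable_funM.
apply: measurable_funM; apply: measurable_prod => i _.
  exact: (@measurable_freq_euclid (fun x : R => eta1 (x / N))).
exact: (@measurable_freq_torus _ _ (fun k : int => eta1 (k%:~R / N) : measurableTypeR R)).
Qed.

Lemma eta_ge0 N (z : freq R n m) : 0 <= Defs.eta eta1 N z.
Proof.
have [_ e01 _ _ _] := ceta; have e0 x : 0 <= eta1 x by have /andP[] := e01 x.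
by rewrite mulr_ge0//; apply: prodr_ge0 => i _.
Qed.

Lemma eta_le1 N (z : freq R n m) : Defs.eta eta1 N z <= 1.
Proof.
have [_ e01 _ _ _] := ceta; have e0 x : 0 <= eta1 x by have /andP[] := e01 x.
by apply: mulr_ile1; (try by apply: prodr_ge0); apply: prodr_ile1 => i _; exact: e01.
Qed.

Lemma eta_eq0 (N : R) (z : freq R n m) j : 0 < N -> 2 * N <= `|tnth z.2 j|%:R -> Defs.eta eta1 N z = 0.
Proof.
move=> N0 h; have [_ _ _ _ e2] := ceta.
rewrite /Defs.eta (bigD1 j)//= [X in X * \prod_(_ | _) _]e2 ?mul0r ?mulr0//.
rewrite normrM normfV (gtr0_norm N0) ler_pdivlMr//; apply: le_trans h _.
by rewrite -intr_norm -[X in X <= _]/((`|tnth z.2 j|%N%:Z)%:~R) abszE.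
Qed.

Lemma eta_cvg1 (z : freq R n m) : Defs.eta eta1 (2 ^+ i) z @[i --> \oo] --> (1 : R).
Proof.
have [_ _ _ e1 _] := ceta.
pose B := \sum_(i < n) `|tnth z.1 i| + \sum_(j < m) `|(tnth z.2 j)%:~R| : R.
have B0 : 0 <= B by rewrite addr_ge0// sumr_ge0.
apply: cvg_near_cst; exists (Num.Def.archi_bound B) => // i /= iB.
have Bi : B <= 2 ^+ i.
  apply: le_trans (ltW (archi_boundP B0)) _; rewrite -natrX ler_nat.
  by apply: leq_trans iB _; exact/ltnW/ltn_expl.
have i0 : 0 < 2 ^+ i :> R by rewrite exprn_gt0.
rewrite /Defs.eta !big1 ?mulr1// => j _; apply: e1;
  rewrite normrM normfV (gtr0_norm i0) ler_pdivrMr// mul1r (le_trans _ Bi)// /B.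
  by rewrite [X in _ + X](bigD1 j)//= addrCA lerDl addr_ge0// sumr_ge0.
by rewrite (bigD1 j)//= -addrA lerDl addr_ge0// sumr_ge0.
Qed.

End measurability.

Lemma big_ord_support (V : nmodType) (a : nat -> V) (P : pred nat) N M :
  (forall j, (N <= j)%N -> a j = 0) -> (forall j, (M <= j)%N -> a j = 0) ->
  \sum_(j < N | P j) a j = \sum_(j < M | P j) a j.
Proof.
have wl N' M' : (N' <= M')%N -> (forall j, (N' <= j)%N -> a j = 0) ->
    \sum_(j < N' | P j) a j = \sum_(j < M' | P j) a j.
  move=> NM aN; rewrite -!(big_mkord P) [RHS](big_cat_nat _ NM)//=.
  by rewrite [X in _ + X]big_nat_cond [X in _ + X]big1 ?addr0// => j /andP[/andP[/aN]].
by move=> aN aM; have [NM|/ltnW MN] := leqP N M; [exact: wl|exact/esym/wl].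
Qed.

(** * The sum of the transforms *)

Section hat_sum.
Variables (R : realType) (n m : nat) (i0 : 'I_m) (F : nat -> freq R n m -> R[i]).
Local Notation mu := (freq_measure R n m).
Hypothesis Fi : forall j, integrable_complex mu (F j).
Hypothesis Fs : forall j z, F j z != 0 -> (2 ^ j <= `|tnth z.2 i0|)%N.

(* The sum is locally finite: at most log2 |k_0| of its terms are nonzero. *)
Definition hat_sum (P : pred nat) (z : freq R n m) : R[i] :=
  \sum_(j < `|tnth z.2 i0| | P j) F j z.

Let F0 j z : (`|tnth z.2 i0| <= j)%N -> F j z = 0.
Proof.
move=> kj; apply/eqP; apply: contraT => /Fs h.
by have := leq_trans h kj; rewrite leqNgt ltn_expl.
Qed.

Lemma hat_sumE P N z : (forall j, (N <= j)%N -> F j z = 0) ->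
  hat_sum P z = \sum_(j < N | P j) F j z.
Proof. by move=> h; apply: (big_ord_support (a := F^~ z)) => // j; exact: F0. Qed.

Lemma measurable_hat_sum P : measurable_complex (hat_sum P).
Proof.
have mF N : measurable_complex (fun z => \sum_(j < N | P j) F j z).
  by apply: measurable_complex_sum => j _; exact: integrable_complex_measurable (Fi j).
have ev z : \forall N \near \oo, \sum_(j < N | P j) F j z = hat_sum P z.
  exists `|tnth z.2 i0|%N => // N /= zN; apply/esym/hat_sumE => j Nj.
  by apply: F0; exact: leq_trans Nj.
split; apply/measurable_EFinP.
  apply: (emeasurable_fun_cvg (fun N z => (cRe (\sum_(j < N | P j) F j z))%:E)).
    by move=> N; apply/measurable_EFinP; exact: (mF N).1.
  by move=> z _; apply: cvg_near_cst; apply: filterS (ev z) => N ->.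
apply: (emeasurable_fun_cvg (fun N z => (cIm (\sum_(j < N | P j) F j z))%:E)).
  by move=> N; apply/measurable_EFinP; exact: (mF N).2.
by move=> z _; apply: cvg_near_cst; apply: filterS (ev z) => N ->.
Qed.

Lemma hat_sum_L2 (w : freq R n m -> R) (P : pred nat) j0 :
  measurable_fun setT w -> (forall z, 0 <= w z) ->
  (forall j, (\int[mu]_z (w z * normc (F j z) ^+ 2)%:E <= (8^-1 ^+ j)%:E)%E) ->
  (forall j, P j -> (j0 <= j)%N) ->
  (\int[mu]_z (w z * normc (hat_sum P z) ^+ 2)%:E <= (4 * 4^-1 ^+ j0)%:E)%E.
Proof.
move=> mw w0 wF Pj; apply: (@L2_series_le _ _ _ mu _ (fun j z => w z * normc (F j z) ^+ 2) P j0) => //.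
- apply: measurable_funM => //; apply: measurable_funX.
  exact/measurable_normc/measurable_hat_sum.
- by move=> z; rewrite mulr_ge0// sqr_ge0.
- move=> j; apply: measurable_funM => //; apply: measurable_funX.
  exact/measurable_normc/integrable_complex_measurable.
- by move=> j z; rewrite mulr_ge0// sqr_ge0.
move=> z; set N := `|tnth z.2 i0|%N.
apply: (@le_trans _ _ (\sum_(0 <= j < N | P j) (2 ^+ j.+1 * (w z * normc (F j z) ^+ 2))%:E)%E); last first.
  by apply: nneseries_lim_ge => j _ _; rewrite lee_fin !mulr_ge0 ?exprn_ge0 ?normc_ge0.
rewrite sumEFin lee_fin.
have -> : \sum_(0 <= j < N | P j) 2 ^+ j.+1 * (w z * normc (F j z) ^+ 2) =
    w z * \sum_(j < N) 2 ^+ j.+1 * (if P j then normc (F j z) else 0) ^+ 2.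
  rewrite big_mkord big_mkcond mulr_sumr; apply: eq_bigr => j _.
  by case: (P j); rewrite ?expr0n ?mulr0// mulrCA.
rewrite ler_wpM2l//; apply: le_trans (sqr_sum_le (fun j => if P j then normc (F j z) else 0) N).
rewrite lerXn2r ?nnegrE ?normc_ge0 ?sumr_ge0//.
  by move=> j _; case: (P j); rewrite ?normc_ge0.
apply: le_trans (normc_sum _ _ _) _.
by rewrite big_mkcond.
Qed.

Variable eta1 : R -> R.
Hypothesis ceta : cutoff eta1.

Lemma integrable_schrodinger_integrand G (t : R) p : integrable_complex mu G ->
  integrable_complex mu (schrodinger_integrand G t p).
Proof.
move=> iG; apply: integrable_complexMb => //; first exact: measurable_phase.
by move=> z; rewrite normc_expi2pi.
Qed.

Lemma integrable_cutoff G (N : R) : integrable_complex mu G ->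
  integrable_complex mu (fun z => (Defs.eta eta1 N z)%:C * G z).
Proof.
move=> iG; apply: integrable_complexMb => //.
  by apply: measurable_complex_real; exact: measurable_eta.
by move=> z; rewrite normc_real ger0_norm ?eta_ge0 ?eta_le1.
Qed.

Lemma schrodinger_P_le G (t : R) p N : integrable_complex mu G ->
  normc (schrodinger_P eta1 G t p N) <= 2 * \int[mu]_z normc (G z).
Proof.
move=> iG; apply: normc_integral_le.
- exact/integrable_schrodinger_integrand/integrable_cutoff.
- exact: integrable_normc.
move=> z; rewrite !Normc.normcM normc_expi2pi mul1r normc_real ger0_norm ?eta_ge0//.
by rewrite ler_piMl ?normc_ge0 ?eta_le1.
Qed.

(** Dominated convergence, the cutoffs being bounded by 1: where the integral converges absolutely,
    the limit over the cutoffs gives the same value. *)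
Lemma schrodinger_P_cvg G (t : R) p : measurable_complex G ->
  integrable_complex mu (schrodinger_integrand G t p) ->
  let I := integral_complex mu (schrodinger_integrand G t p) in
  cRe (schrodinger_P eta1 G t p (2 ^+ i)) @[i --> \oo] --> cRe I /\
  cIm (schrodinger_P eta1 G t p (2 ^+ i)) @[i --> \oo] --> cIm I.
Proof.
move=> mG iG /=.
pose S i z := schrodinger_integrand (fun z => (Defs.eta eta1 (2 ^+ i) z)%:C * G z) t p z.
have SE i z : S i z = (Defs.eta eta1 (2 ^+ i) z)%:C * schrodinger_integrand G t p z.
  by rewrite /S /schrodinger_integrand mulrCA.
have [] // := @integral_complex_cvg _ _ _ mu S (schrodinger_integrand G t p)
  (fun z => (normc (schrodinger_integrand G t p z))%:E).
- move=> N; rewrite (_ : S N = fun z => (Defs.eta eta1 (2 ^+ N) z)%:C * schrodinger_integrand G t p z);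
    last exact/funext.
  apply: measurable_complexM; last exact: integrable_complex_measurable iG.
  by apply: measurable_complex_real; exact: measurable_eta.
- exact: integrable_complex_measurable iG.
- apply: aeW => z; set l := cRe (schrodinger_integrand G t p z).
  have -> : (fun N => cRe (S N z)) = (fun N => Defs.eta eta1 (2 ^+ N) z * l).
    by apply/funext => N; rewrite SE cReM /= mul0r subr0.
  by have := cvgM (eta_cvg1 ceta z) (cvg_cst l); rewrite mul1r; exact.
- apply: aeW => z; set l := cIm (schrodinger_integrand G t p z).
  have -> : (fun N => cIm (S N z)) = (fun N => Defs.eta eta1 (2 ^+ N) z * l).
    by apply/funext => N; rewrite SE cImM /= mul0r addr0.
  by have := cvgM (eta_cvg1 ceta z) (cvg_cst l); rewrite mul1r; exact.
- exact: integrable_normc.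
move=> N z; rewrite SE Normc.normcM normc_real ger0_norm ?eta_ge0// lee_fin.
by rewrite ler_piMl ?normc_ge0 ?eta_le1.
Qed.

(** The cutoff at 2^i vanishes once a torus frequency reaches 2^(i + 1), and packet j has torus
    frequencies of at least 2^j; so only the packets with j <= i are seen. *)
Lemma schrodinger_P_hat_sum (t : R) p i :
  schrodinger_P eta1 (hat_sum xpredT) t p (2 ^+ i) =
  \sum_(j < i.+1) schrodinger_P eta1 (F j) t p (2 ^+ i).
Proof.
rewrite /schrodinger_P -integral_complex_sum; last first.
  by move=> j; exact/integrable_schrodinger_integrand/integrable_cutoff.
apply: eq_integral_complex => z; rewrite /schrodinger_integrand.
rewrite -mulr_sumr; congr (_ * _); rewrite -mulr_sumr.
have [kz|kz] := leqP (2 ^ i.+1) `|tnth z.2 i0|.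
  rewrite (@eta_eq0 _ _ _ _ ceta _ z i0) ?mul0r ?exprn_gt0//.
  by rewrite -exprS -natrX ler_nat.
congr (_ * _); apply: hat_sumE => j ij.
apply/eqP; apply: contraT => /Fs h; have := leq_ltn_trans h kz.
by rewrite ltn_exp2l// ltnS leqNgt ij.
Qed.

End hat_sum.

(** * Divergence at one point *)

Section divergence.
Variables (R : realType) (n m : nat) (i0 : 'I_m) (F : nat -> freq R n m -> R[i]) (eta1 : R -> R).
Local Notation mu := (freq_measure R n m).
Hypothesis Fi : forall j, integrable_complex mu (F j).
Hypothesis Fs : forall j z, F j z != 0 -> (2 ^ j <= `|tnth z.2 i0|)%N.
Hypothesis ceta : cutoff eta1.
Local Notation G := (hat_sum i0 F xpredT).

(** Existence of the limit comes from [tannery]. For the size, all terms are compared at one large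
    cutoff: the sum in the hypothesis pays for the earlier packets, and the margin 4 for the later
    ones, at most 1 in total, and for two approximation errors below 1. *)
Lemma schrodinger_hat_sum_large (k : nat) (t : R) (p : phys R n m) :
  (forall j i, (k < j)%N -> normc (schrodinger_P eta1 (F j) t p (2 ^+ i)) <= 2^-1 ^+ j) ->
  k%:R + 4 + \sum_(j < k) 2 * \int[mu]_z normc (F j z) <=
    normc (integral_complex mu (schrodinger_integrand (F k) t p)) ->
  schrodinger_defined eta1 G t p /\ k%:R <= normc (schrodinger eta1 G t p).
Proof.
move=> small large.
pose A i := schrodinger_P eta1 G t p (2 ^+ i).
pose a i j : R[i] := schrodinger_P eta1 (F j) t p (2 ^+ i).
pose al j := integral_complex mu (schrodinger_integrand (F j) t p).
have AE i : A i = \sum_(j < i.+1) a i j by exact: schrodinger_P_hat_sum.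
have acvg j := schrodinger_P_cvg ceta (integrable_complex_measurable (Fi j))
  (integrable_schrodinger_integrand t p (Fi j)).
have cRA : cvgn (fun i => cRe (A i)).
  have := @tannery _ (fun i j => cRe (a i j)) (fun j => cRe (al j)) k (fun j => (acvg j).1).
  have -> : (fun i => \sum_(j < i.+1) cRe (a i j)) = (fun i => cRe (A i)).
    by apply/funext => i; rewrite AE cRe_sum.
  by apply => i j kj; apply: le_trans (normr_cRe_le _) (small j i kj).
have cIA : cvgn (fun i => cIm (A i)).
  have := @tannery _ (fun i j => cIm (a i j)) (fun j => cIm (al j)) k (fun j => (acvg j).2).
  have -> : (fun i => \sum_(j < i.+1) cIm (a i j)) = (fun i => cIm (A i)).
    by apply/funext => i; rewrite AE cIm_sum.
  by apply => i j kj; apply: le_trans (normr_cIm_le _) (small j i kj).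
pose l : R[i] := limn (fun i => cRe (A i)) +i* limn (fun i => cIm (A i)).
have Al : A @ \oo --> (l : R[i]^o)  by exact: (cvg_ReIm (u := A) (l := l) cRA cIA).
have cA : cvgn A := cvgP _ Al.
split; first by right.
(* Whichever clause defines the value, it is the limit of [A]. *)
have AV : A @ \oo --> (schrodinger eta1 G t p : R[i]^o).
  rewrite /schrodinger; case: asboolP => [iG|_]; last exact: cA.
  have [c1 c2] := schrodinger_P_cvg ceta (measurable_hat_sum Fi Fs xpredT) iG.
  exact: (cvg_ReIm (u := A) c1 c2).
have ak : (fun i => a i k : R[i]^o) @ \oo --> (al k : R[i]^o)  by exact: (cvg_ReIm (u := a^~ k) (l := al k) (acvg k).1 (acvg k).2).
have [N1 _ hV] : \forall i \near \oo, normc (schrodinger eta1 G t p - A i) < 1.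
  by exact: (cvg_normc A (schrodinger eta1 G t p)).1 AV 1 ltr01.
have [N2 _ hk] : \forall i \near \oo, normc (al k - a i k) < 1.
  by exact: (cvg_normc (fun i => a i k : R[i]^o) (al k)).1 ak 1 ltr01.
pose i := maxn k (maxn N1 N2).
have ki : (k < i.+1)%N by rewrite ltnS leq_maxl.
have {}hV : normc (schrodinger eta1 G t p - A i) < 1.
  by apply: hV; rewrite /= /i !leq_max leqnn !orbT.
have {}hk : normc (al k - a i k) < 1.
  by apply: hk; rewrite /= /i !leq_max leqnn !orbT.
have Ai : A i = \sum_(0 <= j < k) a i j + (a i k + \sum_(k.+1 <= j < i.+1) a i j).
  by rewrite AE -(big_mkord xpredT (a i)) (big_cat_nat (leq0n k) (ltnW ki)) /= (big_ltn ki).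
have s1 : normc (\sum_(0 <= j < k) a i j) <= \sum_(j < k) 2 * \int[mu]_z normc (F j z).
  apply: le_trans (normc_sum _ _ _) _; rewrite big_mkord; apply: ler_sum => j _.
  exact: schrodinger_P_le.
have s2 : normc (\sum_(k.+1 <= j < i.+1) a i j) <= 1.
  apply: le_trans (normc_sum _ _ _) _.
  apply: (@le_trans _ _ (\sum_(k.+1 <= j < i.+1) 2^-1 ^+ j)).
    by rewrite big_nat [leRHS]big_nat; apply: ler_sum => j /andP[kj _]; exact: small.
  apply: le_trans (geometric_tail _ _ _) _; first by rewrite lexx invr_ge0 ler0n.
  rewrite exprS mulrA divff ?mul1r//; apply: exprn_ile1; rewrite ?invr_ge0// invf_le1//.
  by rewrite ler1n.
have tri (x y : R[i]) : normc (x + y) <= normc x + normc y by exact: normcD_le.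
have e1 : al k = (al k - a i k) + (A i + (- \sum_(0 <= j < k) a i j
    - \sum_(k.+1 <= j < i.+1) a i j)).
  by rewrite Ai; ring.
have e2 : A i = schrodinger eta1 G t p - (schrodinger eta1 G t p - A i).
  by rewrite opprB addrC subrK.
have h1 : normc (al k) <= normc (al k - a i k) + (normc (A i) +
    (normc (\sum_(0 <= j < k) a i j) + normc (\sum_(k.+1 <= j < i.+1) a i j))).
  rewrite {1}e1; apply: le_trans (tri _ _) _; rewrite lerD2l.
  apply: le_trans (tri _ _) _; rewrite lerD2l.
  by apply: le_trans (tri _ _) _; rewrite !normc_opp.
have h2 : normc (A i) <= normc (schrodinger eta1 G t p) + normc (schrodinger eta1 G t p - A i).
  by rewrite {1}e2; apply: le_trans (tri _ _) _; rewrite normc_opp.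
by move: large; rewrite -/(al k); lra.
Qed.

Lemma not_schrodinger_tends_to (H : freq R n m -> R[i]) (p : phys R n m) (l : R[i]) :
  (forall N : nat, exists t : R, [/\ 0 < t <= 2^-1 ^+ N, schrodinger_defined eta1 H t p &
     N%:R <= normc (schrodinger eta1 H t p)]) ->
  ~ schrodinger_tends_to eta1 H p l.
Proof.
move=> hN /cvg_normc/(_ 1 ltr01).
rewrite near_withinE /dnbhs near_withinE => /nbhs_ballP[e /= e0 he].
have q1 : `|2^-1| < 1 :> R by rewrite ger0_norm ?invr_ge0// invf_lt1// ltr1n.
have /cvgrPdist_lt/(_ e e0)[J0 _ hJ] := cvg_geometric 1 q1.
pose N := maxn J0 (Num.Def.archi_bound (normc l + 1)).
have [t [/andP[t0 tN] td tl]] := hN N.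
have lt_e : 2^-1 ^+ N < e.
  have := hJ N; rewrite /= sub0r normrN /geometric /= mul1r ger0_norm ?exprn_ge0 ?invr_ge0//.
  by apply; rewrite /N leq_maxl.
have := he t; rewrite /ball /= sub0r normrN gtr0_norm// (le_lt_trans tN lt_e) => /(_ isT).
rewrite gt_eqF// => /(_ isT td) h.
have nl : normc l + 1 < N%:R.
  have l0 : 0 <= normc l + 1 by rewrite addr_ge0 ?normc_ge0.
  by apply: lt_le_trans (archi_boundP l0) _; rewrite ler_nat leq_maxr.
have : normc (schrodinger eta1 H t p) <= normc l + normc (l - schrodinger eta1 H t p).
  have e2 : schrodinger eta1 H t p = l - (l - schrodinger eta1 H t p).
    by rewrite opprB addrC subrK.
  by rewrite {1}e2; apply: le_trans (normcD_le _ _) _; rewrite normc_opp.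
by move: h tl nl; lra.
Qed.

End divergence.

(** * The sum in physical space *)

Section absolute_sum.
Context d (T : measurableType d) (R : realType).
Variables (mu : {measure set T -> \bar R}) (f : nat -> T -> R[i]).
Hypothesis fi : forall j, integrable_complex mu (f j).
Hypothesis fL1 : forall j, \int[mu]_x normc (f j x) <= 8^-1 ^+ j.

Definition abs_sum (x : T) : \bar R := (\sum_(j <oo) (normc (f j x))%:E)%E.
Definition summable_at : set T := [set x | (abs_sum x < +oo)%E].

(* The pointwise sum where it converges absolutely, and 0 elsewhere. *)
Definition term (j : nat) (x : T) : R[i] := (\1_summable_at x : R)%:C * f j x.
Definition pointwise_sum (x : T) : R[i] :=
  limn (fun N => cRe (\sum_(j < N) term j x)) +i* limn (fun N => cIm (\sum_(j < N) term j x)).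

Let mf j : measurable_complex (f j) := integrable_complex_measurable (fi j).
Let mn j : measurable_fun setT (EFin \o (fun x => normc (f j x))).
Proof. by apply/measurable_EFinP; exact: measurable_normc. Qed.

Lemma abs_sum_ge N x : ((\sum_(j < N) normc (f j x))%:E <= abs_sum x)%E.
Proof.
rewrite -sumEFin -(big_mkord xpredT (fun j => (normc (f j x))%:E)).
by apply: nneseries_lim_ge => j _ _; rewrite lee_fin normc_ge0.
Qed.

Lemma measurable_abs_sum : measurable_fun setT abs_sum.
Proof.
by apply: ge0_emeasurable_sum => [j x _ _|j _]; [rewrite lee_fin normc_ge0|exact: mn].
Qed.

Lemma integrable_abs_sum : mu.-integrable setT abs_sum.
Proof.
apply/integrableP; split; first exact: measurable_abs_sum.
have a0 x : (0 <= abs_sum x)%E.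
  by apply: nneseries_ge0 => j _ _; rewrite lee_fin normc_ge0.
under eq_integral do rewrite gee0_abs//.
rewrite integral_nneseries//; last by move=> j x _; rewrite lee_fin normc_ge0.
apply: (@le_lt_trans _ _ 2%:E); last exact: ltry.
apply: lime_le.
  by apply: is_cvg_nneseries => j _ _; apply: integral_ge0 => x _; rewrite lee_fin normc_ge0.
apply: nearW => N; apply: (@le_trans _ _ (\sum_(0 <= j < N) (8^-1 ^+ j)%:E)%E).
  apply: lee_sum => j _; rewrite -[leLHS]fineK; first by rewrite lee_fin; exact: fL1.
  by apply: integrable_fin_num => //; exact: integrable_normc.
rewrite sumEFin lee_fin; apply: le_trans (geometric_tail _ _ _) _; last by rewrite expr0 mulr1.
by rewrite invr_ge0 ler0n lef_pV2 ?posrE ?ler_nat.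
Qed.

Lemma ae_summable : {ae mu, forall x, summable_at x}.
Proof.
have := integrable_ae measurableT integrable_abs_sum.
by apply: filterS => x /(_ Logic.I); rewrite fin_numE /summable_at /= ltey => /andP[].
Qed.

Let msummable : measurable summable_at.
Proof.
by rewrite -[summable_at]setTI; apply: emeasurable_fun_infty_o => //; exact: measurable_abs_sum.
Qed.

Lemma measurable_term j : measurable_complex (term j).
Proof.
apply: measurable_complexM => //; apply: measurable_complex_real.
exact: measurable_indic.
Qed.

Lemma term_summable j x : summable_at x -> term j x = f j x.
Proof. by move=> sx; rewrite /term indicE mem_set// mul1r. Qed.

Let normc_term j x : normc (term j x) <= normc (f j x).
Proof.
rewrite /term Normc.normcM normc_real ler_piMl ?normc_ge0// indicE.
by case: (x \in _); rewrite ?normr1 ?normr0.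
Qed.

Let cvg_term (c : R[i] -> R) x : (forall z, `|c z| <= normc z) ->
  cvgn (fun N => \sum_(j < N) c (term j x)).
Proof.
move=> cz; have [sx|sx] := pselect (summable_at x); last first.
  have c0 : c 0 = 0 by apply/eqP; rewrite -normr_le0 (le_trans (cz 0))// Normc.normc0.
  have -> : (fun N => \sum_(j < N) c (term j x)) = fun=> 0.
    apply/funext => N; rewrite big1// => j _.
    by rewrite /term indicE memNset// mul0r c0.
  exact: is_cvg_cst.
have -> : (fun N => \sum_(j < N) c (term j x)) = series (fun j => c (term j x)).
  by apply/funext => N; rewrite /series /= big_mkord.
apply: normed_cvg; apply: nondecreasing_is_cvgn.
  by apply: nondecreasing_series => j _ _; rewrite /= normr_ge0.
exists (fine (abs_sum x)) => _ [N _ <-]; rewrite -lee_fin fineK; last first.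
  by rewrite ge0_fin_numE//; apply: nneseries_ge0 => j _ _; rewrite lee_fin normc_ge0.
apply: le_trans (abs_sum_ge N x); rewrite lee_fin.
change (\sum_(0 <= j < N) `|c (term j x)| <= \sum_(j < N) normc (f j x)); rewrite big_mkord.
by apply: ler_sum => j _; apply: le_trans (cz _) (normc_term _ _).
Qed.

Lemma cvg_pointwise_sum x :
  (cRe (\sum_(j < N) term j x)) @[N --> \oo] --> cRe (pointwise_sum x) /\
  (cIm (\sum_(j < N) term j x)) @[N --> \oo] --> cIm (pointwise_sum x).
Proof.
rewrite /pointwise_sum /=; split.
  have -> : (fun N => cRe (\sum_(j < N) term j x)) = fun N => \sum_(j < N) cRe (term j x).
    by apply/funext => N; rewrite cRe_sum.
  exact: (cvg_term (@normr_cRe_le R)).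
have -> : (fun N => cIm (\sum_(j < N) term j x)) = fun N => \sum_(j < N) cIm (term j x).
  by apply/funext => N; rewrite cIm_sum.
exact: (cvg_term (@normr_cIm_le R)).
Qed.

Lemma measurable_pointwise_sum : measurable_complex pointwise_sum.
Proof.
have ms N : measurable_complex (fun x => \sum_(j < N) term j x).
  by apply: measurable_complex_sum => j _; exact: measurable_term.
split; apply/measurable_EFinP.
  apply: (emeasurable_fun_cvg (fun N x => (cRe (\sum_(j < N) term j x))%:E)).
    by move=> N; apply/measurable_EFinP; exact: (ms N).1.
  by move=> x _; apply: cvg_EFin; [exact: nearW|exact: (cvg_pointwise_sum x).1].
apply: (emeasurable_fun_cvg (fun N x => (cIm (\sum_(j < N) term j x))%:E)).
  by move=> N; apply/measurable_EFinP; exact: (ms N).2.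
by move=> x _; apply: cvg_EFin; [exact: nearW|exact: (cvg_pointwise_sum x).2].
Qed.

Lemma pointwise_sum_L2 :
  (forall j, \int[mu]_x (normc (f j x) ^+ 2)%:E <= (8^-1 ^+ j)%:E)%E ->
  (L2norm mu pointwise_sum < +oo)%E.
Proof.
move=> fL2; apply: L2norm_lty; apply: (@le_lt_trans _ _ (4 * 4^-1 ^+ 0)%:E); last exact: ltry.
apply: (@L2_series_le _ _ _ mu _ (fun j x => normc (f j x) ^+ 2) xpredT 0) => //.
- apply: measurable_funX; exact/measurable_normc/measurable_pointwise_sum.
- by move=> x; exact: sqr_ge0.
- move=> j; apply: measurable_funX; exact/measurable_normc.
- by move=> j x; exact: sqr_ge0.
move=> x; set S := (X in (_ <= X)%E).
(* The bound is uniform in N, so it passes to the limit; an infinite [S] leaves nothing to prove. *)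
have SN N : ((normc (\sum_(j < N) term j x) ^+ 2)%:E <= S)%E.
  apply: (@le_trans _ _ (\sum_(0 <= j < N) (2 ^+ j.+1 * normc (f j x) ^+ 2)%:E)%E); last first.
    by apply: nneseries_lim_ge => j _ _; rewrite lee_fin !mulr_ge0 ?exprn_ge0 ?normc_ge0.
  rewrite sumEFin lee_fin big_mkord.
  apply: le_trans (sqr_sum_le (fun j => normc (f j x)) N).
  rewrite lerXn2r ?nnegrE ?normc_ge0 ?sumr_ge0//.
    by move=> j _; exact: normc_ge0.
  by apply: le_trans (normc_sum _ _ _) _; apply: ler_sum => j _; exact: normc_term.
have [cR cI] := cvg_pointwise_sum x.
have c2 : (normc (\sum_(j < N) term j x) ^+ 2) @[N --> \oo] --> normc (pointwise_sum x) ^+ 2.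
  rewrite sqr_normc2; under eq_fun do rewrite sqr_normc2 !expr2.
  by rewrite !expr2; apply: cvgD; apply: cvgM.
case: S SN => [r| |] SN; [|exact: leey|by have := SN 0%N].
rewrite lee_fin; have <- := cvg_lim (@Rhausdorff R) c2.
by apply: limr_le; [exact: cvgP c2|apply: nearW => N; rewrite -lee_fin].
Qed.

End absolute_sum.

(** * Transforms of the truncations *)

Section phys_sum.
Variables (R : realType) (n m : nat) (f : nat -> phys R n m -> R[i]) (Nj : nat -> nat).
Local Notation mu := (phys_measure R n m).
Hypothesis fi : forall j, integrable_complex mu (f j).
Hypothesis fL1 : forall j, \int[mu]_p normc (f j p) <= 8^-1 ^+ j.
Hypothesis shell : forall j p, f j p != 0 ->
  (Nj j)%:R ^+ 2 < \sum_(i < n) tnth p.1 i ^+ 2 < (Nj j).+1%:R ^+ 2.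

Lemma pointwise_sum_periodic :
  (forall j, Defs.periodic (f j)) -> Defs.periodic (pointwise_sum f).
Proof.
move=> pf x y k.
have aE : abs_sum f (x, [tuple tnth y l + (tnth k l)%:~R | l < m]) = abs_sum f (x, y).
  by rewrite /abs_sum; apply: eq_eseriesr => j _; rewrite pf.
have tE j : term f j (x, [tuple tnth y l + (tnth k l)%:~R | l < m]) = term f j (x, y).
  rewrite /term pf; congr (_%:C * _); rewrite !indicE; congr (_ _)%:R.
  by apply/idP/idP; rewrite !inE /summable_at /= aE.
rewrite /pointwise_sum; congr (_ +i* _); congr (limn _);
  by apply/funext => N; under eq_bigr do rewrite tE.
Qed.

(** Each packet lives in an open shell between consecutive integer spheres, so truncation at an
    integer radius keeps it or removes it. The partial sums converge under the integrable majorant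
    [abs_sum], and their transforms at z are constant from index J on. *)
Lemma fourierL1_truncate (r J : nat) (z : freq R n m) :
  (forall j, (J <= j)%N -> fourierL1 (f j) z = 0) ->
  fourierL1 (truncate r%:R (pointwise_sum f)) z = \sum_(j < J | (Nj j < r)%N) fourierL1 (f j) z.
Proof.
move=> fJ.
pose e p : R[i] := expi2pi (- pairing p z).
have me : measurable_complex e.
  apply: measurable_complex_expi2pi; apply: measurableT_comp => //.
  exact: measurable_pairing_phys.
have ne p : normc (e p) = 1 by exact: normc_expi2pi.
pose s N p := \sum_(j < N | (Nj j < r)%N) f j p.
pose u N p := s N p * e p.
pose v p := truncate r%:R (pointwise_sum f) p * e p.
have ms N : measurable_complex (s N).
  by apply: measurable_complex_sum => j _; exact: integrable_complex_measurable.
have mt : measurable_complex (truncate r%:R (pointwise_sum f)).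
  have mA : measurable_fun setT
      (fun p : phys R n m => \sum_(i < n) tnth p.1 i ^+ 2 <= r%:R ^+ 2).
    apply: measurable_fun_ler => //; apply: measurable_sum => i; apply: measurable_funX.
    exact: (measurableT_comp (measurable_tnth i) measurable_fst).
  have [mr mi] := measurable_pointwise_sum fi.
  split.
    rewrite (_ : (fun p => _) = fun p : phys R n m =>
      if \sum_(i < n) tnth p.1 i ^+ 2 <= r%:R ^+ 2 then cRe (pointwise_sum f p) else 0).
      by apply: measurable_fun_ifT.
    by apply/funext => p; rewrite /truncate; case: ifP.
  rewrite (_ : (fun p => _) = fun p : phys R n m =>
    if \sum_(i < n) tnth p.1 i ^+ 2 <= r%:R ^+ 2 then cIm (pointwise_sum f p) else 0).
    by apply: measurable_fun_ifT.
  by apply/funext => p; rewrite /truncate; case: ifP.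
have scvg p : summable_at f p ->
    cRe (s N p) @[N --> \oo] --> cRe (truncate r%:R (pointwise_sum f) p) /\
    cIm (s N p) @[N --> \oo] --> cIm (truncate r%:R (pointwise_sum f) p).
  move=> sp; rewrite /truncate; case: ifPn => pr.
    have sE N : s N p = \sum_(j < N) term f j p.
      rewrite /s big_mkcond; apply: eq_bigr => j _; rewrite term_summable//.
      case: ifPn => // jr; apply/eqP; rewrite eq_sym; apply: contraNT jr => /shell/andP[lo _].
      have := lt_le_trans lo pr; by rewrite ltr_pXn2r ?nnegrE// ltr_nat.
    have [cR cI] := cvg_pointwise_sum f p.
    by split; under eq_fun do rewrite sE.
  have sE N : s N p = 0.
    apply: big1 => j jr; apply/eqP; apply: contraNT pr => /shell/andP[_ hi].
    by apply: le_trans (ltW hi) _; rewrite lerXn2r ?nnegrE// ler_nat.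
  by split; under eq_fun do rewrite sE; exact: cvg_cst.
have uvR : {ae mu, forall p, cRe (u N p) @[N --> \oo] --> cRe (v p)}.
  apply: filterS (ae_summable fi fL1) => p /scvg[cR cI].
  under eq_fun do rewrite cReM; rewrite cReM.
  by apply: cvgB; apply: cvgM => //; exact: cvg_cst.
have uvI : {ae mu, forall p, cIm (u N p) @[N --> \oo] --> cIm (v p)}.
  apply: filterS (ae_summable fi fL1) => p /scvg[cR cI].
  under eq_fun do rewrite cImM; rewrite cImM.
  by apply: cvgD; apply: cvgM => //; exact: cvg_cst.
have mU N : measurable_complex (u N) by exact: measurable_complexM.
have mV : measurable_complex v by exact: measurable_complexM.
have bd N p : ((normc (u N p))%:E <= abs_sum f p)%E.
  apply: le_trans (abs_sum_ge f N p); rewrite lee_fin Normc.normcM ne mulr1.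
  apply: le_trans (normc_sum _ _ _) _; rewrite big_mkcond; apply: ler_sum => j _.
  by case: ifP => // _; exact: normc_ge0.
have [_ cR cI] := integral_complex_cvg mU mV uvR uvI (integrable_abs_sum fi fL1) bd.
have uE N : (J <= N)%N ->
    integral_complex mu (u N) = \sum_(j < J | (Nj j < r)%N) fourierL1 (f j) z.
  move=> JN; rewrite -(@big_ord_support _ (fun j => fourierL1 (f j) z) (fun j => (Nj j < r)%N) N J)//; last first.
    by move=> j Nj'; apply: fJ; exact: leq_trans Nj'.
  rewrite big_mkcond /=.
  have -> : u N = fun p => \sum_(j < N) (if (Nj j < r)%N then f j p * e p else 0).
    apply/funext => p; rewrite /u /s big_mkcond mulr_suml; apply: eq_bigr => j _.
    by case: ifP => // _; rewrite mul0r.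
  rewrite integral_complex_sum => [|j].
    apply: eq_bigr => j _; case: (Nj j < r)%N => //.
    rewrite (_ : (fun=> 0) = fun p : phys R n m => 0 * f j p); last by apply/funext => p; rewrite mul0r.
    by rewrite integral_complexZ// mul0r.
  case: (Nj j < r)%N.
    rewrite (_ : (fun p => _) = fun p => e p * f j p); last by apply/funext => p; rewrite mulrC.
    by apply: integrable_complexMb => // p; rewrite ne.
  rewrite (_ : (fun=> 0) = fun p : phys R n m => 0 * f j p); last by apply/funext => p; rewrite mul0r.
  exact: integrable_complexZ.
have cstR : cRe (integral_complex mu (u N)) @[N --> \oo] -->
    cRe (\sum_(j < J | (Nj j < r)%N) fourierL1 (f j) z).
  by apply: cvg_near_cst; exists J => // N JN; rewrite (uE N JN).
have cstI : cIm (integral_complex mu (u N)) @[N --> \oo] -->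
    cIm (\sum_(j < J | (Nj j < r)%N) fourierL1 (f j) z).
  by apply: cvg_near_cst; exists J => // N JN; rewrite (uE N JN).
apply: complex_ext.
  exact: (cvg_unique (@Rhausdorff R) cR cstR).
exact: (cvg_unique (@Rhausdorff R) cI cstI).
Qed.

End phys_sum.

(** * Almost everywhere divergence *)

Section null_sets.
Variable R : realType.
Local Notation leb := (@lebesgue_measure R).

Lemma lebesgue_sqr_eq_null (c : R) : leb [set x : R | x ^+ 2 = c] = 0%E.
Proof.
apply: countable_lebesgue_measure0; apply: finite_set_countable.
apply: (@sub_finite_set _ _ [set Num.sqrt c; - Num.sqrt c]); last exact: finite_set2.
move=> x /= <-; rewrite sqrtr_sqr; case: (lerP 0 x) => x0; [left|right].
  by rewrite ger0_norm.
by rewrite ltr0_norm// opprK.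
Qed.

Lemma measurable_sum_sqr k :
  measurable_fun setT (fun x : k.-tuple (measurableTypeR R) => \sum_(i < k) tnth x i ^+ 2 : R).
Proof. by apply: measurable_sum => i; apply: measurable_funX; exact: measurable_tnth. Qed.

(** When the other coordinates are fixed, at most two values of the first lie on the sphere; Fubini
    with the first coordinate innermost concludes. *)
Lemma sphere_null k (c : R) : tuple_measure leb k.+1
  [set x : k.+1.-tuple (measurableTypeR R) | \sum_(i < k.+1) tnth x i ^+ 2 = c] = 0%E.
Proof.
set A := [set x | _].
have mA : measurable A.
  rewrite -[A]setTI; exact: (@measurable_sum_sqr k.+1 measurableT [set c] (measurable_set1 c)).
pose consp (p : measurableTypeR R * k.-tuple (measurableTypeR R)) := cons_tuple p.1 p.2.
have mB : measurable (consp @^-1` A).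
  by rewrite -[X in measurable X]setTI; apply: measurable_cons.
change ((leb \x tuple_measure leb k)%E (consp @^-1` A) = 0%E).
rewrite (@product_measure_unique _ _ _ _ R leb (tuple_measure leb k)
  (leb \x^ tuple_measure leb k)%E)//; last by move=> *; exact: product_measure2E.
rewrite /product_measure2; apply: integral0_eq => y _ /=.
apply/eqP; rewrite eq_le measure_ge0 andbT -(lebesgue_sqr_eq_null (c - \sum_(i < k) tnth y i ^+ 2)).
apply: le_measure; rewrite ?inE; [exact: measurable_ysection| |].
  rewrite -[X in measurable X]setTI.
  have mx : measurable_fun setT (fun x : R => x ^+ 2) by exact: measurable_funX.
  exact: (mx measurableT _ (measurable_set1 _)).
move=> x; rewrite /ysection /= inE /A /= big_ord_recl /= => <-.
by rewrite (tnth_nth 0) /= [X in _ + X - _](eq_bigr (fun i => tnth y i ^+ 2)) ?addrK// => i _;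
  rewrite !(tnth_nth 0).
Qed.

Context d1 d2 (T1 : measurableType d1) (T2 : measurableType d2).
Variables (m1 : {sigma_finite_measure set T1 -> \bar R})
  (m2 : {sigma_finite_measure set T2 -> \bar R}).

Lemma ae_fst (P : T1 -> Prop) :
  {ae m1, forall x, P x} -> {ae (m1 \x m2)%E, forall p, P p.1}.
Proof.
move=> [A [mA A0 PA]]; exists (A `*` setT); split; first exact: measurableX.
  by apply: etrans (product_measure1E _ _ mA measurableT) _; rewrite [X in (X * _)%E](A0 : m1 A = 0%E) mul0e.
by move=> [x y] /= nP; split => //; apply: PA.
Qed.

Lemma ae_snd (P : T2 -> Prop) :
  {ae m2, forall y, P y} -> {ae (m1 \x m2)%E, forall p, P p.2}.
Proof.
move=> [A [mA A0 PA]]; exists (setT `*` A); split; first exact: measurableX.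
  by apply: etrans (product_measure1E _ _ measurableT mA) _; rewrite [X in (_ * X)%E](A0 : m2 A = 0%E) mule0.
by move=> [x y] /= nP; split => //; apply: PA.
Qed.

End null_sets.

(* Writing j + 1 = 2 ^ a * (2 i + 1), the index j is sent to the element coded by a. *)
Lemma infinitely_often (C : countType) (P : C -> Prop) (c0 : C) : P c0 ->
  exists phi : nat -> C, (forall j, P (phi j)) /\
    forall c, P c -> forall J, exists2 j, (J <= j)%N & phi j = c.
Proof.
move=> Pc0.
exists (fun j => if unpickle (logn 2 j.+1) is Some c then if `[< P c >] then c else c0 else c0).
split=> [j|c Pc J].
  by case: unpickle => [c|] //; case: asboolP.
pose o := (2 ^ pickle c * (2 * J).+1)%N.
have o0 : (0 < o)%N by rewrite muln_gt0 expn_gt0.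
exists o.-1.
  rewrite -ltnS prednK//; apply: leq_trans (leq_pmull _ _); last by rewrite expn_gt0.
  by rewrite ltnS leq_pmull.
rewrite prednK// /o lognM ?expn_gt0// lognX logn_prime// eqxx muln1.
rewrite [logn 2 (2 * J).+1]lognE /= dvdn2 /= oddM /= addn0 pickleK.
by case: asboolP.
Qed.

(** * Covering almost every point by countably many locations *)

Section cover.
Variables (R : realType) (n' : nat) (C1 : R -> R).
Local Notation n := n'.+1.
Hypothesis C1P : forall rho, 0 < rho <= 1 -> 0 < C1 rho <= rho.

(** Shell index, centre and radius; rational data make the locations enumerable. *)
Definition config : Type := (nat * n.-tuple rat * rat)%type.
HB.instance Definition _ := Countable.on config.
Definition shell_index (c : config) : nat := c.1.1.
Definition center (c : config) (i : 'I_n) : R := ratr (tnth c.1.2 i).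
Definition radius (c : config) : R := ratr c.2.

Definition in_shell (c : config) : Prop :=
  0 < radius c <= 1 /\
  forall x : n.-tuple (measurableTypeR R), (forall i, `|tnth x i - center c i| < radius c) ->
    (shell_index c)%:R ^+ 2 < \sum_(i < n) tnth x i ^+ 2 < (shell_index c).+1%:R ^+ 2.

Lemma cover m (p : phys R n m) :
  (forall N : nat, \sum_(i < n) tnth p.1 i ^+ 2 != N%:R ^+ 2) ->
  exists2 c, in_shell c & region (center c) (C1 (radius c)) p.
Proof.
set S := \sum_(i < n) _ => Sne.
have S0 : 0 <= S by apply: sumr_ge0 => i _; exact: sqr_ge0.
pose N := Num.truncn (Num.sqrt S).
have /andP[N1 N2] : N%:R <= Num.sqrt S < N.+1%:R by apply: truncn_itv; exact: sqrtr_ge0.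
have {}N1 : N%:R ^+ 2 < S.
  by rewrite lt_neqAle eq_sym Sne/= -(sqr_sqrtr S0) lerXn2r ?nnegrE ?sqrtr_ge0.
have {}N2 : S < N.+1%:R ^+ 2.
  by rewrite -(sqr_sqrtr S0) ltrXn2r ?nnegrE ?sqrtr_ge0.
pose g := Num.min (S - N%:R ^+ 2) (N.+1%:R ^+ 2 - S).
have g0 : 0 < g by rewrite lt_min !subr_gt0 N1.
have gS1 : g <= S - N%:R ^+ 2 by rewrite ge_min lexx.
have gS2 : g <= N.+1%:R ^+ 2 - S by rewrite ge_min lexx orbT.
(* Points of the ball are within 3 q of p in each coordinate, the centre being within 2 c1 <= 2 q.
   As 3 q <= 3, the sum of squares varies by at most 3 q B. *)
pose B := \sum_(i < n) (2 * `|tnth p.1 i| + 3).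
have B0 : 0 < B.
  rewrite /B big_ord_recl; apply: ltr_pwDl; first by rewrite ltr_wpDl// mulr_ge0.
  by apply: sumr_ge0 => i _; rewrite addr_ge0// mulr_ge0.
have r0 : 0 < Num.min 1 (g / (3 * B)).
  by rewrite lt_min ltr01/= divr_gt0// mulr_gt0.
have [q] := rat_in_itvoo r0; rewrite in_itv /= lt_min => /andP[q0 /andP[q1 q2]].
have {}q2 : 3 * ratr q * B < g.
  by move: q2; rewrite ltr_pdivlMr ?mulr_gt0// mulrCA -mulrA mulrCA mulrA.
have /andP[c0 cq] : 0 < C1 (ratr q) <= ratr q by apply: C1P; rewrite q0 ltW.
set c1 := C1 (ratr q) in c0 cq.
(* In the first coordinate the centre is placed ahead of p, by between c1 and 2 c1, as the region
   requires. *)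
have hv (i : 'I_n) : exists w : rat,
    if i == ord0 then tnth p.1 i + c1 < ratr w < tnth p.1 i + 2 * c1
    else tnth p.1 i - c1 < ratr w < tnth p.1 i + c1.
  case: (i == ord0).
    have [|w] := @rat_in_itvoo R (tnth p.1 i + c1) (tnth p.1 i + 2 * c1); first by lra.
    by rewrite in_itv /=; exists w.
  have [|w] := @rat_in_itvoo R (tnth p.1 i - c1) (tnth p.1 i + c1); first by lra.
  by rewrite in_itv /=; exists w.
have [v vP] := choice hv.
exists (N, [tuple v i | i < n], q); last first.
  split=> [|i i0]; rewrite /center /= tnth_mktuple.
    by have := vP ord0; rewrite eqxx /radius /= -/c1 => /andP[? ?]; apply/andP; split; lra.
  have := vP i; rewrite (negbTE i0) /radius /= -/c1 => /andP[? ?].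
  by rewrite ler_norml; apply/andP; split; lra.
split; first by rewrite /radius /= q0 ltW.
move=> x xv; rewrite /shell_index /=.
have dist i : `|tnth x i - tnth p.1 i| <= 3 * ratr q.
  have := xv i; rewrite /center /radius /= tnth_mktuple ltr_norml => /andP[? ?].
  have := vP i; rewrite ler_norml; case: ifP => _ /andP[? ?]; apply/andP; split; lra.
have : `|\sum_(i < n) tnth x i ^+ 2 - S| <= 3 * ratr q * B.
  rewrite -sumrB mulr_sumr; apply: le_trans (ler_norm_sum _ _ _) _; apply: ler_sum => i _.
  rewrite subr_sqr normrM; apply: ler_pM => //.
  have -> : tnth x i + tnth p.1 i = 2 * tnth p.1 i + (tnth x i - tnth p.1 i) by ring.
  apply: le_trans (ler_normD _ _) _; rewrite normrM ger0_norm// lerD2l.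
  by apply: le_trans (dist i) _; lra.
by rewrite ler_norml => /andP[? ?]; apply/andP; split; lra.
Qed.

(** The enumeration of locations needs one as a default. The point (1/2, 0, ..., 0) lies on no
    integer sphere, so [cover] supplies it. *)
Lemma in_shell_inhabited : exists c, in_shell c.
Proof.
pose p : phys R n 0 := ([tuple if i == ord0 then 2^-1 else 0 | i < n], [tuple]).
have [|c cP _] := @cover 0 p; last by exists c.
move=> N; rewrite big_ord_recl big1 => [|i _]; last by rewrite !tnth_mktuple expr0n.
rewrite tnth_mktuple addr0 /=; apply/eqP.
case: N => [|N].
  by rewrite expr0n => /eqP; rewrite sqrf_eq0 invr_eq0 pnatr_eq0.
move/eqP; rewrite eqrXn2 ?invr_ge0// => /eqP e.
have : 1 <= N.+1%:R :> R by rewrite ler1n.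
by rewrite -e; lra.
Qed.

End cover.

Lemma integral_le_Rintegral d (T : measurableType d) (R : realType)
    (mu : {measure set T -> \bar R}) (g : T -> R) (e : R) :
  mu.-integrable setT (EFin \o g) -> \int[mu]_x g x <= e -> (\int[mu]_x (g x)%:E <= e%:E)%E.
Proof.
move=> ig ge; rewrite -[leLHS]fineK ?lee_fin//.
exact: integrable_fin_num.
Qed.

(** * The lacunary sum and its properties *)

Section assembly.
Variables (R : realType) (n' m : nat) (eta1 : R -> R) (s : R) (i0 : 'I_m).
Local Notation n := n'.+1.
Local Notation circ := (circle_measure R).
Variables (phi : nat -> config n') (C1 : R -> R) (f : nat -> phys R n m -> R[i])
  (F : nat -> freq R n m -> R[i]) (T ts : nat -> seq R)
  (W : nat -> m.-tuple (measurableTypeR R) -> R).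
Hypothesis ceta : cutoff eta1.
Hypothesis C1P : forall rho, 0 < rho <= 1 -> 0 < C1 rho <= rho.
Hypothesis phiP : forall j, in_shell R (phi j).
Hypothesis phi_io : forall c, in_shell R c -> forall J, exists2 j, (J <= j)%N & phi j = c.
Hypothesis spec : forall j,
  packet_spec eta1 s (radius R (phi j)) (C1 (radius R (phi j))) (center R (phi j)) (128^-1 ^+ j)
    (j%:R + 4 + \sum_(l < j) 2 * \int[freq_measure R n m]_z normc (F l z))
    (ts j) j (f j) (F j) (T j) (W j).
Hypothesis tsP : forall j l t, (l < j)%N -> t \in T l -> t \in ts j.

Let le_eps (a b : R) j : 0 < b -> b <= a -> a^-1 ^+ j <= b^-1 ^+ j.
Proof.
move=> b0 ba; have a0 : 0 < a by exact: lt_le_trans ba.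
by rewrite lerXn2r ?nnegrE ?invr_ge0 ?(ltW a0) ?(ltW b0)// lef_pV2.
Qed.

(** 128 = 16 * 8: the factor 16^j is spent in the almost everywhere bound on the majorants, and 8^-j
    serves for the L^1 and L^2 sums. *)
Let eps8 j : 128^-1 ^+ j <= 8^-1 ^+ j :> R.
Proof. by apply: le_eps => //; rewrite ler_nat. Qed.

Let fi j : integrable_complex (phys_measure R n m) (f j) := spec_integrable (spec j).
Let Fi j : integrable_complex (freq_measure R n m) (F j) := spec_hat_integrable (spec j).

Let Fs j z : F j z != 0 -> (2 ^ j <= `|tnth z.2 i0|)%N.
Proof. exact: (spec_hat_support (spec j)). Qed.

Let fL1 j : \int[phys_measure R n m]_p normc (f j p) <= 8^-1 ^+ j.
Proof. exact: le_trans (spec_L1 (spec j)) (eps8 j). Qed.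

Let fL2 j : (\int[phys_measure R n m]_p (normc (f j p) ^+ 2)%:E <= (8^-1 ^+ j)%:E)%E.
Proof.
apply: integral_le_Rintegral; first exact: (spec_L2i (spec j)).
exact: le_trans (spec_L2 (spec j)) (eps8 j).
Qed.

Let FL2 j : (\int[freq_measure R n m]_z (1 * normc (F j z) ^+ 2)%:E <= (8^-1 ^+ j)%:E)%E.
Proof.
under eq_integral do rewrite mul1r.
apply: integral_le_Rintegral; first exact: (spec_hat_L2i (spec j)).
exact: le_trans (spec_hat_L2 (spec j)) (eps8 j).
Qed.

Let FS j : (\int[freq_measure R n m]_z ((1 + sqnorm z) `^ s * normc (F j z) ^+ 2)%:E <=
  (8^-1 ^+ j)%:E)%E.
Proof.
apply: integral_le_Rintegral; first exact: (spec_sobolevi (spec j)).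
exact: le_trans (spec_sobolev (spec j)) (eps8 j).
Qed.

Let Nj j := shell_index (phi j).

Let shell j p : f j p != 0 ->
  (Nj j)%:R ^+ 2 < \sum_(i < n) tnth p.1 i ^+ 2 < (Nj j).+1%:R ^+ 2.
Proof.
move=> fp; have [_ h] := phiP j; apply: h => i; exact: (spec_support (spec j)).
Qed.

(** The error of the truncation at radius r is itself a sum of transforms, over the packets of shell
    index at least r, so that [hat_sum_L2] applies to it. *)
Let fhat r z : fourierL1 (truncate r%:R (pointwise_sum f)) z =
  hat_sum i0 F xpredT z - hat_sum i0 F (fun j => (r <= Nj j)%N) z.
Proof.
pose J := `|tnth z.2 i0|%N.
have FJ j : (J <= j)%N -> F j z = 0.
  move=> Jj; apply/eqP; apply: contraT => /Fs h.
  by have := leq_trans h Jj; rewrite leqNgt ltn_expl.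
rewrite (@fourierL1_truncate _ _ _ f Nj fi fL1 shell r J z) => [|j Jj]; last first.
  by rewrite (spec_fourier (spec j)) FJ.
rewrite /hat_sum -/J [in RHS](bigID (fun j : 'I_J => (Nj j < r)%N))/=.
rewrite [X in _ + X - _](eq_bigl (fun j : 'I_J => (r <= Nj j)%N)) => [|j]; last by rewrite -leqNgt.
by rewrite addrK; apply: eq_bigr => j _; rewrite (spec_fourier (spec j)).
Qed.

Lemma assembly_fourier_transform : fourier_transform (pointwise_sum f) (hat_sum i0 F xpredT).
Proof.
split; first exact: measurable_hat_sum.
apply: L2norm_cvg0 => e e0.
have q1 : `|4^-1| < 1 :> R by rewrite ger0_norm ?invr_ge0// invf_lt1// ltr1n.
have /cvgrPdist_lt/(_ e e0)[j0 _ hj] := cvg_geometric 4 q1.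
have {}hj : 4 * 4^-1 ^+ j0 <= e.
  have := hj j0; rewrite /= sub0r normrN /geometric /= ger0_norm ?mulr_ge0 ?exprn_ge0 ?invr_ge0//.
  by move/(_ (leqnn _))/ltW.
(* From this radius on the first [j0] packets are untouched, so the error starts at index [j0]. *)
exists (\max_(j < j0) (Nj j).+1)%N => // r /= hr.
under eq_integral do rewrite fhat subKr -[_ ^+ 2]mul1r.
apply: (@le_trans _ _ (4 * 4^-1 ^+ j0)%:E); last by rewrite lee_fin.
apply: (@hat_sum_L2 R n m i0 F Fi Fs (fun=> 1)) => // j rj.
rewrite leqNgt; apply/negP => jj.
have := leq_trans hr rj; rewrite leqNgt => /negP; apply.
by rewrite (leq_bigmax (Ordinal jj)).
Qed.

Lemma assembly_sobolev : sobolev s (pointwise_sum f) (hat_sum i0 F xpredT).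
Proof.
split.
- by apply: pointwise_sum_periodic => j; exact: (spec_periodic (spec j)).
- exact: measurable_pointwise_sum.
- exact: pointwise_sum_L2.
- exact: assembly_fourier_transform.
have w0 (z : freq R n m) : 0 < 1 + sqnorm z.
  by rewrite ltr_pwDl// addr_ge0// sumr_ge0// => i _; exact: sqr_ge0.
apply: L2norm_lty.
under eq_integral => z _.
  rewrite Normc.normcM normc_real ger0_norm ?powR_ge0// exprMn -[X in X * _]powR_mulrn ?powR_ge0//.
  rewrite -powRrM divfK//.
  over.
apply: (@le_lt_trans _ _ (4 * 4^-1 ^+ 0)%:E); last exact: ltry.
apply: (@hat_sum_L2 R n m i0 F Fi Fs (fun z => (1 + sqnorm z) `^ s)) => //.
- have ms : measurable_fun setT (fun z : freq R n m => 1 + sqnorm z : measurableTypeR R).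
    by apply: measurable_funD => //; exact: measurable_sqnorm.
  exact: (measurableT_comp (measurable_powR s) ms).
- by move=> z; exact: powR_ge0.
Qed.

Let w j (y : m.-tuple (measurableTypeR R)) : R[i] := (16 ^+ j * W j y)%:C.

(** A Borel-Cantelli argument: the integrals of 16^j W_j are summable, so almost everywhere their
    sum S is finite, and 16^j W_j <= S <= 4^j for large j. *)
Let ae_majorant : {ae tuple_measure circ m, forall y, exists J0, forall j, (J0 <= j)%N ->
  W j y <= 4^-1 ^+ j}.
Proof.
have wi j : integrable_complex (tuple_measure circ m) (w j).
  apply: integrable_complex_real.
  have := integrableZl measurableT (16 ^+ j) (spec_maji (spec j)).
  by apply: eq_integrable => // y _.
have w1 j : \int[tuple_measure circ m]_y normc (w j y) <= 8^-1 ^+ j.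
  have -> : \int[tuple_measure circ m]_y normc (w j y) =
      \int[tuple_measure circ m]_y (16 ^+ j * W j y).
    apply: eq_Rintegral => y _; rewrite normc_real ger0_norm//.
    by rewrite mulr_ge0 ?exprn_ge0//; exact: (spec_maj_ge0 (spec j)).
  rewrite RintegralZl//; last exact: (spec_maji (spec j)).
  apply: le_trans (ler_wpM2l _ (spec_maj (spec j))) _; first exact: exprn_ge0.
  by rewrite -exprMn (_ : 16 / 128 = 8^-1 :> R)//; field.
apply: filterS (ae_summable wi w1) => y sy.
have S0 : (0 <= abs_sum w y)%E by apply: nneseries_ge0 => j _ _; rewrite lee_fin normc_ge0.
pose S := fine (abs_sum w y).
have SE : abs_sum w y = S%:E by rewrite fineK// ge0_fin_numE.
have SS : 0 <= S by rewrite -lee_fin -SE.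
exists (Num.Def.archi_bound S) => j Jj.
have Sj : S <= 4 ^+ j.
  apply: le_trans (ltW (archi_boundP SS)) _; rewrite -natrX ler_nat.
  by apply: leq_trans Jj _; exact/ltnW/ltn_expl.
have : 16 ^+ j * W j y <= S.
  rewrite -lee_fin -SE; apply: le_trans (abs_sum_ge w j.+1 y); rewrite lee_fin big_ord_recr /=.
  apply: (@le_trans _ _ (normc (w j y))); last by rewrite lerDr sumr_ge0// => l _; exact: normc_ge0.
  by rewrite normc_real ler_norm.
move=> /le_trans/(_ Sj); rewrite mulrC -ler_pdivlMr ?exprn_gt0// => /le_trans; apply.
by rewrite -expr_div_n (_ : 4 / 16 = 4^-1 :> R)//; field.
Qed.

Lemma assembly_diverges : {ae @phys_measure R n m, forall p,
  ~ schrodinger_tends_to eta1 (hat_sum i0 F xpredT) p (pointwise_sum f p)}.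
Proof.
have ae1 : {ae tuple_measure (@lebesgue_measure R) n, forall x : n.-tuple (measurableTypeR R),
    forall N : nat, \sum_(i < n) tnth x i ^+ 2 != N%:R ^+ 2}.
  apply: ae_foralln => N; exists [set x | \sum_(i < n) tnth x i ^+ 2 = N%:R ^+ 2]; split.
  - rewrite -[X in measurable X]setTI.
    exact: (@measurable_sum_sqr R n measurableT [set N%:R ^+ 2] (measurable_set1 _)).
  - exact: sphere_null.
  by move=> x /= /negP; rewrite negbK => /eqP.
apply: filterS2 (ae_fst (tuple_measure circ m) ae1)
  (ae_snd (tuple_measure (@lebesgue_measure R) n) ae_majorant) => p px [J0 py].
apply: not_schrodinger_tends_to => N.
(* The location depends on p alone. Among the infinitely many packets placed there, one is taken
   beyond N and beyond the index [J0] after which the later packets are small for this y. *)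
have [c cP cr] := cover C1P px.
have [k kJ kc] := phi_io cP (maxn N J0).
have [t tT tl] : exists2 t, t \in T k &
    k%:R + 4 + \sum_(l < k) 2 * \int[freq_measure R n m]_z normc (F l z) <=
    normc (integral_complex (freq_measure R n m) (schrodinger_integrand (F k) t p)).
  by apply: (spec_large (spec k)); rewrite kc.
have /andP[t0 te] := spec_times (spec k) tT.
have kN : (N <= k)%N by apply: leq_trans kJ; exact: leq_maxl.
have kJ0 : (J0 <= k)%N by apply: leq_trans kJ; exact: leq_maxr.
have [td tk] : schrodinger_defined eta1 (hat_sum i0 F xpredT) t p /\
    k%:R <= normc (schrodinger eta1 (hat_sum i0 F xpredT) t p).
  apply: schrodinger_hat_sum_large => // j i kj.
  have := spec_tail (spec j) i p (tsP kj tT) => /le_trans/(_ (py j (leq_trans kJ0 (ltnW kj)))).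
  have -> : 4^-1 ^+ j = (2^-1 ^+ j) ^+ 2 :> R.
    by rewrite -exprM mulnC exprM; congr (_ ^+ _); field.
  by rewrite ler_pXn2r// ?nnegrE ?normc_ge0 ?exprn_ge0 ?invr_ge0.
exists t; split => //; last by apply: le_trans tk; rewrite ler_nat.
rewrite t0; apply: le_trans te _; apply: (@le_trans _ _ (2^-1 ^+ k)).
  by apply: le_eps => //; rewrite ler_nat.
by apply: ler_wiXn2l => //; rewrite invf_le1// ler1n.
Qed.

End assembly.

(** * Recursive choice of the packets *)

Section recursion.
Variables (P Q : Type) (A : P -> Q -> P) (g : nat -> P -> Q) (a0 : P).

(** The history on which a choice depends is summarised in an accumulator: [g] chooses from the
    index and the accumulator, and [A] records the choice. *)
Fixpoint stage (j : nat) : P := if j is l.+1 then A (stage l) (g l (stage l)) else a0.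

End recursion.

Theorem theorem1p3 (R : realType) (n m : nat) (eta1 : R -> R) (s : R) :
  (0 < n)%N -> (0 < m)%N -> cutoff eta1 ->
  s < (n + m)%:R / (2 * (n + m + 1)%:R) ->
  exists (f : phys R n m -> R[i]) (F : freq R n m -> R[i]),
    sobolev s f F /\
    {ae @phys_measure R n m, forall p, ~ schrodinger_tends_to eta1 F p (f p)}.
Proof.
case: n => // n' _ m0 ceta sP.
pose Q := ((phys R n'.+1 m -> R[i]) * (freq R n'.+1 m -> R[i]) * seq R *
  (m.-tuple (measurableTypeR R) -> R))%type.
pose ok rho c1 v eps M ts r0 (q : Q) :=
  packet_spec eta1 s rho c1 v eps M ts r0 q.1.1.1 q.1.1.2 q.1.2 q.2.
(* The region size is fixed as a function of the radius before any packet is chosen; outside (0, 1]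
   its value 0 is a placeholder. *)
have /choice[C1 C1P] (rho : R) : exists c1 : R, 0 < rho <= 1 -> 0 < c1 <= rho /\
    forall v eps M ts r0, 0 < eps -> exists q, ok rho c1 v eps M ts r0 q.
  have [/andP[r0 r1]|_] := boolP (0 < rho <= 1); last by exists 0.
  have [c1 c1P h] := packet_exists m0 ceta sP r0 r1.
  exists c1 => _; split => // v eps M ts l eps0.
  by have [f [F [T [W spec]]]] := h v eps M ts l eps0; exists (f, F, T, W).
have C1r rho : 0 < rho <= 1 -> 0 < C1 rho <= rho by move=> /C1P[].
have [c0 c0P] := in_shell_inhabited n' C1r.
have [phi [phiP phi_io]] := infinitely_often c0P.
have /choice[g gP] (x : nat * (R * seq R)) : exists q, ok (radius R (phi x.1))
    (C1 (radius R (phi x.1))) (center R (phi x.1)) (128^-1 ^+ x.1) (x.1%:R + 4 + x.2.1)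
    x.2.2 x.1 q.
  have [rP _] := phiP x.1; have [_ h] := C1P _ rP.
  by apply: h; rewrite exprn_gt0 ?invr_gt0.
(* The accumulator holds the part of the peak that has to outweigh the earlier packets, and the list
   of their times, at which all later packets have to be small. *)
pose next (a : R * seq R) (q : Q) : R * seq R :=
  (a.1 + 2 * \int[freq_measure R n'.+1 m]_z normc (q.1.1.2 z), a.2 ++ q.1.2).
pose st := stage next (fun j a => g (j, a)) (0, [::]).
pose pk j := g (j, st j).
have st1 j : (st j).1 = \sum_(l < j) 2 * \int[freq_measure R n'.+1 m]_z normc ((pk l).1.1.2 z).
  elim: j => [|j IH]; first by rewrite big_ord0.
  by rewrite big_ord_recr /= -IH.
have st2 j l t : (l < j)%N -> t \in (pk l).1.2 -> t \in (st j).2.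
  elim: j => // j IH; rewrite ltnS leq_eqVlt mem_cat => /predU1P[->|/IH h] tl.
    by rewrite tl orbT.
  by rewrite h.
have spec j : packet_spec eta1 s (radius R (phi j)) (C1 (radius R (phi j))) (center R (phi j))
    (128^-1 ^+ j)
    (j%:R + 4 + \sum_(l < j) 2 * \int[freq_measure R n'.+1 m]_z normc ((pk l).1.1.2 z))
    (st j).2 j (pk j).1.1.1 (pk j).1.1.2 (pk j).1.2 (pk j).2.
  by rewrite -st1; exact: (gP (j, st j)).
exists (pointwise_sum (fun j => (pk j).1.1.1)),
  (hat_sum (Ordinal m0) (fun j => (pk j).1.1.2) xpredT); split.
  exact: (assembly_sobolev (Ordinal m0) phiP spec).
exact: (assembly_diverges (Ordinal m0) ceta C1r phi_io spec st2).
Qed.
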